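(* Let $1\leq r\leq n-5$. The risk of estimators of the form $\hat\Sigma^+_t=\frac{n-r-4}{n}\left[S^++t\,\frac{SS^+}{\mathrm{tr}(S)}\right]$ for $t\in\mathbb{R}$ can be bounded in terms of the risk of $\hat\Sigma^+_{\mathrm{EM1}}=\frac{n-r-4}{n}S^+$ through $$E\left[\|\hat\Sigma^+_t-\Sigma^+\|_F^2\right]\leq E\left[\big\|\hat\Sigma^+_{\mathrm{EM1}}-\Sigma^+\big\|_F^2\right]+\frac{(n-r-4)r}{n^2}\left[(n-r-4)t^2-4(r-1)t\right]E\left[\frac1{\mathrm{tr}^{2}(S)}\right].$$ The constant that minimizes this upper bound is $t=2\frac{r-1}{n-r-4}$, and the corresponding estimator $\hat\Sigma^+_{\mathrm{EM2}}=\frac{n-r-4}{n}\left[S^++2\frac{r-1}{n-r-4}\frac{SS^+}{\mathrm{tr}(S)}\right]$ dominates $\hat\Sigma^+_{\mathrm{EM1}}$.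
   Context: Model: $X_1,\dots,X_n$ are i.i.d. from the $p$-dimensional normal distribution $N_p(\mu,\Sigma)$ with $\mu\in\mathbb{R}^p$ and $\Sigma$ (symmetric positive semidefinite) unknown, where $r=\mathrm{rk}\,\Sigma<\min(n,p)$. The sample mean is $\bar X=\frac1n\sum_{i=1}^n X_i$ and the sample covariance matrix is $S=\frac1n\sum_{i=1}^n (X_i-\bar X)(X_i-\bar X)^t$. $A^+$ denotes the Moore-Penrose pseudoinverse of a matrix $A$, and $\mathrm{tr}^2(A)=(\mathrm{tr}\,A)^2$. The estimation of $\Sigma^+$ is under the Frobenius loss $\|\hat\Sigma^+-\Sigma^+\|_F^2$, and the risk is the expected loss. ''Dominates'' is in the usual decision-theoretic sense with respect to this risk: the risk of the dominating estimator is no larger for every $(\mu,\Sigma)$ with $\mathrm{rk}\,\Sigma=r$, and strictly smaller for at least one.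
   Formalization: The risk bound is stated for t ≥ 0, or any real t if r = 1 (for r ≥ 2 and t < 0 it is false at every parameter); strict domination is claimed for r ≥ 2 only, since for r = 1 the optimal t is 0 and EM2 equals EM1, where just the non-strict risk inequality is stated. *)

(* Defs.v *)
From HB Require Import structures.
From mathcomp Require Import all_boot all_order all_algebra.
From mathcomp Require Import all_classical all_reals all_analysis.

Set Implicit Arguments.
Unset Strict Implicit.
Unset Printing Implicit Defensive.
Import Order.TTheory GRing.Theory Num.Theory.
Local Open Scope classical_set_scope.
Local Open Scope ring_scope.

Section matrices.
Variable R : realType.

(* The four Penrose equations. *)
Definition penrose m n (A : 'M[R]_(m, n)) (B : 'M[R]_(n, m)) : Prop :=
  [/\ A *m B *m A = A, B *m A *m B = B,
      (A *m B)^T = A *m B & (B *m A)^T = B *m A].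

(* The default value 0 is never used: see penrose_pinv and pinv_unique. *)
Definition pinv m n (A : 'M[R]_(m, n)) : 'M[R]_(n, m) :=
  xget 0 [set B | penrose A B].

Lemma penrose_unique m n (A : 'M[R]_(m, n)) (B C : 'M[R]_(n, m)) :
  penrose A B -> penrose A C -> B = C.
Proof.
move=> [ABA BAB sAB sBA] [ACA CAC sAC sCA].
have eAB : A *m B = A *m C.
  by rewrite -sAB -{1}ACA -mulmxA trmx_mul sAB sAC mulmxA ABA.
have eBA : B *m A = C *m A.
  by rewrite -sBA -{1}ACA -mulmxA mulmxA trmx_mul sBA sCA -mulmxA (mulmxA A B A) ABA.
by rewrite -BAB -mulmxA eAB mulmxA eBA CAC.
Qed.

Lemma mulmx_trmx_eq0 m n (A : 'M[R]_(m, n)) : A *m A^T = 0 -> A = 0.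
Proof.
move=> AA0; apply/matrixP => i j; rewrite mxE.
have /eqP : (A *m A^T) i i = 0 by rewrite AA0 mxE.
rewrite mxE psumr_eq0 => [|k _]; last by rewrite mxE -expr2 sqr_ge0.
by move=> /allP/(_ j (mem_index_enum j)); rewrite /= mxE mulf_eq0 orbb => /eqP.
Qed.

Lemma gram_unitmx m n (A : 'M[R]_(m, n)) : row_free A -> A *m A^T \in unitmx.
Proof.
move=> fA; rewrite -row_free_unit -kermx_eq0; apply/eqP.
set K := kermx _.
have KA : K *m A *m A^T = 0 by rewrite -mulmxA mulmx_ker.
have /mulmx_trmx_eq0 KA0 : (K *m A) *m (K *m A)^T = 0.
  by rewrite trmx_mul mulmxA KA mul0mx.
by apply: (row_free_inj fA); rewrite KA0 mul0mx.
Qed.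

Lemma penrose_full_rank m n k (C : 'M[R]_(m, k)) (F : 'M[R]_(k, n)) :
  row_free C^T -> row_free F -> exists B, penrose (C *m F) B.
Proof.
move=> /gram_unitmx; rewrite trmxK => uH /gram_unitmx uG.
set G := F *m F^T in uG; set H := C^T *m C in uH.
have sG : G^T = G by rewrite trmx_mul trmxK.
have sH : H^T = H by rewrite trmx_mul trmxK.
pose B := F^T *m invmx G *m invmx H *m C^T.
have AB : C *m F *m B = C *m invmx H *m C^T.
  by rewrite /B !mulmxA -(mulmxA C F) -/G mulmxK.
have BA : B *m (C *m F) = F^T *m invmx G *m F.
  by rewrite /B !mulmxA -(mulmxA _ C^T C) -/H mulmxKV.
exists B; split.
- by rewrite AB !mulmxA -(mulmxA _ C^T C) -/H mulmxKV.
- by rewrite BA /B !mulmxA -(mulmxA _ F F^T) -/G mulmxKV.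
- by rewrite AB !trmx_mul trmxK trmx_inv sH mulmxA.
- by rewrite BA !trmx_mul trmxK trmx_inv sG mulmxA.
Qed.

Lemma penrose_pinv m n (A : 'M[R]_(m, n)) : penrose A (pinv A).
Proof.
have [||B] := @penrose_full_rank _ _ _ (col_base A) (row_base A).
- by rewrite /row_free mxrank_tr; exact: col_base_full.
- exact: row_base_free.
- by rewrite mulmx_base => AB; exact: (@xgetPex _ 0 _ (ex_intro _ B AB)).
Qed.

Lemma pinv_unique m n (A : 'M[R]_(m, n)) (B : 'M[R]_(n, m)) :
  penrose A B -> pinv A = B.
Proof. exact: penrose_unique (penrose_pinv A). Qed.

Definition frob_norm m n (A : 'M[R]_(m, n)) : R :=
  Num.sqrt (\sum_i \sum_j A i j ^+ 2).

Definition psdmx p (A : 'M[R]_p) : Prop :=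
  A^T = A /\ forall v : 'cV[R]_p, 0 <= (v^T *m A *m v) 0 0.

End matrices.

Section normal_sample.
Variable R : realType.

Definition mutually_independent d d' (T : measurableType d)
    (T' : measurableType d') (P : probability T R) (I : finType)
    (X : I -> {mfun T >-> T'}) : Prop :=
  forall (J : {set I}) (B : I -> set T'),
    (forall i, i \in J -> measurable (B i)) ->
    P (\bigcap_(i in [set` J]) (X i @^-1` B i)) =
    (\prod_(i in J) P (X i @^-1` B i))%E.

Definition standard_normal d (T : measurableType d) (P : probability T R) k
    (Z : 'I_k -> {mfun T >-> R}) : Prop :=
  mutually_independent P Z /\
  forall j (B : set R), measurable B -> distribution P (Z j) B = normal_prob 0 1 B.

Definition vec p (x : p.-tuple R) : 'cV[R]_p := \col_j tnth x j.

(* Sigma may be singular, so the law has in general no density: X follows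
   N_p(mu, Sigma) when X has the law of mu + A Z, where Z has independent
   standard normal entries and A A^T = Sigma. *)
Definition multivariate_normal d (T : measurableType d) (P : probability T R) p
    (X : {mfun T >-> p.-tuple R}) (mu : 'cV[R]_p) (Sigma : 'M[R]_p) : Prop :=
  exists (k : nat) (A : 'M[R]_(p, k)) (d' : measure_display)
         (T' : measurableType d') (Q : probability T' R)
         (Z : 'I_k -> {mfun T' >-> R}),
    [/\ A *m A^T = Sigma, standard_normal Q Z &
        forall B : set (p.-tuple R), measurable B ->
          distribution P X B =
          Q [set w | B [tuple (mu + A *m \col_j Z j w) i 0 | i < p]]].

Definition iid_normal d (T : measurableType d) (P : probability T R) n p
    (X : 'I_n -> {mfun T >-> p.-tuple R})
    (mu : 'cV[R]_p) (Sigma : 'M[R]_p) : Prop :=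
  mutually_independent P X /\ forall i, multivariate_normal P (X i) mu Sigma.

End normal_sample.

Section estimators.
Variables (R : realType) (n p : nat).

Definition data := 'I_n -> 'cV[R]_p.

Definition sample_mean (x : data) : 'cV[R]_p := n%:R^-1 *: \sum_i x i.

Definition sample_cov (x : data) : 'M[R]_p :=
  n%:R^-1 *: \sum_i ((x i - sample_mean x) *m (x i - sample_mean x)^T).

Definition estimator := data -> 'M[R]_p.

Definition EM1 (r : nat) : estimator := fun x =>
  ((n%:R - r%:R - 4) / n%:R) *: pinv (sample_cov x).

Definition EMt (r : nat) (t : R) : estimator := fun x =>
  let S := sample_cov x in
  ((n%:R - r%:R - 4) / n%:R) *: (pinv S + (t / \tr S) *: (S *m pinv S)).

Definition t_opt (r : nat) : R := 2 * ((r%:R - 1) / (n%:R - r%:R - 4)).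

Definition EM2 (r : nat) : estimator := EMt r (t_opt r).

Definition parameter (r : nat) (mu : 'cV[R]_p) (Sigma : 'M[R]_p) : Prop :=
  psdmx Sigma /\ \rank Sigma = r.

(* Statistical experiment: one sample X on one measurable space, and one
   probability P mu Sigma per parameter. *)
Definition normal_model d (T : measurableType d) (r : nat)
    (P : 'cV[R]_p -> 'M[R]_p -> probability T R)
    (X : 'I_n -> {mfun T >-> p.-tuple R}) : Prop :=
  forall mu Sigma, parameter r mu Sigma -> iid_normal (P mu Sigma) X mu Sigma.

Definition sample d (T : measurableType d) (X : 'I_n -> {mfun T >-> p.-tuple R})
    (w : T) : data := fun i => vec (X i w).

Section risk.
Context d (T : measurableType d).
Variables (P : 'cV[R]_p -> 'M[R]_p -> probability T R).
Variables (X : 'I_n -> {mfun T >-> p.-tuple R}).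
Local Open Scope ereal_scope.

Definition risk (delta : estimator) (mu : 'cV[R]_p) (Sigma : 'M[R]_p) : \bar R :=
  'E_(P mu Sigma)[fun w =>
    (frob_norm (delta (sample X w) - pinv Sigma) ^+ 2)%R].

Definition dominates (r : nat) (delta1 delta2 : estimator) : Prop :=
  (forall mu Sigma, parameter r mu Sigma ->
     risk delta1 mu Sigma <= risk delta2 mu Sigma) /\
  (exists mu Sigma, parameter r mu Sigma /\
     risk delta1 mu Sigma < risk delta2 mu Sigma).

Definition risk_bound (r : nat) (t : R) (mu : 'cV[R]_p) (Sigma : 'M[R]_p) : \bar R :=
  risk (EM1 r) mu Sigma +
  ((n%:R - r%:R - 4) * r%:R / n%:R ^+ 2 *
     ((n%:R - r%:R - 4) * t ^+ 2 - 4 * (r%:R - 1) * t))%:E *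
  'E_(P mu Sigma)[fun w => ((\tr (sample_cov (sample X w)) ^+ 2)^-1)%R].

End risk.
End estimators.

(* Main.v *)
(** Only the field [K R C h] is ever differentiated, where [K] is the pseudoinverse of [Sigma],
    [C = Pi X H] the centred data ([Pi] the projection on the range of [Sigma], [H] the centring
    matrix), [V = C C^T], [R = (V + e I)^-1] and [h] is scalar. Writing [X_i = mu + A Z_i] with
    independent standard normal coordinates [Z_il], Stein's identity for a possibly singular law
    follows from one-dimensional integration by parts in each [Z_il]; neither a density nor the
    Wishart law is needed, and the regularization [e > 0] makes every integrand bounded.
    With [h = tr (Pi R)] the identity gives [(n - r - 4) E (tr (Pi R))^2 <= tr K * E tr (Pi R)],
    a bound uniform in [e], so [V] has rank [r] almost surely and [E (tr V^+)^2] is finite.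
    With [h = 1 / (e + tr V)] and [e --> 0] it gives
    [tr K * E (1 / tr V) = E ((n - r - 2) tr V^+ / tr V - 2 r / (tr V)^2)].
    Expanding the loss, this evaluates the cross term, and [tr V * tr V^+ >= r^2] (an equality
    if [r = 1]) gives the bound. *)

Require Import Defs.
From HB Require Import structures.
From mathcomp Require Import all_boot all_order all_algebra.
From mathcomp Require Import all_classical all_reals all_analysis.
From mathcomp Require Import measurable_realfun ring lra.

Set Implicit Arguments.
Unset Strict Implicit.
Unset Printing Implicit Defensive.
Import Order.TTheory GRing.Theory Num.Theory.
Import numFieldNormedType.Exports.
Local Open Scope classical_set_scope.
Local Open Scope ring_scope.

(* [pinv] is also a MathComp-Analysis name, for partial inverses of functions. *)
Local Notation pinv := Defs.pinv.

(** * Entrywise closure properties of matrix functions *)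

(** Once the cross term is evaluated, the bound exceeds the risk of [EMt r t] by [4 (n - r - 4) t]
    times the mean of [(tr V * tr V^+ - r^2) / (tr V)^2]. That mean is nonnegative, so the gap
    follows the sign of [t]: for [t < 0] the inequality survives only if the mean vanishes, which
    rank one guarantees. This is the origin of the condition [0 <= t \/ r = 1]. The constant [t_opt]
    is nonnegative, so the comparison of [EM2] with [EM1] stays within this condition; but for
    [r = 1] it is 0 and the two estimators coincide, whence strict improvement is claimed for
    [1 < r]. The number [n - r - 4] is the factor of the estimators and also the coefficient that
    controls the second moment of [tr V^+]. So [r + 5 <= n], which makes it positive, is at the same
    time the source of all the integrability. *)

Section entrywise.
Context {R : realType} {T : Type}.

(** Keeping the class [Q] abstract lets one set of closure lemmas serve boundedness, measurability,
    derivability along lines and continuity of matrix expressions. *)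
Definition fun_subring (Q : (T -> R) -> Prop) : Prop :=
  [/\ forall c, Q (fun=> c),
      forall f g, Q f -> Q g -> Q (fun x => f x + g x) &
      forall f g, Q f -> Q g -> Q (fun x => f x * g x)].

Definition entries (Q : (T -> R) -> Prop) m n (A : T -> 'M[R]_(m, n)) : Prop :=
  forall i j, Q (fun x => A x i j).

Variable Q : (T -> R) -> Prop.
Hypothesis HQ : fun_subring Q.

Lemma fun_subring_ext f g : (forall x, f x = g x) -> Q f -> Q g.
Proof. by move=> fg; rewrite (_ : g = f) //; apply/funext => x. Qed.

Lemma fun_subring_sum (I : Type) (s : seq I) (F : I -> T -> R) :
  (forall i, Q (F i)) -> Q (fun x => \sum_(i <- s) F i x).
Proof.
move=> QF; have [Qc QD QM] := HQ; elim: s => [|i s IH].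
  by apply: fun_subring_ext (Qc 0) => x; rewrite big_nil.
by apply: fun_subring_ext (QD _ _ (QF i) IH) => x; rewrite big_cons.
Qed.

Lemma fun_subring_prod (I : Type) (s : seq I) (F : I -> T -> R) :
  (forall i, Q (F i)) -> Q (fun x => \prod_(i <- s) F i x).
Proof.
move=> QF; have [Qc QD QM] := HQ; elim: s => [|i s IH].
  by apply: fun_subring_ext (Qc 1) => x; rewrite big_nil.
by apply: fun_subring_ext (QM _ _ (QF i) IH) => x; rewrite big_cons.
Qed.

Lemma entries_ext m n (A B : T -> 'M[R]_(m, n)) :
  (forall x, A x = B x) -> entries Q A -> entries Q B.
Proof. by move=> AB QA i j; apply: fun_subring_ext (QA i j) => x; rewrite AB. Qed.

Lemma entries_cst m n (A : 'M[R]_(m, n)) : entries Q (fun=> A).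
Proof. by case: HQ => Qc _ _ i j; exact: Qc. Qed.

Lemma entries_add m n (A B : T -> 'M[R]_(m, n)) :
  entries Q A -> entries Q B -> entries Q (fun x => A x + B x).
Proof.
case: HQ => _ QD _ QA QB i j.
by apply: fun_subring_ext (QD _ _ (QA i j) (QB i j)) => x; rewrite mxE.
Qed.

Lemma entries_scale m n (f : T -> R) (A : T -> 'M[R]_(m, n)) :
  Q f -> entries Q A -> entries Q (fun x => f x *: A x).
Proof.
case: HQ => _ _ QM Qf QA i j.
by apply: fun_subring_ext (QM _ _ Qf (QA i j)) => x; rewrite mxE.
Qed.

Lemma entries_opp m n (A : T -> 'M[R]_(m, n)) :
  entries Q A -> entries Q (fun x => - A x).
Proof.
case: HQ => Qc _ _ QA.
by apply: entries_ext (entries_scale (Qc (-1)) QA) => x; rewrite scaleN1r.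
Qed.

Lemma entries_tr m n (A : T -> 'M[R]_(m, n)) :
  entries Q A -> entries Q (fun x => (A x)^T).
Proof. by move=> QA i j; apply: fun_subring_ext (QA j i) => x; rewrite mxE. Qed.

Lemma entries_mul m n k (A : T -> 'M[R]_(m, n)) (B : T -> 'M[R]_(n, k)) :
  entries Q A -> entries Q B -> entries Q (fun x => A x *m B x).
Proof.
case: HQ => _ _ QM QA QB i j.
apply: (@fun_subring_ext (fun x => \sum_l A x i l * B x l j)).
  by move=> x; rewrite mxE.
by apply: fun_subring_sum => l; exact: QM.
Qed.

Lemma entries_trace n (A : T -> 'M[R]_n) :
  entries Q A -> Q (fun x => \tr (A x)).
Proof. by move=> QA; apply: fun_subring_sum => i; exact: QA. Qed.

Lemma entries_det n (A : T -> 'M[R]_n) :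
  entries Q A -> Q (fun x => \det (A x)).
Proof.
case: HQ => Qc _ QM QA; apply: fun_subring_sum => s.
by apply: QM => //; apply: fun_subring_prod => i; exact: QA.
Qed.

Lemma entries_adj n (A : T -> 'M[R]_n) :
  entries Q A -> entries Q (fun x => \adj (A x)).
Proof.
case: HQ => Qc _ QM QA i j.
apply: (@fun_subring_ext (fun x => cofactor (A x) j i)).
  by move=> x; rewrite mxE.
apply: QM => //; apply: entries_det => k l.
by apply: fun_subring_ext (QA (lift j k) (lift i l)) => x; rewrite !mxE.
Qed.

(** Cramer's formula: only the determinant gets inverted. Boundedness is not stable under such
    inverses, so the bounds on the resolvent are proved separately, from positivity. *)
Lemma entries_inv n (A : T -> 'M[R]_n) :
  (forall f, (forall x, f x != 0) -> Q f -> Q (fun x => (f x)^-1)) ->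
  (forall x, A x \in unitmx) ->
  entries Q A -> entries Q (fun x => invmx (A x)).
Proof.
move=> QV uA QA.
apply: (@entries_ext _ _ (fun x => (\det (A x))^-1 *: \adj (A x))).
  by move=> x; rewrite /invmx uA.
apply: entries_scale; last exact: entries_adj.
by apply: QV; [move=> x; have := uA x; rewrite unitmxE unitfE|exact: entries_det].
Qed.

End entrywise.

Section bounded_functions.
Context {R : realType} {T : Type}.

Definition fbounded (f : T -> R) : Prop := exists M, forall x, `|f x| <= M.

Lemma fun_subring_bounded : fun_subring fbounded.
Proof.
split=> [c|f g [M hM] [N hN]|f g [M hM] [N hN]]; first by exists `|c|.
- by exists (M + N) => x; apply: (le_trans (ler_normD _ _)); exact: lerD.
- by exists (M * N) => x; rewrite normrM ler_pM.
Qed.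

End bounded_functions.

Section measurable_functions.
Context {R : realType} d {T : measurableType d}.

Lemma fun_subring_measurable :
  fun_subring (fun f : T -> R => measurable_fun setT f).
Proof.
by split=> [c|f g mf mg|f g mf mg] //; [exact: measurable_funD|exact: measurable_funM].
Qed.

Lemma measurable_funV (f : T -> R) :
  measurable_fun setT f -> measurable_fun setT (fun x => (f x)^-1).
Proof.
move=> mf.
(* Squaring moves the argument to where [powR] with exponent -1 is the inverse; at a zero of [f]
   both sides are 0. *)
rewrite (_ : (fun x => _) = (fun x => f x * ((f x) ^+ 2) `^ (-1))).
  apply: measurable_funM => //; apply: (measurableT_comp (@measurable_powR R (-1))).
  exact: measurable_funX.
apply/funext => x; rewrite powR_inv1 ?sqr_ge0//.
have [->|fx0] := eqVneq (f x) 0; first by rewrite invr0 mul0r.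
by rewrite expr2 invfM mulrA mulfV // mul1r.
Qed.

End measurable_functions.

(** * Calculus along lines in a space of matrices *)

Section line_derivative.
Context {R : realType} {V : lmodType R}.

(* [Dg X Z] is the derivative of [g] at [X] in the direction [Z]. *)
Definition C1 (g : V -> R) (Dg : V -> V -> R) : Prop :=
  [/\ forall X Z (s : R), is_derive s 1 (fun u : R => g (X + u *: Z)) (Dg (X + s *: Z) Z),
      forall X Z, continuous (fun s : R => Dg (X + s *: Z) Z) &
      forall X a Z Z', Dg X (a *: Z + Z') = a * Dg X Z + Dg X Z'].

Definition C1mx m n (F : V -> 'M[R]_(m, n)) (DF : V -> V -> 'M[R]_(m, n)) : Prop :=
  forall i j, C1 (fun X => F X i j) (fun X Z => DF X Z i j).

Lemma C1_ext g g' Dg Dg' : (forall X, g X = g' X) ->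
  (forall X Z, Dg X Z = Dg' X Z) -> C1 g Dg -> C1 g' Dg'.
Proof.
move=> gg' DD'; rewrite (_ : g' = g); last exact/funext.
by rewrite (_ : Dg' = Dg) //; apply/funext => X; exact/funext.
Qed.

Lemma C1_continuous g Dg : C1 g Dg ->
  forall X Z, continuous (fun s : R => g (X + s *: Z)).
Proof.
case=> dg _ _ X Z s.
by apply/differentiable_continuous/derivable1_diffP; apply: ex_derive; exact: dg.
Qed.

Lemma C1_cst (c : R) : C1 (fun=> c) (fun _ _ => 0).
Proof.
split=> [X Z s|X Z|X a Z Z']; first exact: is_derive_cst.
- by move=> s; exact: cvg_cst.
- by rewrite mulr0 addr0.
Qed.

Lemma C1_add f Df g Dg : C1 f Df -> C1 g Dg ->
  C1 (fun X => f X + g X) (fun X Z => Df X Z + Dg X Z).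
Proof.
move=> [df cf lf] [dg cg lg]; split=> [X Z s|X Z s|X a Z Z'].
- by have := df X Z s; have := dg X Z s; move=> ? ?; exact: is_deriveD.
- by apply: cvgD; [exact: cf|exact: cg].
- by rewrite lf lg mulrDr addrACA.
Qed.

Lemma C1_mul f Df g Dg : C1 f Df -> C1 g Dg ->
  C1 (fun X => f X * g X) (fun X Z => Df X Z * g X + f X * Dg X Z).
Proof.
move=> Cf Cg; have [df cf lf] := Cf; have [dg cg lg] := Cg.
split=> [X Z s|X Z s|X a Z Z'].
- have := df X Z s; have := dg X Z s; move=> d1 d2.
  by apply: is_derive_eq; rewrite /GRing.scale /=; ring.
- apply: cvgD; apply: cvgM.
  + exact: cf.
  + exact: (C1_continuous Cg).
  + exact: (C1_continuous Cf).
  + exact: cg.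
- by rewrite lf lg; ring.
Qed.

Lemma C1_sum (I : Type) (r : seq I) (f : I -> V -> R) Df :
  (forall i, C1 (f i) (Df i)) ->
  C1 (fun X => \sum_(i <- r) f i X) (fun X Z => \sum_(i <- r) Df i X Z).
Proof.
move=> Cf; elim: r => [|i r IH].
  by apply: C1_ext (C1_cst 0) => *; rewrite big_nil.
by apply: C1_ext (C1_add (Cf i) IH) => *; rewrite big_cons.
Qed.

Lemma C1_inv f Df : (forall X, f X != 0) -> C1 f Df ->
  C1 (fun X => (f X)^-1) (fun X Z => - (f X)^-1 ^+ 2 * Df X Z).
Proof.
move=> f0 Cf; have [df cf lf] := Cf.
split=> [X Z s|X Z s|X a Z Z'].
- have d := df X Z s.
  have dv : derivable (fun u : R => f (X + u *: Z)) s 1 by apply: ex_derive; exact: d.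
  apply: DeriveDef; first by apply: derivableV => //; exact: f0.
  by rewrite deriveV //; rewrite derive_val /GRing.scale /= exprVn; ring.
- apply: cvgM; last exact: cf.
  apply: cvgN; rewrite expr2; under eq_fun do rewrite expr2.
  by apply: cvgM; apply: cvgV => //; exact: (C1_continuous Cf).
- by rewrite lf; ring.
Qed.

Lemma C1mx_cst m n (A : 'M[R]_(m, n)) : C1mx (fun=> A) (fun _ _ => 0).
Proof. by move=> i j; apply: C1_ext (C1_cst (A i j)) => *; rewrite ?mxE. Qed.

Lemma C1mx_add m n (F : V -> 'M[R]_(m, n)) DF G DG : C1mx F DF -> C1mx G DG ->
  C1mx (fun X => F X + G X) (fun X Z => DF X Z + DG X Z).
Proof.
by move=> CF CG i j; apply: C1_ext (C1_add (CF i j) (CG i j)) => *; rewrite mxE.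
Qed.

Lemma C1mx_tr m n (F : V -> 'M[R]_(m, n)) DF : C1mx F DF ->
  C1mx (fun X => (F X)^T) (fun X Z => (DF X Z)^T).
Proof. by move=> CF i j; apply: C1_ext (CF j i) => *; rewrite mxE. Qed.

Lemma C1mx_mul m n k (F : V -> 'M[R]_(m, n)) DF (G : V -> 'M[R]_(n, k)) DG :
  C1mx F DF -> C1mx G DG ->
  C1mx (fun X => F X *m G X) (fun X Z => DF X Z *m G X + F X *m DG X Z).
Proof.
move=> CF CG i j.
apply: C1_ext (C1_sum (index_enum _) (fun l => C1_mul (CF i l) (CG l j))) => *.
  by rewrite mxE.
by rewrite !mxE big_split.
Qed.

Lemma C1mx_trace n (F : V -> 'M[R]_n) DF : C1mx F DF ->
  C1 (fun X => \tr (F X)) (fun X Z => \tr (DF X Z)).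
Proof. by move=> CF; exact: (C1_sum _ (fun i => CF i i)). Qed.

(** Cramer's formula gives derivability of the entries; the value of the derivative is then forced
    by differentiating [invmx F *m F = 1], whose right side is constant. *)
Lemma C1mx_inv n (F : V -> 'M[R]_n) DF :
  (forall X, F X \in unitmx) -> C1mx F DF ->
  C1mx (fun X => invmx (F X)) (fun X Z => - (invmx (F X) *m DF X Z *m invmx (F X))).
Proof.
move=> uF CF.
pose Q (f : V -> R) := forall X Z (s : R), derivable (fun u : R => f (X + u *: Z)) s 1.
have HQ : fun_subring Q.
  split=> [c X Z s|f g Qf Qg X Z s|f g Qf Qg X Z s].
  - exact: derivable_cst.
  - exact: derivableD.
  - exact: derivableM.
have QV f : (forall X, f X != 0) -> Q f -> Q (fun X => (f X)^-1).
  by move=> f0 Qf X Z s; apply: derivableV => //; exact: f0.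
have QF : entries Q F.
  by move=> i j X Z s; have [d _ _] := CF i j; apply: ex_derive; exact: d.
have QI := entries_inv HQ QV uF QF.
pose W X Z (s : R) : 'M[R]_n := \matrix_(i, j) 'D_1 (fun u : R => invmx (F (X + u *: Z)) i j) s.
have dW X Z (s : R) i j :
    is_derive s 1 (fun u : R => invmx (F (X + u *: Z)) i j) (W X Z s i j).
  by rewrite mxE; apply: DeriveDef => //; exact: QI.
have WE X Z s : W X Z s =
    - (invmx (F (X + s *: Z)) *m DF (X + s *: Z) Z *m invmx (F (X + s *: Z))).
  set Y := X + s *: Z.
  suff WF : W X Z s *m F Y = - (invmx (F Y) *m DF Y Z).
    by rewrite -mulNmx -WF mulmxK.
  apply/matrixP => i j.
  pose f l (u : R) := invmx (F (X + u *: Z)) i l * F (X + u *: Z) l j.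
  have df l : is_derive s 1 (f l) (W X Z s i l * F Y l j + invmx (F Y) i l * DF Y Z l j).
    have d1 := dW X Z s i l; have [d _ _] := CF l j; have d2 := d X Z s.
    by apply: is_derive_eq; rewrite /GRing.scale /= -/Y; ring.
  have dsum : is_derive s 1 (\sum_l f l)
     (\sum_l (W X Z s i l * F Y l j + invmx (F Y) i l * DF Y Z l j)).
    exact: is_derive_sum.
  have sumE : \sum_l f l = cst ((1%:M : 'M[R]_n) i j).
    apply/funext => u; rewrite fct_sumE /f /= -(mulVmx (uF (X + u *: Z))) mxE.
    by [].
  rewrite sumE in dsum.
  have := @derive_val _ _ _ _ _ _ _ dsum; rewrite derive_cst => /esym/eqP.
  rewrite big_split /= addr_eq0 => /eqP eqW.
  by rewrite !mxE eqW.
move=> i j; split=> [X Z s|X Z|X a Z Z'].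
- by have := dW X Z s i j; rewrite WE.
- have c1 a b : continuous (fun s : R => invmx (F (X + s *: Z)) a b).
    move=> s; apply/differentiable_continuous/derivable1_diffP.
    exact: QI.
  pose Qc (f : R -> R) := continuous f.
  have HQc : fun_subring Qc.
    split=> [c s|f g Qf Qg s|f g Qf Qg s]; first exact: cvg_cst.
    + by apply: cvgD; [exact: Qf|exact: Qg].
    + by apply: cvgM; [exact: Qf|exact: Qg].
  apply: (entries_opp HQc); apply: (entries_mul HQc); last exact: c1.
  apply: (entries_mul HQc); first exact: c1.
  by move=> a b; have [_ c _] := CF a b; exact: c.
- have DFl : DF X (a *: Z + Z') = a *: DF X Z + DF X Z'.
    by apply/matrixP => k l; have [_ _ lin] := CF k l; rewrite lin !mxE.
  rewrite DFl mulmxDr mulmxDl -scalemxAr -scalemxAl.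
  by rewrite [LHS]mxE [X in - X]mxE [X in - (X + _)]mxE opprD [in RHS]mxE mulrN [X in _ = _ + X]mxE.
Qed.

End line_derivative.

(** * Stein's identity *)

Section one_dimensional_stein.
Context {R : realType}.
Local Notation mu := (@lebesgue_measure R).
Local Notation phi := (@normal_pdf R 0 1).
Local Notation gamma := (@normal_prob R 0 1).

Lemma normal_pdf01E : phi = fun x => normal_peak 1 * expR (- 2^-1 * x ^+ 2).
Proof.
apply/funext => x; rewrite normal_pdfE ?oner_eq0// /normal_fun subr0.
by congr (_ * expR _); field.
Qed.

Lemma is_derive_normal_pdf (x : R) : is_derive x 1 phi (- x * phi x).
Proof.
rewrite normal_pdf01E.
have d2 : is_derive x 1 (fun x => - 2^-1 * x ^+ 2 : R) (- x).
  have -> : (fun x => - 2^-1 * x ^+ 2 : R) = (- 2^-1) *: (@GRing.exp R ^~ 2).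
    by apply/funext => y.
  apply: is_derive_eq; rewrite /GRing.scale /=. by field.
have de := @is_derive1_comp _ expR _ x _ _ (is_derive_expR _) d2.
have -> : (fun x => normal_peak 1 * expR (- 2^-1 * x ^+ 2)) =
    normal_peak 1 *: (expR \o (fun x => - 2^-1 * x ^+ 2 : R)).
  by apply/funext => y.
by apply: is_derive_eq; rewrite /GRing.scale /=; ring.
Qed.

Lemma cvg_normal_pdf_y : phi x @[x --> +oo] --> (0 : R).
Proof.
rewrite normal_pdf01E -[X in _ --> X](mulr0 (normal_peak 1)).
apply: cvgM; first exact: cvg_cst.
(* From [(x - 1)^2 >= 0] one gets [x^2 / 2 >= x - 1/2 >= x - 2]. *)
apply: (@squeeze_cvgr _ _ _ _ (fun=> 0) (fun x => expR (- (x - 2)))).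
- near=> x; rewrite expR_ge0 /= ler_expR.
  have : 0 <= (x - 1) ^+ 2 by exact: sqr_ge0.
  nra.
- exact: cvg_cst.
- apply: (cvg_comp (fun x : R => x - 2) (fun x => expR (- x))); last exact: cvgr_expR.
  exact: cvg_addrr.
Unshelve. all: by end_near. Qed.

Lemma normal_pdfN (x : R) : phi (- x) = phi x.
Proof. by rewrite normal_pdf01E sqrrN. Qed.

(** The Radon-Nikodym derivative of [gamma] agrees almost everywhere with [phi], because both have
    the same integral over every measurable set. *)
Lemma ge0_integral_normal_prob (f : R -> R) :
  measurable_fun setT f -> (forall x, 0 <= f x) ->
  (\int[gamma]_x (f x)%:E = \int[mu]_x (f x * phi x)%:E)%E.
Proof.
move=> mf f0.
have dom := @normal_prob_dominates R 0 1.
rewrite -(Radon_Nikodym_SigmaFinite.change_of_variables dom) //; last first.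
  exact/measurable_EFinP.
apply: ae_eq_integral => //.
- apply: emeasurable_funM; first exact/measurable_EFinP.
  exact: measurable_int (Radon_Nikodym_SigmaFinite.f_integrable dom).
- apply/measurable_EFinP; apply: measurable_funM => //.
  exact: measurable_normal_pdf.
under [X in ae_eq _ _ _ X]eq_fun do rewrite EFinM.
apply: ae_eqe_mul2l.
apply: integral_ae_eq => //.
- exact: Radon_Nikodym_SigmaFinite.f_integrable.
- by apply/measurable_EFinP; exact: measurable_normal_pdf.
- by move=> E _ mE; rewrite -Radon_Nikodym_SigmaFinite.f_integral.
Qed.

Lemma integral_normal_prob (f : R -> R) :
  measurable_fun setT f -> gamma.-integrable setT (EFin \o f) ->
  mu.-integrable setT (EFin \o (fun x => f x * phi x)) /\
  (\int[gamma]_x (f x)%:E = \int[mu]_x (f x * phi x)%:E)%E.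
Proof.
move=> mf intf.
have mp : measurable_fun setT phi by exact: measurable_normal_pdf.
have key (g : R -> R) : measurable_fun setT g -> (forall x, 0 <= g x) ->
    gamma.-integrable setT (EFin \o g) ->
    mu.-integrable setT (EFin \o (fun x => g x * phi x)).
  move=> mg g0 /integrableP[_ ig]; apply/integrableP; split.
    by apply/measurable_EFinP; exact: measurable_funM.
  have gE : (\int[gamma]_x `|(g x)%:E| = \int[gamma]_x (g x)%:E)%E.
    by apply: eq_integral => x _; rewrite gee0_abs ?lee_fin.
  have gpE : (\int[mu]_x `|(g x * phi x)%:E| = \int[mu]_x (g x * phi x)%:E)%E.
    by apply: eq_integral => x _; rewrite gee0_abs ?lee_fin ?mulr_ge0 ?normal_pdf_ge0.
  by move: ig; rewrite /= gE gpE ge0_integral_normal_prob.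
have mp1 := measurable_funrpos mf.
have mn1 := measurable_funrneg mf.
have ip : gamma.-integrable setT (EFin \o f^\+) by exact: integrable_funrpos.
have in_ : gamma.-integrable setT (EFin \o f^\-) by exact: integrable_funrneg.
have ip' := key _ mp1 (funrpos_ge0 f) ip.
have in' := key _ mn1 (funrneg_ge0 f) in_.
have fE x : f x = f^\+ x - f^\- x by rewrite -[in LHS](funrposBneg f).
split.
  rewrite (_ : _ \o _ = ((EFin \o (fun x => f^\+ x * phi x)%R) \- (EFin \o (fun x => f^\- x * phi x)%R))%E).
    exact: integrableB.
  by apply/funext => x /=; rewrite -EFinB -mulrBl -fE.
under eq_integral do rewrite fE EFinB.
rewrite integralB // (ge0_integral_normal_prob mp1) //.
rewrite (ge0_integral_normal_prob mn1) // -integralB //.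
by apply: eq_integral => x _; rewrite -EFinB -mulrBl -fE.
Qed.

Lemma integrable_normal_id : gamma.-integrable setT (EFin \o id).
Proof.
apply/integrableP; split; first by apply/measurable_EFinP.
rewrite (@ge0_integral_normal_prob (fun x => `|x|)) //.
rewrite ge0_symfun_integralT /=; last 3 first.
- by move=> x; rewrite mulr_ge0 // normal_pdf_ge0.
- move=> x; apply: cvgM; first exact: norm_continuous.
  by apply: continuous_normal_pdf; rewrite oner_eq0.
- by move=> x /=; rewrite normrN normal_pdfN.
(* On the half line, [- phi] is a primitive of [x * phi x]. *)
rewrite -set_itvcy (@ge0_continuous_FTC2y _ _ (fun x => - phi x) _ 0).
- by rewrite -EFinB -EFinM ltry.
- by move=> x _; rewrite mulr_ge0 // normal_pdf_ge0.
- apply: continuous_subspaceT => x; apply: cvgM; first exact: norm_continuous.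
  by apply: continuous_normal_pdf; rewrite oner_eq0.
- by rewrite -[X in _ --> X]oppr0; apply: cvgN; exact: cvg_normal_pdf_y.
- move=> x _; apply: derivableN; by apply: ex_derive; exact: is_derive_normal_pdf.
- apply: cvgN; apply: cvg_at_right_filter.
  by apply: continuous_normal_pdf; rewrite oner_eq0.
- move=> x; rewrite in_itv /= andbT => x0.
  have := is_derive_normal_pdf x => d.
  rewrite derive1E deriveN; last by apply: ex_derive; exact: d.
  by rewrite derive_val gtr0_norm // mulNr opprK.
Qed.

(** Integration by parts: [g * phi] has derivative [g' * phi - x * g * phi] and vanishes at both
    ends. The integrals over [[-n, n]] tend to 0 by the fundamental theorem, and to the integral
    over the line by dominated convergence. *)
Lemma stein_normal (g g' : R -> R) (M M' : R) :
  (forall x : R, is_derive x 1 g (g' x)) -> continuous g' ->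
  (forall x, `|g x| <= M) -> (forall x, `|g' x| <= M') ->
  [/\ gamma.-integrable setT (EFin \o (fun x => x * g x)),
      gamma.-integrable setT (EFin \o g') &
      (\int[gamma]_x (x * g x)%:E = \int[gamma]_x (g' x)%:E)%E].
Proof.
move=> dg cg' gM gM'.
have cg : continuous g.
  by move=> x; apply/differentiable_continuous/derivable1_diffP; by apply: ex_derive; exact: dg.
have mg : measurable_fun setT g by exact: continuous_measurable_fun.
have mg' : measurable_fun setT g' by exact: continuous_measurable_fun.
have igx : gamma.-integrable setT (EFin \o (fun x => x * g x)).
  have iM : gamma.-integrable setT (EFin \o (fun x => M * x)).
    exact: (integrableZl _ M integrable_normal_id).
  apply: (le_integrable _ _ _ iM) => //.
  - by apply/measurable_EFinP; exact: measurable_funM.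
  - move=> x _ /=; rewrite lee_fin !normrM mulrC ler_wpM2r //.
    exact: le_trans (gM x) (ler_norm _).
have ig' : gamma.-integrable setT (EFin \o g').
  have g1 : gamma setT = 1%E by exact: probability_setT.
  apply: measurable_bounded_integrable => //.
    by change (gamma setT < +oo)%E; rewrite g1 ltry.
  by exists M'; split; [exact: num_real|move=> x Mx y _; exact: le_trans (gM' y) (ltW Mx)].
split=> //.
have [i1 ->] := integral_normal_prob (measurable_funM (@measurable_id _ _ setT) mg) igx.
have [i2 ->] := integral_normal_prob mg' ig'.
pose h x := g x * phi x.
pose h' x := g' x * phi x - x * g x * phi x.
have dh (x : R) : is_derive x 1 h (h' x).
  have dp := is_derive_normal_pdf x; have dgx := dg x.
  have -> : h = g * phi by [].
  by apply: is_derive_eq; rewrite /GRing.scale /= /h'; ring.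
have ch' : continuous h'.
  move=> x; have cp : {for x, continuous phi}.
    by apply: continuous_normal_pdf; rewrite oner_eq0.
  apply: cvgB; first by apply: cvgM; [exact: cg'|].
  by apply: cvgM => //; apply: cvgM; [exact: cvg_id|exact: cg].
have ih' : mu.-integrable setT (EFin \o h').
  rewrite (_ : EFin \o h' = ((EFin \o (fun x => g' x * phi x)%R) \- (EFin \o (fun x => x * g x * phi x)%R))%E).
    exact: integrableB.
  by apply/funext => x.
suff h'0 : (\int[mu]_x (h' x)%:E = 0)%E.
  have f1 := integrable_fin_num measurableT i1.
  have f2 := integrable_fin_num measurableT i2.
  have : (\int[mu]_x ((g' x * phi x)%:E - (x * g x * phi x)%:E) = 0)%E.
    by rewrite -[RHS]h'0; apply: eq_integral.
  rewrite integralB //= -(fineK f1) -(fineK f2) -EFinB => -[/eqP].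
  by rewrite subr_eq0 => /eqP ->.
have c1 : (\int[mu]_(x in `[(- n%:R)%R, n%:R]) (h' x)%:E)%E @[n --> \oo] -->
    (\int[mu]_x (h' x)%:E)%E.
  under eq_fun do rewrite integral_mkcond.
  apply: (@dominated_cvg _ _ _ mu setT _ _ _ (fun x => `|h' x|%:E)) => //.
  - move=> n.
    have mD : measurable `[(- n%:R : R), n%:R]%classic by exact: measurable_itv.
    have mh : measurable_fun `[(- n%:R : R), n%:R]%classic (EFin \o h').
      by apply: measurable_funTS; exact: (measurable_int mu ih').
    exact: ((measurable_restrictT _ mD).1 mh).
  - move=> x _; apply: cvg_near_cst; near=> n.
    rewrite patchE; case: ifPn => // /negP; rewrite in_setE /= in_itv /= -ler_norml.
    by case; near: n; exact: nbhs_infty_ger.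
  - exact: integrable_norm.
  - by move=> n x _; rewrite patchE; case: ifP => _ //; rewrite abse0 lee_fin.
have c2 : (\int[mu]_(x in `[(- n%:R)%R, n%:R]) (h' x)%:E)%E @[n --> \oo] --> 0%E.
  have : (h n%:R - h (- n%:R))%:E @[n --> \oo] --> 0%:E.
    apply: cvg_EFin; first by near=> n.
    have hM (x : R) : `|h x| <= M * phi x.
      by rewrite normrM (ger0_norm (normal_pdf_ge0 _ _ _)) ler_wpM2r // normal_pdf_ge0.
    have pn : M * phi n%:R + M * phi n%:R @[n --> \oo] --> (0 : R).
      have : phi n%:R @[n --> \oo] --> (0 : R).
        exact: (cvg_comp (fun n => n%:R) phi cvgr_idn cvg_normal_pdf_y).
      move=> c; rewrite -[X in _ --> X]addr0 -[X in _ --> X + X](mulr0 M).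
      by apply: cvgD; apply: cvgM => //; exact: cvg_cst.
    apply/cvgr0Pnorm_lt => e e0; move/cvgr0Pnorm_lt : pn => /(_ e e0).
    apply: filterS => n; apply: le_lt_trans.
    apply: (le_trans (ler_normB _ _)).
    apply: le_trans (ler_norm _); apply: lerD; first exact: hM.
    by rewrite -[phi n%:R]normal_pdfN; exact: hM.
  apply: cvg_trans; apply: near_eq_cvg; near=> n.
  have n0 : (- n%:R < n%:R :> R).
    by rewrite gtrN // ltr0n; near: n; exact: nbhs_infty_gt.
  rewrite (@continuous_FTC2 _ h' h) //.
  - exact: continuous_subspaceT.
  - have ch (x : R) : {for x, continuous h}.
      by apply/differentiable_continuous/derivable1_diffP; by apply: ex_derive; exact: dh.
    split; first by move=> x _; by apply: ex_derive; exact: dh.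
      exact/cvg_at_right_filter/ch.
    exact/cvg_at_left_filter/ch.
  - by move=> x _; rewrite derive1E; have := dh x => d; rewrite derive_val.
exact: cvg_unique c1 c2.
Unshelve. all: by end_near. Qed.

Section normal_law.
Variable m : {measure set R -> \bar R}.
Hypothesis m_normal : forall B, measurable B -> m B = gamma B.

(* [normal_prob] is a measure on [measurableTypeR R], whose display differs from
   that of the carrier [R] of the random variables. *)
Lemma integral_normal_law (f : R -> R) : measurable_fun setT f ->
  gamma.-integrable setT (EFin \o f) ->
  m.-integrable setT (EFin \o f) /\
  (\int[m]_x (f x)%:E = \int[gamma]_x (f x)%:E)%E.
Proof.
move=> mf intf.
have mid : measurable_fun setT (id : measurableTypeR R -> R) by move=> _ B mB; rewrite setTI.
pose g' : {measure set R -> \bar R} := pushforward gamma (id : measurableTypeR R -> R).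
pose g := g' mid.
have mE h : (\int[m]_x h x = \int[g]_x h x)%E.
  by apply: eq_measure_integral => B mB _; exact: m_normal.
have mEf : measurable_fun setT (EFin \o f) by exact/measurable_EFinP.
have ig : g.-integrable setT (EFin \o f) by apply: integrable_pushforward.
split; first by apply/integrableP; split=> //; rewrite mE; have /integrableP[] := ig.
by rewrite mE (integral_pushforward mid).
Qed.

Lemma integrable_normal_law_id : m.-integrable setT (EFin \o id).
Proof. exact: (integral_normal_law (@measurable_id _ _ setT) integrable_normal_id).1. Qed.

Lemma stein_normal_law (g g' : R -> R) (M M' : R) :
  (forall x : R, is_derive x 1 g (g' x)) -> continuous g' ->
  (forall x, `|g x| <= M) -> (forall x, `|g' x| <= M') ->
  (\int[m]_x (x * g x)%:E = \int[m]_x (g' x)%:E)%E.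
Proof.
move=> dg cg' gM gM'; have [i1 i2 e] := stein_normal dg cg' gM gM'.
have mg : measurable_fun setT g.
  apply: continuous_measurable_fun => x; apply/differentiable_continuous/derivable1_diffP.
  by apply: ex_derive; exact: dg.
have [_ ->] := integral_normal_law (measurable_funM (@measurable_id _ _ setT) mg) i1.
by have [_ ->] := integral_normal_law (continuous_measurable_fun cg') i2.
Qed.

End normal_law.

End one_dimensional_stein.

(** * Independence as invariance under resampling one coordinate *)

Definition update n (T : Type) (x : n.-tuple T) (i : 'I_n) (y : T) : n.-tuple T :=
  [tuple if j == i then y else tnth x j | j < n].

Lemma tnth_update n (T : Type) (x : n.-tuple T) (i : 'I_n) (y : T) j :
  tnth (update x i y) j = if j == i then y else tnth x j.
Proof. by rewrite tnth_mktuple. Qed.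

Section resampling.
Context (R : realType) (n : nat) d d' (T : measurableType d)
  (T' : measurableType d') (P : probability T R) (X : 'I_n -> {mfun T >-> T'}).

Definition joint (w : T) : n.-tuple T' := [tuple X j w | j < n].

Lemma measurable_joint : measurable_fun setT joint.
Proof.
apply/measurable_fun_tnthP => j.
rewrite (_ : _ \o _ = X j); first exact: measurable_funPT.
by apply/funext => w /=; rewrite tnth_mktuple.
Qed.

Lemma measurable_update (x : T -> n.-tuple T') (i : 'I_n) :
  measurable_fun setT x ->
  measurable_fun setT (fun z : T * T' => update (x z.1) i z.2).
Proof.
move=> /measurable_fun_tnthP mx; apply/measurable_fun_tnthP => j.
have [->|ji] := eqVneq j i.
  rewrite (_ : _ \o _ = snd) //.
  by apply/funext => z /=; rewrite tnth_update eqxx.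
rewrite (_ : _ \o _ = (fun w => tnth (x w) j) \o fst).
  exact: measurableT_comp (mx j) _.
by apply/funext => z /=; rewrite tnth_update (negbTE ji).
Qed.

Definition box (B : 'I_n -> set T') : set (n.-tuple T') :=
  [set x | forall j, B j (tnth x j)].

Definition boxes : set (set (n.-tuple T')) :=
  [set A | exists2 B, (forall j, measurable (B j)) & A = box B].

Lemma measurable_box B : (forall j, measurable (B j)) -> measurable (box B).
Proof.
move=> mB; rewrite (_ : box B = \big[setI/setT]_(j < n) ((@tnth n T' ^~ j) @^-1` B j)).
  apply: bigsetI_measurable => j _; rewrite -[X in measurable X]setTI.
  exact: measurable_tnth.
apply/seteqP; split => x; rewrite -bigcap_seq => h j; first by move=> _; exact: h.
by apply: h; rewrite /= mem_index_enum.
Qed.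

Lemma measurable_boxesE : measurable = <<s boxes >>.
Proof.
apply/seteqP; split => [A|]; last first.
  by apply: smallest_sub; [exact: sigma_algebra_measurable|move=> _ [B mB ->]; exact: measurable_box].
move: A; apply: smallest_sub; first exact: smallest_sigma_algebra.
rewrite -bigcup_seq => A [i _ [B mB <-]].
apply: sub_sigma_algebra; exists (fun j => if j == i then B else setT).
  by move=> j; case: ifP.
rewrite setTI; apply/seteqP; split => x /= h.
  by move=> j; case: eqP => // ->.
by have := h i; rewrite eqxx.
Qed.

Lemma setI_closed_boxes : setI_closed boxes.
Proof.
move=> _ _ [B mB ->] [C mC ->]; exists (fun j => B j `&` C j).
  by move=> j; exact: measurableI.
apply/seteqP; split => x /=; first by move=> [hB hC] j; split.
by move=> h; split => j; have [] := h j.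
Qed.

Hypothesis indep : mutually_independent P X.

(** The form in which independence is used: an independent fresh draw of coordinate [i] leaves the
    joint law unchanged. Both laws agree on boxes, which are stable under intersection and generate
    the sigma-algebra. *)
Lemma joint_resample (i : 'I_n) (A : set (n.-tuple T')) : measurable A ->
  pushforward P joint A =
  pushforward (P \x distribution P (X i))%E (fun z => update (joint z.1) i z.2) A.
Proof.
have mu := @measurable_update _ i measurable_joint.
have mj := measurable_joint.
pose m1' : {measure set _ -> \bar R} := pushforward P joint.
pose m1 := m1' mj.
pose m2' : {measure set _ -> \bar R} :=
    pushforward (P \x distribution P (X i))%E (fun z => update (joint z.1) i z.2).
pose m2 := m2' mu.
move=> mA; change (m1 A = m2 A).
apply: (measure_unique boxes (fun=> setT) measurable_boxesE setI_closed_boxes _ _ m1 m2) => //.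

- move=> _; exists (fun=> setT) => //.
  by apply/seteqP; split.
- by rewrite bigcup_const.
- move=> _ [B mB ->]; change (P (joint @^-1` box B) = (P \x distribution P (X i))%E
    ((fun z => update (joint z.1) i z.2) @^-1` box B)).
  (* [C] frees coordinate [i], whose constraint passes to the fresh draw. The two box probabilities
     then factor over all indices and over the indices other than [i]. *)
  pose C j := if j == i then setT else B j.
  have -> : (fun z => update (joint z.1) i z.2) @^-1` box B =
      (joint @^-1` box C) `*` B i.
    apply/seteqP; split => -[w y] /= h.
      split=> [j|]; last by have := h i; rewrite tnth_update eqxx.
      rewrite /C; case: eqP => // /eqP ji.
      by have := h j; rewrite tnth_update (negbTE ji).
    case: h => h hi j; rewrite tnth_update.
    by have := h j; rewrite /C; case: eqP => [->|].
  have mC j : measurable (C j) by rewrite /C; case: ifP.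
  rewrite product_measure1E //; last first.
    by rewrite -[X in measurable X]setTI; exact: measurable_joint (measurable_box mC).
  have capE D (J : {set 'I_n}) : (forall j, j \notin J -> D j = setT) ->
      joint @^-1` box D = \bigcap_(j in [set` J]) (X j @^-1` D j).
    move=> DT; apply/seteqP; split => w /= h j.
      by move=> _; have := h j; rewrite tnth_mktuple.
    rewrite tnth_mktuple; have [jJ|jJ] := boolP (j \in J); first exact: h.
    by rewrite DT.
  rewrite (capE _ [set: 'I_n]%SET) => [|j]; last by rewrite inE.
  rewrite (capE _ (~: [set i])%SET) => [|j]; last by rewrite !inE negbK /C => ->.
  rewrite indep // (bigD1 i) ?inE //= muleC; congr (_ * _)%E.
  rewrite [RHS]indep //.
  by apply: eq_big => j; rewrite !inE // /C => /negbTE ->.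
- move=> _; change (P (joint @^-1` setT) < +oo)%E.
  by rewrite preimage_setT probability_setT ltry.
Qed.

(** Fubini after resampling: to compare two expectations it suffices to compare integrals in one
    coordinate with the others frozen. It is used twice, for the normal coordinates of one
    observation and for the observations of the sample. *)
Lemma integral_joint_eq (i : 'I_n) (f g : n.-tuple T' -> R) :
  measurable_fun setT f -> measurable_fun setT g ->
  P.-integrable setT (EFin \o (f \o joint)) ->
  P.-integrable setT (EFin \o (g \o joint)) ->
  (forall w, \int[distribution P (X i)]_y (f (update (joint w) i y))%:E =
             \int[distribution P (X i)]_y (g (update (joint w) i y))%:E)%E ->
  (\int[P]_w (f (joint w))%:E = \int[P]_w (g (joint w))%:E)%E.
Proof.
have mu := @measurable_update _ i measurable_joint.
have mj := measurable_joint.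
have key (h : n.-tuple T' -> R) : measurable_fun setT h -> P.-integrable setT (EFin \o (h \o joint)) ->
    (\int[P]_w (h (joint w))%:E =
     \int[P]_w \int[distribution P (X i)]_y (h (update (joint w) i y))%:E)%E.
  move=> mh ih.
  pose m1' : {measure set _ -> \bar R} := pushforward P joint.
  pose m1 := m1' mj.
  pose m2' : {measure set _ -> \bar R} :=
    pushforward (P \x distribution P (X i))%E (fun z => update (joint z.1) i z.2).
  pose m2 := m2' mu.
  have mEh : measurable_fun setT (EFin \o h) by exact/measurable_EFinP.
  have i1 : m1.-integrable setT (EFin \o h) by apply: integrable_pushforward.
  have i2 : m2.-integrable setT (EFin \o h).
    apply/integrableP; split => //.
    have /integrableP[_] := i1.
    rewrite [in X in X -> _](eq_measure_integral m2) // => A mA _.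
    exact: joint_resample.
  have mhu : measurable_fun setT
      (EFin \o (fun z : T * T' => h (update (joint z.1) i z.2))).
    by apply/measurable_EFinP; exact: measurableT_comp mh mu.
  have i3 : (P \x distribution P (X i))%E.-integrable setT
      (EFin \o (fun z : T * T' => h (update (joint z.1) i z.2))).
    apply/integrableP; split => //.
    have /integrableP[_] := i2.
    rewrite /m2 ge0_integral_pushforward //.
    by apply/measurable_EFinP; exact: measurableT_comp.
  rewrite -[LHS](@integral_pushforward _ _ _ _ _ _ mj P setT (EFin \o h)) //.
  rewrite (eq_measure_integral m2) => [|A mA _]; last exact: joint_resample.
  rewrite integral_pushforward // -(integral12_prod_meas1 i3) //.
move=> mf mg if_ ig fg; rewrite key // [RHS]key //.
by apply: eq_integral => w _; exact: fg.
Qed.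

End resampling.

(** * Stein's identity for a possibly singular normal vector, then for the sample *)

Section stein_multivariate.
Context {R : realType}.

Lemma bounded_integrable d (T : measurableType d) (P : probability T R) (f : T -> R) :
  measurable_fun setT f -> fbounded f -> P.-integrable setT (EFin \o f).
Proof.
move=> mf [M fM]; apply: measurable_bounded_integrable => //.
  have P1 : P setT = 1%E by exact: probability_setT.
  by change (P setT < +oo)%E; rewrite P1 ltry.
by exists M; split; [exact: num_real|move=> x Mx y _; exact: le_trans (fM y) (ltW Mx)].
Qed.

Lemma integrableM_bounded d (T : measurableType d) (P : probability T R) (f g : T -> R) :
  measurable_fun setT g -> fbounded g -> P.-integrable setT (EFin \o f) ->
  P.-integrable setT (EFin \o (fun x => f x * g x)).
Proof.
move=> mg [M gM] intf.
have mf : measurable_fun setT f by apply/measurable_EFinP; exact: measurable_int intf.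
apply: (le_integrable _ _ _ (integrableZl _ `|M| (integrable_norm intf))) => //.
  by apply/measurable_EFinP; exact: measurable_funM.
move=> x _ /=; rewrite lee_fin !normrM !normr_id mulrC ler_wpM2r //.
exact: le_trans (gM x) (ler_norm _).
Qed.

Lemma vecE p (x : p.-tuple R) j : vec x j 0 = tnth x j.
Proof. by rewrite mxE. Qed.

Lemma measurable_vec p j : measurable_fun setT (fun x : p.-tuple R => vec x j 0).
Proof.
rewrite (_ : (fun x => _) = (@tnth p R ^~ j)); first exact: measurable_tnth.
by apply/funext => x; rewrite vecE.
Qed.

Section affine_image.
Context (p k : nat) (mu : 'cV[R]_p) (A : 'M[R]_(p, k)).

Definition affine_tuple (z : k.-tuple R) : p.-tuple R :=
  [tuple (mu + A *m vec z) i 0 | i < p].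

Lemma vec_affine_tuple z : vec (affine_tuple z) = mu + A *m vec z.
Proof. by apply/matrixP => i j; rewrite mxE tnth_mktuple (ord1 j). Qed.

Lemma measurable_affine_tuple : measurable_fun setT affine_tuple.
Proof.
apply/measurable_fun_tnthP => i.
rewrite (_ : _ \o _ = (fun z => (mu + A *m vec z) i 0)); last first.
  by apply/funext => z /=; rewrite tnth_mktuple.
have HQ := @fun_subring_measurable R _ (k.-tuple R).
apply: (entries_add HQ); first exact: entries_cst.
apply: (entries_mul HQ); first exact: entries_cst.
by move=> a b; rewrite (ord1 b); exact: measurable_vec.
Qed.

End affine_image.

Section multivariate_normal_stein.
Context d (T : measurableType d) (P : probability T R) (p : nat)
  (X : {mfun T >-> p.-tuple R}) (mu : 'cV[R]_p) (Sigma : 'M[R]_p).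
Hypothesis HX : multivariate_normal P X mu Sigma.

(** [multivariate_normal] equates probabilities of sets; here this becomes a transfer of integrals
    to the space of the standard normal coordinates, where integration by parts takes place. *)
Lemma multivariate_normal_factor : exists k (A : 'M[R]_(p, k)) d' (T' : measurableType d')
    (Q : probability T' R) (Z : 'I_k -> {mfun T' >-> R}),
  [/\ A *m A^T = Sigma, standard_normal Q Z &
   forall f : p.-tuple R -> R, measurable_fun setT f ->
     Q.-integrable setT (EFin \o (f \o (affine_tuple mu A \o joint Z))) ->
     (distribution P X).-integrable setT (EFin \o f) /\
     (\int[distribution P X]_y (f y)%:E =
      \int[Q]_w (f (affine_tuple mu A (joint Z w)))%:E)%E].
Proof.
have [k [A [d' [T' [Q [Z [AA snZ lawX]]]]]]] := HX.
exists k, A, d', T', Q, Z; split=> // f mf intf.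
pose h (w : T') := affine_tuple mu A (joint Z w).
have mh : measurable_fun setT h.
  exact: (measurableT_comp (measurable_affine_tuple mu A) (measurable_joint Z)).
have hE w : vec (h w) = mu + A *m \col_l Z l w.
  rewrite vec_affine_tuple; congr (_ + _ *m _).
  by apply/matrixP => i j; rewrite !mxE tnth_mktuple.
pose m' : {measure set _ -> \bar R} := pushforward Q h.
pose m := m' mh.
have lawXh (B : set (p.-tuple R)) : measurable B -> distribution P X B = m B.
  move=> mB; rewrite lawX //; congr (Q _); apply/funext => w /=.
  by congr B; apply: eq_from_tnth => i; rewrite !tnth_mktuple -hE vec_affine_tuple.
have mEf : measurable_fun setT (EFin \o f) by exact/measurable_EFinP.
have im : m.-integrable setT (EFin \o f) by apply: integrable_pushforward.
have eqm (g : p.-tuple R -> \bar R) :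
    (\int[distribution P X]_y g y = \int[m]_y g y)%E.
  by apply: eq_measure_integral => B mB _; exact: lawXh.
split; first by apply/integrableP; split => //; rewrite eqm; have /integrableP[] := im.
by rewrite eqm integral_pushforward.
Qed.

Section standard_normal_facts.
Context k d' (T' : measurableType d') (Q : probability T' R) (Z : 'I_k -> {mfun T' >-> R}).
Hypothesis snZ : standard_normal Q Z.

Lemma standard_normal_integrable l : Q.-integrable setT (EFin \o Z l).
Proof.
have mZ : measurable_fun setT (Z l) by exact: measurable_funPT.
apply/integrableP; split; first exact/measurable_EFinP.
have /integrableP[_] := integrable_normal_law_id (snZ.2 l).
rewrite ge0_integral_distribution //.
by apply: measurableT_comp => //; exact/measurable_EFinP.
Qed.

End standard_normal_facts.

Lemma multivariate_normal_integrable j :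
  (distribution P X).-integrable setT (EFin \o (fun y => vec y j 0)).
Proof.
have [k [A [d' [T' [Q [Z [AA snZ key]]]]]]] := multivariate_normal_factor.
have [] // := key (fun y => vec y j 0).
  exact: measurable_vec.
rewrite (_ : _ \o _ = (fun w => (mu j 0)%:E + \sum_l (A j l * Z l w)%:E)%E).
  apply: integrableD => //; first exact: finite_measure_integrable_cst.
  apply: integrable_sum => // l _.
  exact: (integrableZl measurableT (A j l) (standard_normal_integrable snZ l)).
apply/funext => w /=; rewrite vec_affine_tuple mxE EFinD sumEFin !mxE.
by congr (_ + _%:E)%E; apply: eq_bigr => l _; rewrite mxE tnth_mktuple.
Qed.

(** In the coordinates [y = mu + A z], moving [z_l] moves [y] along column [l] of [A], and
    [y_b - mu_b] is the sum of the [A b l * z_l]. Summing the one-dimensional identities with these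
    weights assembles the direction [A A^T e_b = Sigma e_b]. *)
Lemma stein_multivariate_normal (G : 'cV[R]_p -> R) (DG : 'cV[R]_p -> 'cV[R]_p -> R) b :
  C1 G DG -> fbounded G -> (forall v, fbounded (DG^~ v)) ->
  measurable_fun setT (fun y : p.-tuple R => G (vec y)) ->
  (forall v, measurable_fun setT (fun y : p.-tuple R => DG (vec y) v)) ->
  (\int[distribution P X]_y ((vec y b 0 - mu b 0) * G (vec y))%:E =
   \int[distribution P X]_y (DG (vec y) (Sigma *m delta_mx b 0))%:E)%E.
Proof.
move=> CG bG bDG mG mDG.
have [k [A [d' [T' [Q [Z [AA snZ key]]]]]]] := multivariate_normal_factor.
pose H (z : k.-tuple R) := affine_tuple mu A z.
have mH := measurable_affine_tuple mu A.
have mJ := measurable_joint Z.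
have mGH : measurable_fun setT (fun z => G (vec (H z))).
  exact: (measurableT_comp mG mH).
have mDGH v : measurable_fun setT (fun z => DG (vec (H z)) v).
  exact: (measurableT_comp (mDG v) mH).
have mGHJ : measurable_fun setT (fun w => G (vec (H (joint Z w)))).
  exact: (measurableT_comp mGH mJ).
have mDGHJ v : measurable_fun setT (fun w => DG (vec (H (joint Z w))) v).
  exact: (measurableT_comp (mDGH v) mJ).
have bGHJ : fbounded (fun w => G (vec (H (joint Z w)))).
  by have [M GM] := bG; exists M => w; exact: GM.
have bDGHJ v : fbounded (fun w => DG (vec (H (joint Z w))) v).
  by have [M GM] := bDG v; exists M => w; exact: GM.
have iZG l : Q.-integrable setT (EFin \o (fun w => Z l w * G (vec (H (joint Z w))))).
  by apply: integrableM_bounded => //; exact: standard_normal_integrable.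
have iDG v : Q.-integrable setT (EFin \o (fun w => DG (vec (H (joint Z w))) v)).
  exact: bounded_integrable.
have coord l : (\int[Q]_w (Z l w * G (vec (H (joint Z w))))%:E =
    \int[Q]_w (DG (vec (H (joint Z w))) (A *m delta_mx l 0))%:E)%E.
  pose f (z : k.-tuple R) := tnth z l * G (vec (H z)).
  pose g (z : k.-tuple R) := DG (vec (H z)) (A *m delta_mx l 0).
  have fE w : f (joint Z w) = Z l w * G (vec (H (joint Z w))) by rewrite /f tnth_mktuple.
  under eq_integral do rewrite -fE.
  apply: (integral_joint_eq snZ.1 (i := l) (f := f) (g := g)) => //.
  - by apply: measurable_funM => //; exact: measurable_tnth.
  - exact: mDGH.
  - rewrite (_ : f \o joint Z = (fun w => Z l w * G (vec (H (joint Z w))))) //.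
    by apply/funext => w; exact: fE.
  - exact: iDG.
  move=> w.
  pose Y0 := vec (H (update (joint Z w) l 0)).
  have YE y : vec (H (update (joint Z w) l y)) = Y0 + y *: (A *m delta_mx l 0).
    rewrite /Y0 /H !vec_affine_tuple -addrA scalemxAr; congr (_ + _).
    rewrite -mulmxDr; congr (_ *m _); apply/matrixP => i j.
    rewrite !mxE !tnth_update (ord1 j) eqxx andbT.
    by case: eqP => _ /=; rewrite ?mulr1 ?add0r ?mulr0 ?addr0.
  have [M GM] := bG; have [M' GM'] := bDG (A *m delta_mx l 0).
  have [dG cG _] := CG.
  have := @stein_normal_law R _ (snZ.2 l) (fun y => G (Y0 + y *: (A *m delta_mx l 0)))
    (fun y => DG (Y0 + y *: (A *m delta_mx l 0)) (A *m delta_mx l 0)) M M'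
    (dG _ _) (cG _ _) (fun=> GM _) (fun=> GM' _).
  move=> st; transitivity (\int[distribution Q (Z l)]_y
     (y * G (Y0 + y *: (A *m delta_mx l 0)))%:E)%E.
    by apply: eq_integral => y _; rewrite /f YE tnth_update eqxx.
  by rewrite st; apply: eq_integral => y _; rewrite /g YE.
have vE w : vec (H (joint Z w)) b 0 - mu b 0 = \sum_l A b l * Z l w.
  rewrite vec_affine_tuple mxE addrAC subrr add0r mxE.
  by apply: eq_bigr => l _; rewrite mxE tnth_mktuple.
have lhsE w : (vec (H (joint Z w)) b 0 - mu b 0) * G (vec (H (joint Z w))) =
    \sum_l A b l * (Z l w * G (vec (H (joint Z w)))).
  by rewrite vE mulr_suml; apply: eq_bigr => l _; rewrite mulrA.
have SE : Sigma *m delta_mx b 0 = \sum_l A b l *: (A *m delta_mx l 0) :> 'cV[R]_p.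
  rewrite -AA -mulmxA; under eq_bigr do rewrite scalemxAr.
  rewrite -mulmx_sumr; congr (_ *m _); apply/matrixP => i j.
  rewrite summxE (ord1 j) (bigD1 i) //= big1 => [|l li].
    rewrite !mxE !eqxx mulr1 addr0 (bigD1 b) //= big1 => [|a ab].
      by rewrite !mxE !eqxx mulr1 addr0.
    by rewrite !mxE (negbTE ab) mulr0.
  by rewrite !mxE eq_sym (negbTE li) mulr0.
have rhsE Y : DG Y (Sigma *m delta_mx b 0) = \sum_l A b l * DG Y (A *m delta_mx l 0).
  have [_ _ lin] := CG; rewrite SE.
  have DG0 : DG Y 0 = 0.
    by have := lin Y (-1) 0 0; rewrite scaler0 addr0 mulN1r addNr.
  by elim/big_rec2: _ => // l y1 y2 _ <-; rewrite lin.
have ilhs : Q.-integrable setT (EFin \o (fun w =>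
    (vec (H (joint Z w)) b 0 - mu b 0) * G (vec (H (joint Z w))))).
  rewrite (_ : _ \o _ = (fun w => \sum_l (A b l * (Z l w * G (vec (H (joint Z w)))))%:E)%E).
    apply: integrable_sum => // l _.
    exact: (integrableZl measurableT (A b l) (iZG l)).
  by apply/funext => w /=; rewrite lhsE sumEFin.
have mlhs : measurable_fun setT (fun y => (vec y b 0 - mu b 0) * G (vec y)).
  by apply: measurable_funM => //; apply: measurable_funB => //; exact: measurable_vec.
have [_ ->] := key _ mlhs ilhs.
have [_ ->] := key _ (mDG (Sigma *m delta_mx b 0)) (iDG (Sigma *m delta_mx b 0)).
under eq_integral do rewrite lhsE -sumEFin.
under [RHS]eq_integral do rewrite rhsE -sumEFin.
rewrite !integral_sum //.
- apply: eq_bigr => l _; under eq_integral do rewrite EFinM.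
  under [RHS]eq_integral do rewrite EFinM.
  rewrite (integralZl measurableT (iZG l)) (integralZl measurableT (iDG _)).
  by congr (_ * _)%E; exact: coord.
- by move=> l; exact: (integrableZl measurableT (A b l) (iDG _)).
- by move=> l; exact: (integrableZl measurableT (A b l) (iZG l)).
Qed.

End multivariate_normal_stein.
End stein_multivariate.

Definition mxdata (R : realType) n p (x : n.-tuple (p.-tuple R)) : 'M[R]_(p, n) :=
  \matrix_(j, i) tnth (tnth x i) j.

Lemma measurable_mxdata (R : realType) n p :
  entries (fun f => measurable_fun setT f) (@mxdata R n p).
Proof.
move=> j i; rewrite (_ : (fun x => _) = (@tnth p R ^~ j) \o (@tnth n (p.-tuple R) ^~ i)).
  by apply: measurableT_comp; exact: measurable_tnth.
by apply/funext => x; rewrite mxE.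
Qed.

Section stein_sample.
Context {R : realType} d (T : measurableType d) (P : probability T R) (n p : nat)
  (X : 'I_n -> {mfun T >-> p.-tuple R}) (mu : 'cV[R]_p) (Sigma : 'M[R]_p).
Hypothesis HX : iid_normal P X mu Sigma.

Definition obs (w : T) : 'M[R]_(p, n) := mxdata (joint X w).

Lemma obsE w i j : obs w j i = vec (X i w) j 0.
Proof. by rewrite !mxE tnth_mktuple. Qed.

Lemma measurable_obs : entries (fun f => measurable_fun setT f) obs.
Proof.
by move=> j i; exact: (measurableT_comp (measurable_mxdata j i) (measurable_joint X)).
Qed.

Lemma integrable_obs i j : P.-integrable setT (EFin \o (fun w => obs w j i)).
Proof.
have mo := measurable_obs j i.
apply/integrableP; split; first exact/measurable_EFinP.
have /integrableP[_] := multivariate_normal_integrable (HX.2 i) j.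
rewrite ge0_integral_distribution //; last first.
  by apply: measurableT_comp => //; apply/measurable_EFinP; exact: measurable_vec.
by under [X in _ -> (X < _)%E]eq_integral do rewrite /= obsE.
Qed.

Variables (g : 'M[R]_(p, n) -> R) (Dg : 'M[R]_(p, n) -> 'M[R]_(p, n) -> R).
Hypotheses (Cg : C1 g Dg) (bg : fbounded g) (bDg : forall Z, fbounded (Dg^~ Z)).
Hypotheses (mg : measurable_fun setT (g \o (@mxdata R n p)))
  (mDg : forall Z, measurable_fun setT ((Dg^~ Z) \o (@mxdata R n p))).

Lemma integrable_stein_lhs b i :
  P.-integrable setT (EFin \o (fun w => (obs w b i - mu b 0) * g (obs w))).
Proof.
apply: integrableM_bounded.
- exact: (measurableT_comp mg (measurable_joint X)).
- by have [M gM] := bg; exists M => w; exact: gM.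
- rewrite (_ : _ \o _ = (EFin \o (fun w => obs w b i)) \- cst (mu b 0)%:E)%E.
    apply: integrableB => //; first exact: integrable_obs.
    exact: finite_measure_integrable_cst.
  by apply/funext => w.
Qed.

Lemma integrable_stein_rhs Z :
  P.-integrable setT (EFin \o (fun w => Dg (obs w) Z)).
Proof.
apply: bounded_integrable.
- exact: (measurableT_comp (mDg Z) (measurable_joint X)).
- by have [M gM] := bDg Z; exists M => w; exact: gM.
Qed.

(** With the other observations frozen, the data matrix is the affine function [X0 + y E] of
    observation [i], so the identity for a single vector applies to the composite. *)
Lemma stein_sample b i :
  (\int[P]_w ((obs w b i - mu b 0) * g (obs w))%:E =
   \int[P]_w (Dg (obs w) (Sigma *m delta_mx b i))%:E)%E.
Proof.
pose f1 (x : n.-tuple (p.-tuple R)) := (mxdata x b i - mu b 0) * g (mxdata x).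
pose f2 (x : n.-tuple (p.-tuple R)) := Dg (mxdata x) (Sigma *m delta_mx b i).
apply: (integral_joint_eq HX.1 (i := i) (f := f1) (g := f2)).
- by apply: measurable_funM => //; apply: measurable_funB => //; exact: measurable_mxdata.
- exact: mDg.
- exact: integrable_stein_lhs.
- exact: integrable_stein_rhs.
move=> w; set x := joint X w.
pose E := delta_mx 0 i : 'rV[R]_n.
pose X0 := mxdata (update x i [tuple 0 | j < p]).
have updE y : mxdata (update x i y) = X0 + vec y *m E.
  apply/matrixP => a c; rewrite !mxE big_ord1 !mxE !tnth_update eqxx /=.
  by case: eqP => _ /=; rewrite ?tnth_mktuple ?mulr1 ?add0r ?mulr0 ?addr0.
pose G (y : 'cV[R]_p) := g (X0 + y *m E).
pose DG (y v : 'cV[R]_p) := Dg (X0 + y *m E) (v *m E).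
have [dg cg lg] := Cg.
have shift y v (s : R) : X0 + (y + s *: v) *m E = (X0 + y *m E) + s *: (v *m E).
  by rewrite mulmxDl -scalemxAl addrA.
have CG : C1 G DG.
  split=> [y v s|y v|y a v v'].
  - rewrite /G /DG shift.
    rewrite (_ : (fun u => _) = (fun u : R => g ((X0 + y *m E) + u *: (v *m E)))).
      exact: dg.
    by apply/funext => u; rewrite shift.
  - rewrite /DG; under eq_fun do rewrite shift.
    exact: cg.
  - by rewrite /DG mulmxDl -scalemxAl lg.
have mu_i : measurable_fun setT (fun y : p.-tuple R => update x i y).
  apply/measurable_fun_tnthP => j; have [->|ji] := eqVneq j i.
    rewrite (_ : _ \o _ = id) //.
    by apply/funext => y /=; rewrite tnth_update eqxx.
  rewrite (_ : _ \o _ = cst (tnth x j)) //.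
  by apply/funext => y /=; rewrite tnth_update (negbTE ji).
have mG : measurable_fun setT (fun y : p.-tuple R => G (vec y)).
  rewrite (_ : (fun y => _) = (g \o (@mxdata R n p)) \o (fun y => update x i y)).
    exact: measurableT_comp.
  by apply/funext => y; rewrite /= updE.
have mDG v : measurable_fun setT (fun y : p.-tuple R => DG (vec y) v).
  rewrite (_ : (fun y => _) = ((Dg^~ (v *m E)) \o (@mxdata R n p)) \o (fun y => update x i y)).
    exact: measurableT_comp.
  by apply/funext => y; rewrite /= updE.
have bG : fbounded G by have [M gM] := bg; exists M => y; exact: gM.
have bDG v : fbounded (DG^~ v) by have [M gM] := bDg (v *m E); exists M => y; exact: gM.
have := stein_multivariate_normal (HX.2 i) b CG bG bDG mG mDG => st.
transitivity (\int[distribution P (X i)]_y ((vec y b 0 - mu b 0) * G (vec y))%:E)%E.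
  apply: eq_integral => y _; rewrite /f1 updE /G; congr (((_ - _) * _)%:E).
  by rewrite -updE !mxE tnth_update eqxx.
rewrite st; apply: eq_integral => y _; rewrite /f2 updE /DG; congr ((Dg _ _)%:E).
rewrite -mulmxA; congr (_ *m _); apply/matrixP => a c.
by rewrite !mxE big_ord1 !mxE !eqxx andbT /=; case: (a == b); rewrite /= ?mul1r ?mul0r.
Qed.

End stein_sample.

(** * Traces, resolvents and divergences *)

Section psd_trace.
Context {R : realType}.

Lemma psdmx_quad p q (A : 'M[R]_p) (N : 'M[R]_(p, q)) : psdmx A ->
  psdmx (N^T *m A *m N).
Proof.
move=> [sA pA]; split=> [|v]; first by rewrite !trmx_mul trmxK sA mulmxA.
by have := pA (N *m v); rewrite trmx_mul !mulmxA.
Qed.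

Lemma psdmx1 p : psdmx (1%:M : 'M[R]_p).
Proof.
split=> [|v]; first exact: trmx1.
by rewrite mulmx1 mxE sumr_ge0 // => i _; rewrite mxE -expr2 sqr_ge0.
Qed.

Lemma psdmx_gram p q (N : 'M[R]_(p, q)) : psdmx (N *m N^T).
Proof. by have := psdmx_quad N^T (psdmx1 q); rewrite trmxK mulmx1. Qed.

Lemma psdmx_diag_ge0 p (A : 'M[R]_p) i : psdmx A -> 0 <= A i i.
Proof.
move=> [_ /(_ (delta_mx i 0))]; rewrite trmx_delta -rowE -colE.
by rewrite !mxE.
Qed.

Lemma psdmx_trace_ge0 p (A : 'M[R]_p) : psdmx A -> 0 <= \tr A.
Proof. by move=> pA; apply: sumr_ge0 => i _; exact: psdmx_diag_ge0. Qed.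

Lemma psdmx_entry_sqr p (A : 'M[R]_p) i j : psdmx A ->
  A i j ^+ 2 <= A i i * A j j.
Proof.
move=> pA; have [sA qA] := pA.
have Aji : A j i = A i j by rewrite -[in LHS]sA mxE.
have i0 := psdmx_diag_ge0 i pA; have j0 := psdmx_diag_ge0 j pA.
have q x y : 0 <= x ^+ 2 * A i i + 2 * x * y * A i j + y ^+ 2 * A j j.
  have := qA (x *: delta_mx i 0 + y *: delta_mx j 0).
  rewrite !(linearD, linearZ) /= !trmx_delta !(mulmxDl, mulmxDr).
  rewrite -!(scalemxAl, scalemxAr) -!rowE -!colE !mxE Aji => h.
  by apply: le_trans h _; rewrite le_eqVlt; apply/orP; left; apply/eqP; ring.
have [ii0|ii0] := eqVneq (A i i) 0.
  (* With [A i i = 0] the form at this vector equals [- (A j j + 2) * A i j ^+ 2], which forces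
     [A i j = 0]. *)
  have := q (- (A j j + 1)) (A i j); rewrite ii0 mulr0 add0r mul0r => h.
  nra.
have iip : 0 < A i i by rewrite lt_neqAle eq_sym ii0.
have := q (- A i j) (A i i) => h.
have : 0 <= A i i * (A i i * A j j - A i j ^+ 2) by nra.
by rewrite pmulr_rge0 // subr_ge0.
Qed.

Lemma psdmx_entry_le_trace p (A : 'M[R]_p) i j : psdmx A -> `|A i j| <= \tr A.
Proof.
move=> pA.
have dle k : A k k <= \tr A.
  rewrite /mxtrace (bigD1 k) //= lerDl sumr_ge0 // => l _.
  exact: psdmx_diag_ge0.
have t0 := psdmx_trace_ge0 pA.
rewrite -(ler_pXn2r (n := 2)) ?nnegrE // real_normK ?num_real //.
apply: le_trans (psdmx_entry_sqr i j pA) _.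
by rewrite expr2 ler_pM // psdmx_diag_ge0.
Qed.

Lemma entry_sqr_le_gram p q (N : 'M[R]_(p, q)) i j : N i j ^+ 2 <= \tr (N *m N^T).
Proof.
rewrite /mxtrace (bigD1 i) //= mxE (bigD1 j) //= mxE -expr2 -addrA lerDl addr_ge0 //.
  by apply: sumr_ge0 => k _; rewrite mxE -expr2 sqr_ge0.
apply: sumr_ge0 => k _; rewrite mxE; apply: sumr_ge0 => l _.
by rewrite mxE -expr2 sqr_ge0.
Qed.

Lemma psdmx_trace_sqr p (A : 'M[R]_p) : psdmx A -> \tr (A *m A) <= \tr A ^+ 2.
Proof.
move=> pA; have [sA _] := pA.
rewrite expr2 {2}/mxtrace mulr_suml; apply: ler_sum => i _; rewrite mxE mulr_sumr.
apply: ler_sum => j _.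
have -> : A j i = A i j by rewrite -[in LHS]sA mxE.
by rewrite -expr2 psdmx_entry_sqr.
Qed.

Lemma mxtrace_gram_eq0 p q (N : 'M[R]_(p, q)) : \tr (N *m N^T) <= 0 -> N = 0.
Proof.
move=> h; apply/matrixP => i j; rewrite mxE; apply/eqP; rewrite -sqrf_eq0.
by rewrite eq_le sqr_ge0 andbT (le_trans (entry_sqr_le_gram N i j)).
Qed.

Lemma mx_trE m k (M : 'M[R]_(m, k)) i j : M i j = M^T j i.
Proof. by rewrite mxE. Qed.

Lemma trace_quad p q (A : 'M[R]_p) (N : 'M[R]_(p, q)) :
  \tr (N^T *m A *m N) = \tr (A *m (N *m N^T)).
Proof. by rewrite -mulmxA mxtrace_mulC -mulmxA. Qed.

(** With [sum_delta_trmx], this turns a divergence over all entries into traces: a direct variation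
    produces a product of two traces, a transposed one a single trace. *)
Lemma sum_delta_trace p n (A : 'M[R]_p) (B : 'M[R]_n) :
  \sum_b \sum_i (A *m delta_mx b i *m B) b i = \tr A * \tr B.
Proof.
rewrite /mxtrace mulr_suml; apply: eq_bigr => b _; rewrite mulr_sumr.
apply: eq_bigr => i _.
have -> : delta_mx b i = delta_mx b (0 : 'I_1) *m delta_mx 0 i :> 'M[R]_(p, n).
  by rewrite mul_delta_mx.
by rewrite mulmxA -mulmxA -colE -rowE mxE big_ord1 !mxE.
Qed.

Lemma sum_delta_trmx p n (A B : 'M[R]_(p, n)) :
  \sum_b \sum_i (A *m (delta_mx b i)^T *m B) b i = \tr (A^T *m B).
Proof.
rewrite /mxtrace exchange_big; apply: eq_bigr => i _ /=; rewrite mxE.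
apply: eq_bigr => b _; rewrite trmx_delta.
have -> : delta_mx i b = delta_mx i (0 : 'I_1) *m delta_mx 0 b :> 'M[R]_(n, p).
  by rewrite mul_delta_mx.
by rewrite mulmxA -mulmxA -colE -rowE mxE big_ord1 !mxE.
Qed.

Lemma sum_entries_trace p n (A B : 'M[R]_(p, n)) :
  \sum_b \sum_i A b i * B b i = \tr (A^T *m B).
Proof.
rewrite /mxtrace exchange_big; apply: eq_bigr => i _ /=; rewrite mxE.
by apply: eq_bigr => b _; rewrite mxE.
Qed.

Lemma trace_delta p n (A : 'M[R]_(n, p)) b i : \tr (A *m delta_mx b i) = A i b.
Proof.
have -> : delta_mx b i = delta_mx b (0 : 'I_1) *m delta_mx 0 i :> 'M[R]_(p, n).
  by rewrite mul_delta_mx.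
rewrite mulmxA -colE mxtrace_mulC -rowE /mxtrace big_ord1.
by rewrite !mxE.
Qed.

End psd_trace.

(** * The centring matrix and the projection on the range of a symmetric matrix *)

Section centering.
Context {R : realType} (n : nat).

Definition centering : 'M[R]_n := locked (1%:M - n%:R^-1 *: const_mx 1).

Lemma centeringE : centering = 1%:M - n%:R^-1 *: const_mx 1.
Proof. by rewrite /centering -lock. Qed.

Lemma centering_tr : centering^T = centering.
Proof. by rewrite centeringE linearB /= trmx1 linearZ /= trmx_const. Qed.

Hypothesis n_gt0 : (0 < n)%N.

Lemma const_centering m : const_mx 1 *m centering = 0 :> 'M[R]_(m, n).
Proof.
rewrite centeringE; apply/matrixP => i j; rewrite !mxE.
under eq_bigr do rewrite !mxE mul1r mulr1.
rewrite big_split /= (bigD1 j) //= eqxx big1 => [|k kj]; last by rewrite (negbTE kj).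
have n0 : n%:R != 0 :> R by rewrite pnatr_eq0 -lt0n.
by rewrite sumr_const card_ord addr0 /= -[X in 1 + X]mulr_natr mulNr mulVf ?subrr.
Qed.

Lemma centering_idem : centering *m centering = centering.
Proof.
by rewrite {1}centeringE mulmxBl mul1mx -scalemxAl const_centering scaler0 subr0.
Qed.

Lemma centering_trace : \tr centering = n%:R - 1.
Proof.
rewrite centeringE linearB linearZ /= mxtrace1 /mxtrace.
under eq_bigr do rewrite mxE.
by rewrite sumr_const card_ord -mulr_natr mul1r mulVf // pnatr_eq0 -lt0n.
Qed.

End centering.

Section symmetric_pinv.
Context {R : realType} (p : nat) (A : 'M[R]_p).
Hypothesis sA : A^T = A.
Local Notation K := (pinv A).

(* Locked so that [mulmxA] does not reassociate inside it. *)
Definition range_proj : 'M[R]_p := locked (A *m pinv A).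
Local Notation Pi := range_proj.

Lemma range_projE : range_proj = A *m K. Proof. by rewrite /range_proj -lock. Qed.

Lemma pinv_sym : K^T = K.
Proof.
apply/esym/pinv_unique; have [h1 h2 h3 h4] := penrose_pinv A.
split.
- by have := congr1 trmx h1; rewrite !trmx_mul sA mulmxA.
- by have := congr1 trmx h2; rewrite !trmx_mul sA mulmxA.
- by rewrite trmx_mul trmxK sA -h4 trmx_mul sA.
- by rewrite trmx_mul trmxK sA -h3 trmx_mul sA.
Qed.

Lemma range_proj_sym : Pi^T = Pi.
Proof. by rewrite range_projE; have [_ _ h _] := penrose_pinv A. Qed.

Lemma pinv_mulC : K *m A = Pi.
Proof. by rewrite -range_proj_sym range_projE trmx_mul pinv_sym sA. Qed.

Lemma range_proj_mul : Pi *m A = A.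
Proof. by rewrite range_projE; have [h _ _ _] := penrose_pinv A. Qed.

Lemma mul_range_proj : A *m Pi = A.
Proof. by have := congr1 trmx range_proj_mul; rewrite trmx_mul range_proj_sym sA. Qed.

Lemma pinv_range_proj : K *m Pi = K.
Proof. by have [_ h _ _] := penrose_pinv A; rewrite range_projE mulmxA. Qed.

Lemma range_proj_pinv : Pi *m K = K.
Proof. by have := congr1 trmx pinv_range_proj; rewrite trmx_mul range_proj_sym pinv_sym. Qed.

Lemma range_proj_idem : Pi *m Pi = Pi.
Proof. by rewrite {2}range_projE mulmxA range_proj_mul range_projE. Qed.

Lemma psdmx_pinv : psdmx A -> psdmx K.
Proof.
move=> pA; have := psdmx_quad K pA.
by rewrite pinv_sym pinv_mulC range_proj_pinv.
Qed.

Lemma range_proj_rank : \rank Pi = \rank A.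
Proof.
apply/eqP; rewrite eqn_leq {1}range_projE mxrankM_maxl /=.
by rewrite -{1}range_proj_mul mxrankM_maxl.
Qed.

(** For a full rank factorization [Pi = C F], cancelling [C] and [F] in [Pi Pi = Pi] leaves
    [F C = 1], an identity matrix whose size is the rank. *)
Lemma range_proj_trace : \tr Pi = (\rank A)%:R.
Proof.
rewrite -range_proj_rank -{1}(mulmx_base Pi) mxtrace_mulC.
suff -> : row_base Pi *m col_base Pi = 1%:M by rewrite mxtrace1.
apply: (row_full_inj (col_base_full Pi)); rewrite mulmx1.
apply: (row_free_inj (row_base_free Pi)).
have b : col_base Pi *m row_base Pi = Pi by exact: mulmx_base.
by rewrite mulmxA b -mulmxA b range_proj_idem.
Qed.

(** With [Pi = C F], the inner product [F M C] is a 1 x 1 matrix. This is the source of the equality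
    [tr V * tr V^+ = 1] that admits negative [t] in rank one. *)
Lemma range_proj_rank1 (M : 'M[R]_p) : \rank A = 1%N ->
  Pi *m M *m Pi = \tr (Pi *m M) *: Pi.
Proof.
rewrite -range_proj_rank => rk; move: (mulmx_base Pi).
move: (col_base Pi) (row_base Pi); rewrite rk => C F CF.
rewrite -CF !mulmxA -(mulmxA C) -(mulmxA C) [F *m M *m C]mx11_scalar.
rewrite mul_mx_scalar -scalemxAl; congr (_ *: _).
by rewrite [RHS]mxtrace_mulC /mxtrace big_ord1.
Qed.

End symmetric_pinv.

Lemma comm_invmx (R : comUnitRingType) q (A B : 'M[R]_q) : A \in unitmx ->
  B *m A = A *m B -> B *m invmx A = invmx A *m B.
Proof.
move=> uA h; apply: (can_inj (mulmxK uA)).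
by rewrite mulmxKV // -mulmxA h mulKmx.
Qed.

(** * The projected scatter matrix and its resolvent *)

Section resolvent.
Context {R : realType} (n p : nat) (Sigma : 'M[R]_p).
Hypothesis psdS : psdmx Sigma.
Local Notation K := (pinv Sigma).
Local Notation Pi := (range_proj Sigma).
Local Notation H := (centering n).

Let sS : Sigma^T = Sigma. Proof. by case: psdS. Qed.

(** Projecting by [Pi] leaves the scatter unchanged almost surely ([ae_scat1]), but makes the
    resolvent commute with [Pi] for every data matrix, so that the trace identities hold
    pointwise. *)
Definition cdat (X : 'M[R]_(p, n)) : 'M[R]_(p, n) := locked (Pi *m X *m H).
Definition scat X : 'M[R]_p := locked (cdat X *m (cdat X)^T).
Definition rsv (e : R) X : 'M[R]_p := invmx (scat X + e%:M).
Definition trsv e X : R := \tr (Pi *m rsv e X).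

Lemma cdatE X : cdat X = Pi *m X *m H. Proof. by rewrite /cdat -lock. Qed.
Lemma scatE X : scat X = cdat X *m (cdat X)^T. Proof. by rewrite /scat -lock. Qed.

Lemma proj_cdat X : Pi *m cdat X = cdat X.
Proof. by rewrite cdatE !mulmxA range_proj_idem. Qed.

Lemma scat_sym X : (scat X)^T = scat X.
Proof. by rewrite scatE trmx_mul trmxK. Qed.

Lemma proj_scat X : Pi *m scat X = scat X.
Proof. by rewrite scatE mulmxA proj_cdat. Qed.

Lemma scat_proj X : scat X *m Pi = scat X.
Proof. by have := congr1 trmx (proj_scat X); rewrite trmx_mul scat_sym range_proj_sym. Qed.

Lemma psdmx_scat X : psdmx (scat X).
Proof. by rewrite scatE; exact: psdmx_gram. Qed.

Lemma scat_trace_ge0 X : 0 <= \tr (scat X).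
Proof. exact/psdmx_trace_ge0/psdmx_scat. Qed.

Section positive_regularization.
Variables (e : R) (e_gt0 : 0 < e).

Lemma gram_add_unitmx q k (N : 'M[R]_(q, k)) : N *m N^T + e%:M \in unitmx.
Proof.
rewrite -row_free_unit -kermx_eq0; apply/eqP.
move: (kermx _) (mulmx_ker (N *m N^T + e%:M)) => W W0.
apply: mxtrace_gram_eq0.
have : \tr (W *m (N *m N^T + e%:M) *m W^T) = 0 by rewrite W0 mul0mx linear0.
rewrite mulmxDr mulmxDl mul_mx_scalar -scalemxAl linearD linearZ /=.
rewrite (_ : W *m (N *m N^T) *m W^T = (W *m N) *m (W *m N)^T); last first.
  by rewrite trmx_mul !mulmxA.
have := psdmx_trace_ge0 (psdmx_gram (W *m N)).
move=> h1 /eqP; rewrite addr_eq0 => /eqP h2.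
by move: h1; rewrite h2 oppr_ge0 pmulr_rle0.
Qed.

Lemma scat_unitmx X : scat X + e%:M \in unitmx.
Proof. by rewrite scatE; exact: gram_add_unitmx. Qed.

Lemma rsv_sym X : (rsv e X)^T = rsv e X.
Proof. by rewrite trmx_inv linearD /= scat_sym tr_scalar_mx. Qed.

Lemma scat_rsv X : scat X *m rsv e X = 1%:M - e *: rsv e X.
Proof.
have := mulmxV (scat_unitmx X); rewrite mulmxDl mul_scalar_mx => h.
by rewrite -h addrK.
Qed.

Lemma rsv_scat X : rsv e X *m scat X = 1%:M - e *: rsv e X.
Proof.
by have := congr1 trmx (scat_rsv X); rewrite trmx_mul scat_sym rsv_sym linearB linearZ /= trmx1 rsv_sym.
Qed.

Lemma proj_rsv X : Pi *m rsv e X = rsv e X *m Pi.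
Proof.
apply: comm_invmx (scat_unitmx X) _.
by rewrite mulmxDl mulmxDr proj_scat scat_proj mul_mx_scalar mul_scalar_mx.
Qed.

Lemma psdmx_rsv X : psdmx (rsv e X).
Proof.
have h : rsv e X = rsv e X *m (scat X + e%:M) *m rsv e X.
  by rewrite mulVmx ?scat_unitmx // mul1mx.
split=> [|v]; first exact: rsv_sym.
have E : v^T *m rsv e X *m v = (rsv e X *m v)^T *m scat X *m (rsv e X *m v) +
    e *: ((rsv e X *m v)^T *m 1%:M *m (rsv e X *m v)).
  rewrite trmx_mul rsv_sym mulmx1 {1}h !(mulmxDr, mulmxDl) !mulmxA; congr (_ + _).
  by rewrite mul_mx_scalar -!scalemxAl.
rewrite E !mxE addr_ge0 //; last apply: mulr_ge0; try exact: ltW.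
  by have [_] := psdmx_scat X => /(_ (rsv e X *m v)); rewrite mxE.
by have [_] := psdmx1 (R := R) p => /(_ (rsv e X *m v)); rewrite mxE.
Qed.

Lemma proj_rsv_proj X : Pi^T *m rsv e X *m Pi = Pi *m rsv e X.
Proof. by rewrite range_proj_sym // proj_rsv -mulmxA range_proj_idem. Qed.

Lemma psdmx_proj_rsv X : psdmx (Pi *m rsv e X).
Proof. by rewrite -proj_rsv_proj; exact/psdmx_quad/psdmx_rsv. Qed.

Lemma trsv_ge0 X : 0 <= trsv e X.
Proof. exact/psdmx_trace_ge0/psdmx_proj_rsv. Qed.

Lemma proj_rsvX X : (Pi *m rsv e X) *m (Pi *m rsv e X) = Pi *m rsv e X *m rsv e X.
Proof.
by rewrite mulmxA -(mulmxA Pi (rsv e X) Pi) -proj_rsv mulmxA range_proj_idem.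
Qed.

Lemma tr_rsv2_le X : \tr (Pi *m rsv e X *m rsv e X) <= trsv e X ^+ 2.
Proof. by rewrite -proj_rsvX; exact/psdmx_trace_sqr/psdmx_proj_rsv. Qed.

Lemma tr_rsv2_ge0 X : 0 <= \tr (Pi *m rsv e X *m rsv e X).
Proof.
rewrite -proj_rsvX.
have := psdmx_trace_ge0 (psdmx_gram (Pi *m rsv e X)).
by have [-> _] := psdmx_proj_rsv X.
Qed.

Lemma tr_rsv3_ge0 X : 0 <= \tr (Pi *m rsv e X *m rsv e X *m rsv e X).
Proof.
have := psdmx_trace_ge0 (psdmx_quad (rsv e X *m Pi) (psdmx_rsv X)).
rewrite trmx_mul rsv_sym range_proj_sym // mxtrace_mulC !mulmxA.
rewrite (_ : _ *m Pi *m Pi *m _ *m _ = rsv e X *m Pi *m rsv e X *m rsv e X) //.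
  by rewrite -proj_rsv.
by rewrite -(mulmxA (rsv e X)) range_proj_idem.
Qed.

(* [R = R C C^T R + e R^2], so only positivity of [A] itself is needed. *)
Lemma tr_psd_rsv_ge0 (A : 'M[R]_p) X : psdmx A -> 0 <= \tr (A *m rsv e X).
Proof.
move=> pA.
have E : \tr (A *m rsv e X) =
    \tr ((rsv e X *m cdat X)^T *m A *m (rsv e X *m cdat X)) +
    e * \tr ((rsv e X)^T *m A *m rsv e X).
  have h : rsv e X = rsv e X *m scat X *m rsv e X + e *: (rsv e X *m rsv e X).
    by rewrite rsv_scat mulmxBl mul1mx -scalemxAl subrK.
  rewrite {1}h mulmxDr linearD /= -scalemxAr linearZ /= !trace_quad.
  by rewrite trmx_mul rsv_sym scatE !mulmxA.
rewrite E; apply: addr_ge0; first exact: psdmx_trace_ge0 (psdmx_quad _ pA).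
by apply: mulr_ge0; [exact: ltW|exact: psdmx_trace_ge0 (psdmx_quad _ pA)].
Qed.

End positive_regularization.
End resolvent.

(** * Divergence of the Stein field in the directions given by Sigma *)

Section divergence.
Context {R : realType} (n p : nat) (Sigma : 'M[R]_p).
Hypotheses (n_gt0 : (0 < n)%N) (psdS : psdmx Sigma).
Variables (e : R) (e_gt0 : 0 < e).
Local Notation K := (pinv Sigma).
Local Notation Pi := (range_proj Sigma).
Local Notation H := (centering n).
Local Notation C := (cdat Sigma).
Local Notation V := (@scat R n p Sigma).
Local Notation Rs := (@rsv R n p Sigma e).
Local Notation t := (@trsv R n p Sigma e).
Implicit Types X Z : 'M[R]_(p, n).

Let sS : Sigma^T = Sigma. Proof. by case: psdS. Qed.

Definition dcdat Z : 'M[R]_(p, n) := Pi *m Z *m H.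
Definition dscat X Z : 'M[R]_p := dcdat Z *m (C X)^T + C X *m (dcdat Z)^T.
Definition drsv X Z : 'M[R]_p := - (Rs X *m dscat X Z *m Rs X).

Lemma C1_linear_form (V' : lmodType R) (f : V' -> R) :
  (forall a u v, f (a *: u + v) = a * f u + f v) -> C1 f (fun _ z => f z).
Proof.
move=> lin.
have fE x z u : f (x + u *: z) = u * f z + f x by rewrite addrC lin.
split=> [x z s|x z|x a z z'] //; last by move=> s; exact: cvg_cst.
rewrite (_ : (fun u : R => _) = (fun u : R => u * f z + f x)); last by apply/funext => u; rewrite fE.
have -> : (fun u : R => u * f z + f x) = f z *: id + cst (f x).
  by apply/funext => u; rewrite /= mulrC.
by apply: is_derive_eq; rewrite addr0 /GRing.scale /= mulr1.
Qed.

Lemma C1_cdat : C1mx C (fun _ Z => dcdat Z).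
Proof.
move=> i j; apply: (@C1_ext _ _ (fun X => dcdat X i j) _ (fun _ Z => dcdat Z i j)) => //.
  by move=> X; rewrite cdatE.
apply: C1_linear_form => a u v.
by rewrite /dcdat mulmxDr mulmxDl -scalemxAr -scalemxAl [LHS]mxE [X in X + _ = _]mxE.
Qed.

Lemma C1_scat : C1mx V dscat.
Proof.
move=> i j; apply: C1_ext (C1mx_mul C1_cdat (C1mx_tr C1_cdat) i j) => // X.
by rewrite scatE.
Qed.

Lemma C1_rsv : C1mx Rs drsv.
Proof.
apply: C1mx_inv => [X|]; first exact: scat_unitmx.
by move=> i j; apply: C1_ext (C1mx_add C1_scat (C1mx_cst (V := 'M[R]_(p, n)) e%:M) i j) => // X Z; rewrite addr0.
Qed.

(** [K] cancels the [Sigma] of the directions [Sigma *m delta_mx b i], so the divergence contains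
    only resolvent traces. Paired with [X - mu], the field gives [tr (K R V) = tr K - e tr (K R)],
    and [tr K] is the unknown in the cross term of the loss. *)
Definition stein_field X : 'M[R]_(p, n) := K *m Rs X *m C X.
Definition dstein_field X Z : 'M[R]_(p, n) :=
  K *m drsv X Z *m C X + K *m Rs X *m dcdat Z.

Lemma C1_stein_field : C1mx stein_field dstein_field.
Proof.
move=> i j; apply: C1_ext (C1mx_mul (C1mx_mul (C1mx_cst K) C1_rsv) C1_cdat i j) => // X Z.
by rewrite mul0mx add0r.
Qed.

Lemma cdat_centering X : C X *m H = C X.
Proof. by rewrite cdatE -mulmxA centering_idem. Qed.

Lemma centering_cdat_tr X : H *m (C X)^T = (C X)^T.
Proof. by have := congr1 trmx (cdat_centering X); rewrite trmx_mul centering_tr. Qed.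

Lemma dcdatE b i : dcdat (Sigma *m delta_mx b i) = Sigma *m delta_mx b i *m H.
Proof. by rewrite /dcdat mulmxA range_proj_mul. Qed.

Lemma dcdat_trE b i : (dcdat (Sigma *m delta_mx b i))^T = H *m (delta_mx b i)^T *m Sigma.
Proof. by rewrite dcdatE !trmx_mul centering_tr sS mulmxA. Qed.

Lemma dscatE X b i : dscat X (Sigma *m delta_mx b i) =
  Sigma *m delta_mx b i *m (C X)^T + C X *m (delta_mx b i)^T *m Sigma.
Proof.
by rewrite /dscat dcdat_trE dcdatE -mulmxA centering_cdat_tr !mulmxA cdat_centering.
Qed.

Lemma tr_rsv_scat X : \tr (Rs X *m V X) = \tr Pi - e * t X.
Proof.
rewrite -(scat_proj Sigma X) mulmxA rsv_scat // mulmxBl mul1mx -scalemxAl.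
by rewrite linearB linearZ /= -proj_rsv.
Qed.

Lemma tr_rsv2_scat X : \tr (Pi *m Rs X *m Rs X *m V X) =
  t X - e * \tr (Pi *m Rs X *m Rs X).
Proof.
by rewrite -mulmxA rsv_scat // mulmxBr mulmx1 -scalemxAr linearB linearZ.
Qed.

Lemma tr_rsv3_scat X : \tr (Pi *m Rs X *m Rs X *m Rs X *m V X) =
  \tr (Pi *m Rs X *m Rs X) - e * \tr (Pi *m Rs X *m Rs X *m Rs X).
Proof.
by rewrite -mulmxA rsv_scat // mulmxBr mulmx1 -scalemxAr linearB linearZ.
Qed.

Lemma tr_pinv_rsv_scat X : \tr (K *m Rs X *m V X) = \tr K - e * \tr (K *m Rs X).
Proof.
by rewrite -mulmxA rsv_scat // mulmxBr mulmx1 -scalemxAr linearB linearZ.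
Qed.

Lemma tr_pinv_rsv_cov X : \tr (K *m Rs X *m Sigma) = t X.
Proof. by rewrite mxtrace_mulC mulmxA -range_projE. Qed.

(* [K Sigma = Pi] commutes with the resolvent and fixes [C]. *)
Lemma tr_field_cov X (B : 'M[R]_p) :
  \tr ((stein_field X)^T *m (Sigma *m B *m C X)) = \tr (Pi *m Rs X *m B *m V X).
Proof.
have -> : (stein_field X)^T *m (Sigma *m B *m C X) = (C X)^T *m (Pi *m Rs X *m B *m C X).
  rewrite /stein_field !trmx_mul pinv_sym // rsv_sym // !mulmxA.
  by rewrite -(mulmxA _ K) pinv_mulC // -(mulmxA _ _ Pi) -proj_rsv // !mulmxA.
by rewrite mxtrace_mulC scatE !mulmxA.
Qed.

(** Varying the outer [C] gives [tr (K R Sigma) * tr H = (n - 1) t]. Varying the resolvent subtracts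
    one term for each factor of [V = C C^T]: [t * tr (R V)] and [tr (Pi R R V)]. Setting [e = 0] in
    the formula leaves [(n - r - 2) t]. *)
Lemma divergence_field X :
  \sum_b \sum_i dstein_field X (Sigma *m delta_mx b i) b i =
  (n%:R - 1) * t X - (t X - e * \tr (Pi *m Rs X *m Rs X)) - (\tr Pi - e * t X) * t X.
Proof.
pose A := K *m Rs X *m Sigma.
have E b i : dstein_field X (Sigma *m delta_mx b i) b i =
    (A *m delta_mx b i *m H) b i
    - (A *m delta_mx b i *m ((C X)^T *m Rs X *m C X)) b i
    - (stein_field X *m (delta_mx b i)^T *m (Sigma *m Rs X *m C X)) b i.
  have subE (M N : 'M[R]_(p, n)) : (M - N) b i = M b i - N b i by rewrite !mxE.
  rewrite -!subE; congr (fun_of_matrix _ b i).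
  rewrite /dstein_field /drsv dscatE dcdatE /A /stein_field.
  rewrite !(mulmxDr, mulmxDl, mulmxN, mulNmx, mulmxA) addrC opprD addrA.
  by [].
under eq_bigr do under eq_bigr do rewrite E.
under eq_bigr do rewrite !big_split /= !sumrN.
rewrite !big_split /= !sumrN sum_delta_trace sum_delta_trace sum_delta_trmx.
rewrite centering_trace // tr_field_cov tr_pinv_rsv_cov tr_rsv2_scat.
rewrite mxtrace_mulC mulmxA -scatE mxtrace_mulC tr_rsv_scat.
by ring.
Qed.

Definition dtrsv X Z : R := \tr (Pi *m drsv X Z).

Lemma C1_trsv : C1 t dtrsv.
Proof.
apply: C1_ext (C1mx_trace (C1mx_mul (C1mx_cst Pi) C1_rsv)) => // X Z.
by rewrite mul0mx add0r.
Qed.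

Lemma dtrsvE X b i : dtrsv X (Sigma *m delta_mx b i) =
  - 2 * (Sigma *m (Rs X *m Pi *m Rs X) *m C X) b i.
Proof.
rewrite /dtrsv /drsv dscatE mulmxN linearN /= !(mulmxDr, mulmxDl) linearD /=.
have E1 : \tr (Pi *m (Rs X *m (Sigma *m delta_mx b i *m (C X)^T) *m Rs X)) =
    (Sigma *m (Rs X *m Pi *m Rs X) *m C X) b i.
  rewrite !mulmxA [LHS]mxtrace_mulC !mulmxA [LHS]mxtrace_mulC !mulmxA.
  rewrite trace_delta.
  by rewrite [RHS]mx_trE !trmx_mul sS rsv_sym // range_proj_sym // !mulmxA.
have E2 : \tr (Pi *m (Rs X *m (C X *m (delta_mx b i)^T *m Sigma) *m Rs X)) =
    \tr (Pi *m (Rs X *m (Sigma *m delta_mx b i *m (C X)^T) *m Rs X)).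
  rewrite -[LHS]mxtrace_tr !trmx_mul trmxK sS rsv_sym // range_proj_sym // !mulmxA.
  by rewrite [LHS]mxtrace_mulC !mulmxA.
rewrite E2 E1; ring.
Qed.

Lemma field_dtrsv X :
  \sum_b \sum_i stein_field X b i * dtrsv X (Sigma *m delta_mx b i) =
  - 2 * (\tr (Pi *m Rs X *m Rs X) - e * \tr (Pi *m Rs X *m Rs X *m Rs X)).
Proof.
under eq_bigr do under eq_bigr do rewrite dtrsvE mulrCA.
under eq_bigr do rewrite -mulr_sumr.
rewrite -mulr_sumr sum_entries_trace tr_field_cov; congr (_ * _).
rewrite -tr_rsv3_scat !mulmxA; congr (\tr (_ *m _ *m _)).
by rewrite -(mulmxA (Pi *m Rs X)) -proj_rsv // proj_rsvX.
Qed.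

Definition invtr X : R := (e + \tr (V X))^-1.
Definition dinvtr X Z : R := - invtr X ^+ 2 * \tr (dscat X Z).

Lemma etr_gt0 X : 0 < e + \tr (V X).
Proof. by rewrite ltr_wpDr // scat_trace_ge0. Qed.

Lemma C1_invtr : C1 invtr dinvtr.
Proof.
apply: C1_inv => [X|]; first by rewrite gt_eqF // etr_gt0.
by apply: C1_ext (C1_add (C1_cst e) (C1mx_trace C1_scat)) => // X Z; rewrite add0r.
Qed.

Lemma field_dinvtr X :
  \sum_b \sum_i stein_field X b i * dinvtr X (Sigma *m delta_mx b i) =
  - 2 * invtr X ^+ 2 * (\tr Pi - e * t X).
Proof.
have E b i : dinvtr X (Sigma *m delta_mx b i) = - 2 * invtr X ^+ 2 * (Sigma *m 1%:M *m C X) b i.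
  rewrite /dinvtr dscatE linearD /=.
  have E1 : \tr (Sigma *m delta_mx b i *m (C X)^T) = (Sigma *m 1%:M *m C X) b i.
    rewrite mulmx1 mxtrace_mulC !mulmxA trace_delta.
    by rewrite [RHS]mx_trE trmx_mul sS.
  have E2 : \tr (C X *m (delta_mx b i)^T *m Sigma) = \tr (Sigma *m delta_mx b i *m (C X)^T).
    by rewrite -[LHS]mxtrace_tr !trmx_mul trmxK sS mulmxA.
  rewrite E2 E1; ring.
under eq_bigr do under eq_bigr do rewrite E mulrCA.
under eq_bigr do rewrite -mulr_sumr.
rewrite -mulr_sumr sum_entries_trace tr_field_cov mulmx1; congr (_ * _).
by rewrite proj_rsv // -mulmxA proj_scat tr_rsv_scat.
Qed.

(** The field is centred on the right, and centring kills [mu *m const_mx 1]; this is how the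
    unknown mean disappears. *)
Lemma field_lhs (mu : 'cV[R]_p) X :
  \sum_b \sum_i (X b i - mu b 0) * stein_field X b i = \tr K - e * \tr (K *m Rs X).
Proof.
pose M : 'M[R]_(p, n) := X - mu *m const_mx 1.
have ME b i : X b i - mu b 0 = M b i by rewrite !mxE big_ord1 mxE mulr1.
under eq_bigr do under eq_bigr do rewrite ME.
have MH : H *m M^T *m K = (C X)^T *m K.
  rewrite -{1}(centering_tr (R := R) n) -trmx_mul mulmxBl -(mulmxA mu) const_centering //.
  rewrite mulmx0 subr0 cdatE !trmx_mul range_proj_sym // centering_tr.
  by rewrite -!mulmxA range_proj_pinv.
rewrite sum_entries_trace /stein_field -(cdat_centering X) !mulmxA [LHS]mxtrace_mulC !mulmxA MH.
by rewrite -!mulmxA mxtrace_mulC -tr_pinv_rsv_scat scatE !mulmxA.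
Qed.

End divergence.

(** * Stein's identity for the regularized field *)

Section stein_identity.
Context {R : realType} (n p : nat) (Sigma : 'M[R]_p).
Hypotheses (n_gt0 : (0 < n)%N) (psdS : psdmx Sigma).
Variables (e : R) (e_gt0 : 0 < e).
Local Notation K := (pinv Sigma).
Local Notation Pi := (range_proj Sigma).
Local Notation C := (cdat Sigma).
Local Notation V := (@scat R n p Sigma).
Local Notation Rs := (@rsv R n p Sigma e).
Local Notation t := (@trsv R n p Sigma e).
Local Notation F := (@stein_field R n p Sigma e).
Local Notation DF := (@dstein_field R n p Sigma e).
Implicit Types X Z : 'M[R]_(p, n).

Let sS : Sigma^T = Sigma. Proof. by case: psdS. Qed.
Local Notation bentries := (entries (@fbounded R 'M[R]_(p, n))).
Local Notation bring := (@fun_subring_bounded R 'M[R]_(p, n)).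

Lemma ler_norm_sqr1 (x M : R) : x ^+ 2 <= M -> `|x| <= 1 + M.
Proof.
by move=> h; rewrite ler_norml; apply/andP; split; nra.
Qed.

(** Trace of [V R = 1 - e R], with [tr (V R) >= 0]. *)
Lemma tr_rsv_le X : \tr (Rs X) <= e^-1 * p%:R.
Proof.
have := tr_psd_rsv_ge0 Sigma e_gt0 X (psdmx_scat Sigma X).
rewrite scat_rsv // linearB linearZ /= mxtrace1 => h.
by rewrite mulrC ler_pdivlMr // mulrC -subr_ge0.
Qed.

Lemma bounded_rsv : bentries Rs.
Proof.
move=> i j; exists (e^-1 * p%:R) => X.
exact: le_trans (psdmx_entry_le_trace i j (psdmx_rsv Sigma e_gt0 X)) (tr_rsv_le X).
Qed.

(** [C] is unbounded, but [(R C) (R C)^T = R V R = R - e R R] has trace at most [tr R]. *)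
Lemma bounded_rsv_cdat : bentries (fun X => Rs X *m C X).
Proof.
move=> i j; exists (1 + e^-1 * p%:R) => X; apply: ler_norm_sqr1.
apply: le_trans (tr_rsv_le X).
apply: le_trans (entry_sqr_le_gram _ i j) _.
rewrite trmx_mul rsv_sym // mulmxA -(mulmxA (Rs X)) -scatE rsv_scat //.
rewrite mulmxBl mul1mx -scalemxAl linearB linearZ /= gerBl; apply: mulr_ge0; first exact: ltW.
by have := psdmx_trace_ge0 (psdmx_gram (Rs X)); rewrite rsv_sym.
Qed.

Lemma bounded_cdat_rsv_cdat : bentries (fun X => (C X)^T *m Rs X *m C X).
Proof.
move=> i j; exists p%:R => X.
apply: le_trans (psdmx_entry_le_trace i j (psdmx_quad _ (psdmx_rsv Sigma e_gt0 X))) _.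
rewrite trace_quad -scatE rsv_scat // linearB linearZ /= mxtrace1 gerBl.
by apply: mulr_ge0; [exact: ltW|exact: psdmx_trace_ge0 (psdmx_rsv Sigma e_gt0 X)].
Qed.

Lemma bounded_stein_field : bentries F.
Proof.
apply: (entries_ext (A := fun X => K *m (Rs X *m C X))).
  by move=> X; rewrite /stein_field mulmxA.
by apply: (entries_mul bring); [exact: (entries_cst bring)|exact: bounded_rsv_cdat].
Qed.

Lemma bounded_dstein_field Z : bentries (DF^~ Z).
Proof.
pose D := dcdat Sigma Z.
(* The products are regrouped so that every unbounded [C] sits in a bounded block [R C] or
   [C^T R C]. *)
apply: (entries_ext (A := fun X => K *m (Rs X *m D)
   + - (K *m (Rs X *m D *m ((C X)^T *m Rs X *m C X) +
              (Rs X *m C X) *m D^T *m (Rs X *m C X))))).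
  move=> X; rewrite /dstein_field /drsv /dscat -/D.
  by rewrite !(mulmxDr, mulmxDl, mulmxN, mulNmx, mulmxA) addrC.
have cst k l (M : 'M[R]_(k, l)) : bentries (fun=> M) by exact: (entries_cst bring).
have bRD : bentries (fun X => Rs X *m D) by apply: (entries_mul bring) => //; exact: bounded_rsv.
apply: (entries_add bring); first exact: (entries_mul bring).
apply: (entries_opp bring); apply: (entries_mul bring) => //.
apply: (entries_add bring).
  by apply: (entries_mul bring) => //; exact: bounded_cdat_rsv_cdat.
apply: (entries_mul bring); last exact: bounded_rsv_cdat.
by apply: (entries_mul bring) => //; exact: bounded_rsv_cdat.
Qed.

Lemma bounded_trsv : fbounded t.
Proof.
apply: (entries_trace bring); apply: (entries_mul bring); first exact: (entries_cst bring).
exact: bounded_rsv.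
Qed.

Lemma bounded_dtrsv Z : fbounded ((@dtrsv R n p Sigma e)^~ Z).
Proof.
pose D := dcdat Sigma Z.
apply: (entries_trace bring); apply: (entries_mul bring); first exact: (entries_cst bring).
apply: (entries_ext (A := fun X => - (Rs X *m D *m (Rs X *m C X)^T
    + (Rs X *m C X) *m D^T *m Rs X))).
  move=> X; rewrite /drsv /dscat -/D trmx_mul rsv_sym //.
  by rewrite !(mulmxDr, mulmxDl, mulmxA).
apply: (entries_opp bring); apply: (entries_add bring).
  apply: (entries_mul bring); last exact/(entries_tr bounded_rsv_cdat).
  by apply: (entries_mul bring); [exact: bounded_rsv|exact: (entries_cst bring)].
apply: (entries_mul bring); last exact: bounded_rsv.
by apply: (entries_mul bring); [exact: bounded_rsv_cdat|exact: (entries_cst bring)].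
Qed.

Local Notation u := (@invtr R n p Sigma e).

Lemma invtr_gt0 X : 0 < u X.
Proof. by rewrite invr_gt0 etr_gt0. Qed.

Lemma bounded_invtr : fbounded u.
Proof.
exists e^-1 => X; rewrite (ger0_norm (ltW (invtr_gt0 X))).
by rewrite /invtr lef_pV2 ?posrE ?etr_gt0 // lerDl scat_trace_ge0.
Qed.

(** An entry of [C] is at most [1 + tr V], and [(1 + tr V) / (e + tr V) <= 1 / e + 1]. *)
Lemma bounded_invtr_cdat : bentries (fun X => u X *: C X).
Proof.
move=> i j; exists (e^-1 + 1) => X; rewrite mxE normrM (ger0_norm (ltW (invtr_gt0 X))).
have h : `|C X i j| <= 1 + \tr (V X).
  by apply: ler_norm_sqr1; rewrite scatE; exact: entry_sqr_le_gram.
have s0 := scat_trace_ge0 Sigma X.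
rewrite mulrC /invtr ler_pdivrMr ?etr_gt0 //; apply: le_trans h _.
rewrite mulrDl mul1r mulrDr mulVf ?gt_eqF // -addrA lerD2l.
rewrite addrA lerDr; apply: addr_ge0; last exact: ltW.
by rewrite mulr_ge0 // invr_ge0 ltW.
Qed.

Lemma bounded_dinvtr Z : fbounded ((@dinvtr R n p Sigma e)^~ Z).
Proof.
pose D := dcdat Sigma Z.
have [_ _ bM] := bring.
(* One of the two factors [u] is spent on making [C] bounded. *)
apply: (fun_subring_ext (f := fun X => - u X *
    \tr (D *m (u X *: C X)^T + (u X *: C X) *m D^T))).
  move=> X; rewrite /dinvtr /dscat -/D linearZ /= -scalemxAr -scalemxAl -scalerDr linearZ /=.
  ring.
apply: (bM).
  have [M hM] := bounded_invtr; exists M => X; rewrite normrN; exact: hM.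
apply: (entries_trace bring); apply: (entries_add bring).
  by apply: (entries_mul bring); [exact: (entries_cst bring)|exact/(entries_tr bounded_invtr_cdat)].
by apply: (entries_mul bring); [exact: bounded_invtr_cdat|exact: (entries_cst bring)].
Qed.

Section closure.
Variable Q : ('M[R]_(p, n) -> R) -> Prop.
Hypotheses (HQ : fun_subring Q) (Qid : entries Q id)
  (QV : forall f, (forall X, f X != 0) -> Q f -> Q (fun X => (f X)^-1)).

Lemma entries_cdat : entries Q C.
Proof.
apply: (entries_ext (A := fun X => Pi *m X *m centering n)).
  by move=> X; rewrite cdatE.
apply: (entries_mul HQ); last exact: entries_cst.
by apply: (entries_mul HQ) => //; exact: entries_cst.
Qed.

Lemma entries_scat : entries Q V.
Proof.
apply: (entries_ext (A := fun X => C X *m (C X)^T)); first by move=> X; rewrite scatE.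
by apply: (entries_mul HQ); [|apply: entries_tr]; exact: entries_cdat.
Qed.

Lemma entries_rsv : entries Q Rs.
Proof.
apply: (entries_inv HQ QV) => [X|]; first exact: scat_unitmx.
by apply: (entries_add HQ); [exact: entries_scat|exact: entries_cst].
Qed.

Lemma entries_dscat Z : entries Q ((dscat Sigma)^~ Z).
Proof.
apply: (entries_add HQ); apply: (entries_mul HQ); try exact: entries_cst.
  by apply: entries_tr; exact: entries_cdat.
exact: entries_cdat.
Qed.

Lemma entries_drsv Z : entries Q ((drsv Sigma e)^~ Z).
Proof.
apply: (entries_opp HQ); apply: (entries_mul HQ); last exact: entries_rsv.
by apply: (entries_mul HQ); [exact: entries_rsv|exact: entries_dscat].
Qed.

Lemma entries_stein_field : entries Q F.
Proof.
apply: (entries_mul HQ); last exact: entries_cdat.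
by apply: (entries_mul HQ); [exact: entries_cst|exact: entries_rsv].
Qed.

Lemma entries_dstein_field Z : entries Q (DF^~ Z).
Proof.
apply: (entries_add HQ); apply: (entries_mul HQ).
- by apply: (entries_mul HQ); [exact: entries_cst|exact: entries_drsv].
- exact: entries_cdat.
- by apply: (entries_mul HQ); [exact: entries_cst|exact: entries_rsv].
- exact: entries_cst.
Qed.

Lemma closure_trsv : Q t.
Proof.
apply: (entries_trace HQ); apply: (entries_mul HQ); first exact: entries_cst.
exact: entries_rsv.
Qed.

Lemma closure_dtrsv Z : Q ((dtrsv Sigma e)^~ Z).
Proof.
apply: (entries_trace HQ); apply: (entries_mul HQ); first exact: entries_cst.
exact: entries_drsv.
Qed.

Lemma closure_invtr : Q u.
Proof.
have [Qc QD _] := HQ.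
apply: QV => [X|]; first by rewrite gt_eqF // etr_gt0.
by apply: (QD) => //; exact/(entries_trace HQ)/entries_scat.
Qed.

Lemma closure_dinvtr Z : Q ((dinvtr Sigma e)^~ Z).
Proof.
have [Qc QD QM] := HQ.
apply: (QM); last exact/(entries_trace HQ)/entries_dscat.
apply: (fun_subring_ext (f := fun X => -1 * (u X * u X))).
  by move=> X; rewrite mulN1r expr2.
by apply: (QM) => //; apply: (QM); exact: closure_invtr.
Qed.

End closure.

Section application.
Context d (T : measurableType d) (P : probability T R)
  (X : 'I_n -> {mfun T >-> p.-tuple R}) (mu : 'cV[R]_p).
Hypothesis HX : iid_normal P X mu Sigma.

Definition data_measurable (f : 'M[R]_(p, n) -> R) : Prop :=
  measurable_fun setT (f \o @mxdata R n p).

Lemma fun_subring_data_measurable : fun_subring data_measurable.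
Proof.
split=> [c|f g mf mg|f g mf mg]; first exact: measurable_cst.
- exact: measurable_funD.
- exact: measurable_funM.
Qed.

Lemma data_measurableV f : (forall Y, f Y != 0) -> data_measurable f ->
  data_measurable (fun Y => (f Y)^-1).
Proof. by move=> _ mf; exact: measurable_funV. Qed.

Lemma entries_data_measurable : entries data_measurable id.
Proof. exact: measurable_mxdata. Qed.

Local Notation mring := fun_subring_data_measurable.

Section test_function.
Variables (h : 'M[R]_(p, n) -> R) (Dh : 'M[R]_(p, n) -> 'M[R]_(p, n) -> R).
Hypotheses (Ch : C1 h Dh) (bh : fbounded h) (bDh : forall Z, fbounded (Dh^~ Z)).
Hypotheses (mh : data_measurable h) (mDh : forall Z, data_measurable (Dh^~ Z)).

Lemma integral_bigsum m k (f : 'I_m -> 'I_k -> T -> R) :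
  (forall b i, P.-integrable setT (EFin \o f b i)) ->
  P.-integrable setT (EFin \o (fun w => \sum_b \sum_i f b i w)) /\
  (\int[P]_w (\sum_b \sum_i f b i w)%:E = \sum_b \sum_i \int[P]_w (f b i w)%:E)%E.
Proof.
move=> intf.
have intb b : P.-integrable setT (fun w => \sum_i (f b i w)%:E)%E.
  by apply: integrable_sum => // i _; exact: intf.
split.
  rewrite (_ : _ \o _ = (fun w => \sum_b \sum_i (f b i w)%:E)%E).
    by apply: integrable_sum.
  by apply/funext => w /=; rewrite -sumEFin; apply: eq_bigr => b _; rewrite -sumEFin.
under eq_integral do rewrite -sumEFin.
rewrite integral_sum //=; last first.
  by move=> b; under eq_fun do rewrite -sumEFin; exact: intb.
apply: eq_bigr => b _; under eq_integral do rewrite -sumEFin.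
by rewrite integral_sum // => i; exact: intf.
Qed.

(** [stein_sample] for each entry of [h F], in the direction of that same entry, summed over all
    entries. By the product rule the right side is [h] times the divergence of [F] plus the
    derivative of [h] along the field. *)
Lemma stein_identity :
  let lhs w := h (obs X w) * (\tr K - e * \tr (K *m Rs (obs X w))) in
  let rhs w := h (obs X w) * ((n%:R - 1) * t (obs X w)
      - (t (obs X w) - e * \tr (Pi *m Rs (obs X w) *m Rs (obs X w)))
      - (\tr Pi - e * t (obs X w)) * t (obs X w))
    + \sum_b \sum_i F (obs X w) b i * Dh (obs X w) (Sigma *m delta_mx b i) in
  [/\ P.-integrable setT (EFin \o lhs), P.-integrable setT (EFin \o rhs) &
      (\int[P]_w (lhs w)%:E = \int[P]_w (rhs w)%:E)%E].
Proof.
move=> lhs rhs.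
have mQ : forall f, (forall Y, f Y != 0) -> data_measurable f -> data_measurable (fun Y => (f Y)^-1).
  exact: data_measurableV.
pose g b i Y := h Y * F Y b i.
pose Dg b i Y Z := Dh Y Z * F Y b i + h Y * DF Y Z b i.
have Cg b i : C1 (g b i) (Dg b i) by apply: C1_mul => //; exact: C1_stein_field.
have [_ bD bM] := bring; have [_ mD mM] := mring.
have bg b i : fbounded (g b i) by apply: (bM) => //; exact: bounded_stein_field.
have bDg b i Z : fbounded ((Dg b i)^~ Z).
  apply: (bD); apply: (bM) => //; first exact: bounded_stein_field.
  exact: (bounded_dstein_field Z b i).
have mF b i := entries_stein_field mring entries_data_measurable mQ b i.
have mg b i : data_measurable (g b i) by apply: (mM) => //; exact: mF.
have mDg b i Z : data_measurable ((Dg b i)^~ Z).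
  apply: (mD); [apply: (mM); [exact: mDh|exact: mF]|apply: (mM); first exact: mh].
  exact: (entries_dstein_field mring entries_data_measurable mQ Z b i).
pose f1 b i w := (obs X w b i - mu b 0) * g b i (obs X w).
pose f2 b i w := Dg b i (obs X w) (Sigma *m delta_mx b i).
have int1 b i : P.-integrable setT (EFin \o f1 b i).
  exact: (integrable_stein_lhs HX (bg b i) (mg b i) b i).
have int2 b i : P.-integrable setT (EFin \o f2 b i).
  exact: (integrable_stein_rhs P X (bDg b i) (mDg b i) (Sigma *m delta_mx b i)).
have [i1 e1] := integral_bigsum int1.
have [i2 e2] := integral_bigsum int2.
have E1 w : \sum_b \sum_i f1 b i w = lhs w.
  rewrite /lhs -(field_lhs n_gt0 psdS e_gt0 mu) mulr_sumr; apply: eq_bigr => b _.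
  by rewrite mulr_sumr; apply: eq_bigr => i _; rewrite /f1 /g mulrCA.
have E2 w : \sum_b \sum_i f2 b i w = rhs w.
  rewrite /rhs -(divergence_field n_gt0 psdS e_gt0) mulr_sumr -big_split; apply: eq_bigr => b _.
  rewrite mulr_sumr -big_split; apply: eq_bigr => i _.
  by rewrite /f2 /Dg addrC [F _ _ _ * _]mulrC.
have L1 : (EFin \o lhs) = EFin \o (fun w => \sum_b \sum_i f1 b i w) by apply/funext => w /=; rewrite E1.
have L2 : (EFin \o rhs) = EFin \o (fun w => \sum_b \sum_i f2 b i w) by apply/funext => w /=; rewrite E2.
split; [by rewrite L1|by rewrite L2|].
under eq_integral do rewrite -E1; under [RHS]eq_integral do rewrite -E2.
rewrite e1 e2; apply: eq_bigr => b _; apply: eq_bigr => i _.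
exact: (stein_sample HX (Cg b i) (bg b i) (bDg b i) (mg b i) (mDg b i) b i).
Qed.

End test_function.
End application.
End stein_identity.

(** * Two choices of the scalar factor in Stein's identity *)

Section regularized_moments.
Context {R : realType} (n p : nat) (Sigma : 'M[R]_p).
Hypotheses (n_gt0 : (0 < n)%N) (psdS : psdmx Sigma).
Context d (T : measurableType d) (P : probability T R)
  (X : 'I_n -> {mfun T >-> p.-tuple R}) (mu : 'cV[R]_p).
Hypothesis HX : iid_normal P X mu Sigma.
Local Notation K := (pinv Sigma).
Local Notation Pi := (range_proj Sigma).
Local Notation V := (@scat R n p Sigma).
Local Notation Rs := (@rsv R n p Sigma).
Local Notation t := (@trsv R n p Sigma).
Local Notation u := (@invtr R n p Sigma).
Local Notation mring := (@fun_subring_data_measurable R n p).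
Local Notation mid := (@entries_data_measurable R n p).
Local Notation mV := (@data_measurableV R n p).

Let sS : Sigma^T = Sigma. Proof. by case: psdS. Qed.

Lemma measurable_trsv_obs e : 0 < e -> measurable_fun setT (fun w => t e (obs X w)).
Proof.
move=> e0.
exact: (measurableT_comp (closure_trsv Sigma e0 mring mid mV) (measurable_joint X)).
Qed.

Lemma second_moment_trsv (e a : R) : 0 < e -> a = n%:R - \tr Pi - 4 -> 0 < a ->
  (\int[P]_w (t e (obs X w) ^+ 2)%:E <= ((\tr K / a) ^+ 2)%:E)%E.
Proof.
move=> e0 aE a_gt0.
have [il ir eq] := stein_identity n_gt0 psdS e0 HX (@C1_trsv R n p Sigma e e0)
  (@bounded_trsv R n p Sigma e e0) (@bounded_dtrsv R n p Sigma e e0)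
  (closure_trsv Sigma e0 mring mid mV) (closure_dtrsv Sigma e0 mring mid mV).
have it2 : P.-integrable setT (EFin \o (fun w => t e (obs X w) ^+ 2)).
  apply: bounded_integrable; first exact/measurable_funX/measurable_trsv_obs.
  have [_ _ bM] := @fun_subring_bounded R T.
  by apply: bM; have [M hM] := @bounded_trsv R n p Sigma e e0; exists M => w; exact: hM.
set k := \tr K in il eq *.
have iat2 : P.-integrable setT (fun w => (a / 2)%:E * (t e (obs X w) ^+ 2)%:E)%E.
  exact: (integrableZl measurableT (a / 2) it2).
have ik : P.-integrable setT (cst (k ^+ 2 / (2 * a))%:E).
  exact: finite_measure_integrable_cst.
(* The integrand lies below the right side minus the left side of Stein's identity, a difference of
   integral 0. *)
have le0 : (\int[P]_w ((a / 2)%:E * (t e (obs X w) ^+ 2)%:E - (k ^+ 2 / (2 * a))%:E) <= 0)%E.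
  have := integralB measurableT ir il.
  have := integrable_fin_num measurableT il; move: eq => /= -> fin.
  rewrite [X in _ = X -> _]subee // => <-.
  apply: le_integral => //; [exact: (integrableB measurableT iat2 ik)|exact: (integrableB measurableT ir il)|].
  move=> w _ /=; rewrite -EFinM -!EFinB lee_fin (field_dtrsv n_gt0 psdS e0).
  set x := t e _; set t2 := \tr (Pi *m _ *m _); set t3 := \tr (_ *m _ *m _ *m _).
  set s := \tr (K *m _).
  have x0 : 0 <= x by exact: trsv_ge0.
  have t20 : 0 <= t2 by exact: tr_rsv2_ge0.
  (* The derivative of [h = tr (Pi R)] costs at most [2 t2 <= 2 x^2]; this lowers the coefficient
     [n - r - 2] of the divergence to [a = n - r - 4]. *)
  have t2x : t2 <= x ^+ 2 by exact: tr_rsv2_le.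
  have h1 : 0 <= e * x * t2 by rewrite !mulr_ge0 // ltW.
  have h2 : 0 <= e * x ^+ 3 by rewrite mulr_ge0 ?exprn_ge0 // ltW.
  have h3 : 0 <= e * t3 by apply: mulr_ge0; [exact: ltW|exact: tr_rsv3_ge0].
  have h4 : 0 <= e * x * s.
    by rewrite !mulr_ge0 ?(ltW e0) //; exact: tr_psd_rsv_ge0 (psdmx_pinv sS psdS).
  (* Completing the square trades the linear term for a constant, so only the integral of [x ^+ 2]
     remains, and it is at most [(k / a)^2]. *)
  have h5 : a / 2 * x ^+ 2 - k ^+ 2 / (2 * a) <= a * x ^+ 2 - k * x.
    rewrite -subr_ge0.
    have -> : a * x ^+ 2 - k * x - (a / 2 * x ^+ 2 - k ^+ 2 / (2 * a)) = (a * x - k) ^+ 2 / (2 * a).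
      by field; rewrite gt_eqF.
    by rewrite divr_ge0 ?sqr_ge0 // mulr_ge0 // ltW.
  apply: le_trans h5 _; rewrite aE; nra.
move: le0; rewrite integralB // (integralZl measurableT it2) integral_cst //=.
rewrite probability_setT mule1.
have := integrable_fin_num measurableT it2 => /= f2.
rewrite -(fineK f2); set I := fine _.
rewrite -EFinM -EFinB !lee_fin subr_le0 => h.
have -> : (k / a) ^+ 2 = (2 / a) * (k ^+ 2 / (2 * a)) by field; rewrite gt_eqF.
have -> : I = (2 / a) * (a / 2 * I) by field; rewrite gt_eqF.
by rewrite ler_wpM2l // divr_ge0 // ltW.
Qed.

Lemma stein_invtr (e : R) : 0 < e ->
  let lhs w := u e (obs X w) * (\tr K - e * \tr (K *m Rs e (obs X w))) in
  let rhs w := u e (obs X w) * ((n%:R - 1) * t e (obs X w)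
      - (t e (obs X w) - e * \tr (Pi *m Rs e (obs X w) *m Rs e (obs X w)))
      - (\tr Pi - e * t e (obs X w)) * t e (obs X w))
    - 2 * u e (obs X w) ^+ 2 * (\tr Pi - e * t e (obs X w)) in
  [/\ P.-integrable setT (EFin \o lhs), P.-integrable setT (EFin \o rhs) &
      (\int[P]_w (lhs w)%:E = \int[P]_w (rhs w)%:E)%E].
Proof.
move=> e0 lhs rhs.
have [il ir eq] := stein_identity n_gt0 psdS e0 HX (@C1_invtr R n p Sigma e e0)
  (@bounded_invtr R n p Sigma e e0) (@bounded_dinvtr R n p Sigma e e0)
  (closure_invtr Sigma e0 mring mid mV) (closure_dinvtr Sigma e0 mring mid mV).
have rhsE w : u e (obs X w) * ((n%:R - 1) * t e (obs X w)
      - (t e (obs X w) - e * \tr (Pi *m Rs e (obs X w) *m Rs e (obs X w)))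
      - (\tr Pi - e * t e (obs X w)) * t e (obs X w))
    + \sum_b \sum_i stein_field Sigma e (obs X w) b i *
        dinvtr Sigma e (obs X w) (Sigma *m delta_mx b i) = rhs w.
  by rewrite /rhs (field_dinvtr n_gt0 psdS e0) !mulNr.
split=> //.
  by move: ir => /=; rewrite (_ : (fun w : T => _) = rhs) //; exact/funext.
by rewrite [LHS]eq; apply: eq_integral => w _; rewrite -rhsE.
Qed.

End regularized_moments.

(** * Removal of the regularization *)

Section bounded_perturbation.
Context {R : realType}.

(** The regularization is removed along [e = 1 / (k + 1)]; resolvent expressions are written as
    their limit plus [e] times something bounded in [k]. *)
Lemma cvg_add_harmonic (f b : nat -> R) (l : R) : fbounded b ->
  (forall k, f k = l + k.+1%:R^-1 * b k) -> f k @[k --> \oo] --> l.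
Proof.
move=> [M hM] fE; apply/cvgrPdist_lt => /= eps eps0.
have : (harmonic k * (`|M| + 1)) @[k --> \oo] --> (0 * (`|M| + 1) : R).
  by apply: cvgM; [exact: cvg_harmonic|exact: cvg_cst].
rewrite mul0r => /cvgr0Pnorm_lt /(_ _ eps0); apply: filterS => k.
rewrite fE opprD addNKr normrN !normrM => h.
apply: le_lt_trans h; rewrite ler_wpM2l //.
apply: le_trans (hM k) _; apply: le_trans (ler_norm M) _.
by rewrite ger0_norm ?addr_ge0 // lerDl.
Qed.

End bounded_perturbation.

(** The crude factor counts the [p^2] products of entries, each at most the product of the traces;
    it only serves to produce dominating functions. *)
Lemma tr_mul_psdmx_le (R : realType) p (A B : 'M[R]_p) : psdmx A -> psdmx B ->
  \tr (A *m B) <= p%:R ^+ 2 * (\tr A * \tr B).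
Proof.
move=> pA pB; rewrite /mxtrace -/(mxtrace A) -/(mxtrace B).
apply: (@le_trans _ _ (\sum_(i < p) \sum_(j < p) \tr A * \tr B)).
  apply: ler_sum => i _; rewrite mxE; apply: ler_sum => j _.
  apply: le_trans (ler_norm _) _; rewrite normrM.
  by rewrite ler_pM // psdmx_entry_le_trace.
by rewrite !sumr_const !card_ord -mulrnA -[leLHS]mulr_natl natrM expr2.
Qed.

(** * The resolvent as the regularization tends to zero, for fixed data *)

Section pinv_limit.
Context {R : realType} (n p : nat) (Sigma : 'M[R]_p).
Local Notation Pi := (range_proj Sigma).
Local Notation V := (@scat R n p Sigma).
Local Notation Rs := (@rsv R n p Sigma).
Local Notation t := (@trsv R n p Sigma).
Hypothesis sSigma : Sigma^T = Sigma.
Variable X : 'M[R]_(p, n).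
Local Notation W := (pinv (V X)).

Let sV : (V X)^T = V X. Proof. exact: scat_sym. Qed.

Let e_ (k : nat) : R := k.+1%:R^-1.
Let e_gt0 k : 0 < e_ k. Proof. by rewrite invr_gt0. Qed.

Lemma bounded_scaled_rsv :
  entries (@fbounded R nat) (fun k => e_ k *: Rs (e_ k) X).
Proof.
move=> i j; exists p%:R => k; rewrite mxE normrM (ger0_norm (ltW (e_gt0 k))).
have h := psdmx_entry_le_trace i j (psdmx_rsv Sigma (e_gt0 k) X).
apply: (@le_trans _ _ (e_ k * (e_ k)^-1 * p%:R)); last by rewrite mulfV ?mul1r ?gt_eqF.
rewrite -mulrA ler_wpM2l ?(ltW (e_gt0 k)) //.
exact: le_trans h (tr_rsv_le Sigma (e_gt0 k) X).
Qed.

Lemma rsv_range_proj e : 0 < e -> Rs e X *m range_proj (V X) = W - e *: (Rs e X *m W).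
Proof. by move=> e0; rewrite range_projE mulmxA rsv_scat // mulmxBl mul1mx scalemxAl. Qed.

Lemma rsv_pinv e : 0 < e ->
  Rs e X *m W = (1%:M - e *: Rs e X) *m (W *m W).
Proof.
move=> e0; rewrite -[in LHS](range_proj_pinv sV) mulmxA rsv_range_proj //.
by rewrite mulmxBl mulmxBl mul1mx -!scalemxAl mulmxA.
Qed.

(** On the range of [V] one has [R = W - e R W]. Expanding twice leaves an error equal to [e] times
    a polynomial in [e R], which stays bounded, applied to the fixed matrix [W W]. *)
Lemma rsv_scat_rsv e : 0 < e ->
  Rs e X *m V X *m Rs e X = W + e *: ((e *: Rs e X - 2%:M) *m (1%:M - e *: Rs e X) *m (W *m W)).
Proof.
move=> e0.
have comm : range_proj (V X) *m Rs e X = Rs e X *m range_proj (V X).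
  apply: comm_invmx (scat_unitmx Sigma e0 X) _.
  by rewrite mulmxDl mulmxDr range_proj_mul mul_range_proj // mul_mx_scalar mul_scalar_mx.
rewrite -{1}(mul_range_proj sV) mulmxA -mulmxA comm rsv_range_proj // rsv_scat //.
have RW := rsv_pinv e0; rewrite -[in RHS]mulmxA -RW; set Y := Rs e X *m W.
rewrite mulmxBl mul1mx mulmxBr -[X in _ - (X - _)]scalemxAl -/Y -scalemxAr.
rewrite mulmxBl mul_scalar_mx scalerBr.
move: (e *: (e *: Rs e X *m Y)) => Z.
by apply/matrixP => i j; rewrite !mxE; ring.
Qed.

(** [R] alone behaves like [1 / e] on the kernel of [V]; the factor [V] in [R V R] removes that
    part. The limit is therefore the pseudoinverse for every data matrix, whatever the rank of
    [V]. *)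
Lemma cvg_pinv i j :
  (Rs (e_ k) X *m V X *m Rs (e_ k) X) i j @[k --> \oo] --> W i j.
Proof.
have bring := @fun_subring_bounded R nat.
pose B k := (e_ k *: Rs (e_ k) X - 2%:M) *m (1%:M - e_ k *: Rs (e_ k) X) *m (W *m W).
have bB : entries (@fbounded R nat) B.
  apply: (entries_mul bring); last exact: (entries_cst bring).
  apply: (entries_mul bring); apply: (entries_add bring); try exact: (entries_cst bring).
    exact: bounded_scaled_rsv.
  exact: (entries_opp bring bounded_scaled_rsv).
apply: (cvg_add_harmonic (bB i j)) => k.
by rewrite rsv_scat_rsv // [LHS]mxE [X in _ + X]mxE.
Qed.

(** On the part of the range of [Sigma] that [V] misses, the resolvent is [1 / e]. The projection
    [Q] on that part has as trace a difference of ranks, so once positive it is at least 1. A moment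
    bound uniform in [e] can thus exclude rank deficiency. *)
Lemma trsv_lower (e : R) : 0 < e -> range_proj (V X) <> Pi -> e^-1 <= t e X.
Proof.
move=> e0 bad; pose Q := Pi - range_proj (V X).
have PV : Pi *m range_proj (V X) = range_proj (V X) by rewrite (range_projE (V X)) mulmxA proj_scat.
have VP : range_proj (V X) *m Pi = range_proj (V X).
  by have := congr1 trmx PV; rewrite trmx_mul !range_proj_sym.
have sQ : Q^T = Q by rewrite linearB /= !range_proj_sym.
have QQ : Q *m Q = Q.
  by rewrite mulmxBl !mulmxBr !range_proj_idem PV VP subrr subr0.
have VQ : V X *m Q = 0 by rewrite mulmxBr scat_proj mul_range_proj ?subrr.
have RQ : Rs e X *m Q = e^-1 *: Q.
  have uX := scat_unitmx Sigma e0 X.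
  have h : (V X + e%:M) *m Q = e *: Q by rewrite mulmxDl VQ add0r mul_scalar_mx.
  by rewrite -{1}(scalerK (lt0r_neq0 e0) Q) -h -scalemxAr mulmxA mulVmx // mul1mx.
have trQ : 1 <= \tr Q.
  have tQ : \tr Q = (\rank Sigma)%:R - (\rank (V X))%:R.
    by rewrite linearB /= !range_proj_trace.
  have : 0 < \tr Q.
    rewrite lt_neqAle eq_sym; apply/andP; split.
      apply/eqP => t0; apply: bad; apply/esym/eqP; rewrite -subr_eq0 -/Q; apply/eqP.
      by apply: mxtrace_gram_eq0; rewrite sQ QQ t0.
    by rewrite -QQ -{2}sQ; exact: psdmx_trace_ge0 (psdmx_gram Q).
  by rewrite tQ subr_gt0 ltr_nat => lt; rewrite -natrB ?ler1n ?subn_gt0 // ltnW.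
have -> : t e X = \tr (range_proj (V X) *m Rs e X) + e^-1 * \tr Q.
  rewrite -linearZ /= -RQ [X in _ + X]mxtrace_mulC -linearD /= -mulmxDl.
  by rewrite addrC subrK.
have pP : psdmx (range_proj (V X)).
  by rewrite -(range_proj_idem (V X)) -{2}(range_proj_sym (V X)); exact: psdmx_gram.
have := tr_psd_rsv_ge0 Sigma e0 X pP.
have : e^-1 <= e^-1 * \tr Q by rewrite ler_peMr // invr_ge0 ltW.
by move=> h1 h2; apply: le_trans h1 _; rewrite lerDr.
Qed.

Section full_rank.
Hypothesis good : range_proj (V X) = Pi.

Lemma psdmx_pinv_scat : psdmx W.
Proof. exact: psdmx_pinv sV (psdmx_scat Sigma X). Qed.

Lemma trsvE e : 0 < e -> t e X = \tr W - e * \tr (Rs e X *m W).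
Proof.
by move=> e0; rewrite /trsv proj_rsv // -good rsv_range_proj // linearB linearZ.
Qed.

Lemma trsv_le e : 0 < e -> t e X <= \tr W.
Proof.
move=> e0; rewrite trsvE // gerBl mulr_ge0 ?(ltW e0) // mxtrace_mulC.
exact: tr_psd_rsv_ge0 psdmx_pinv_scat.
Qed.

Lemma cvg_trsv : t (e_ k) X @[k --> \oo] --> \tr W.
Proof.
have bring := @fun_subring_bounded R nat.
pose b k := \tr (- ((1%:M - e_ k *: Rs (e_ k) X) *m (W *m W))).
have bb : fbounded b.
  apply: (entries_trace bring); apply: (entries_opp bring); apply: (entries_mul bring).
    apply: (entries_add bring); first exact: (entries_cst bring).
    exact: (entries_opp bring bounded_scaled_rsv).
  exact: (entries_cst bring).
apply: (cvg_add_harmonic bb) => k.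
by rewrite trsvE // rsv_pinv // /b linearN mulrN.
Qed.

Lemma scat_trace_gt0 : 0 < \tr Pi -> 0 < \tr (V X).
Proof.
move=> r0; rewrite lt_neqAle scat_trace_ge0 andbT; apply/eqP => /esym V0.
move: r0; rewrite -good range_projE.
have -> : V X = 0.
  by rewrite scatE (_ : cdat Sigma X = 0) ?mul0mx //; apply: mxtrace_gram_eq0; rewrite -scatE V0.
by rewrite mul0mx linear0 ltxx.
Qed.

(** Cauchy-Schwarz: the trace of [(a Pi - V) W (a Pi - V)] is a nonnegative quadratic in [a],
    evaluated at [a = tr V / tr Pi]. *)
Lemma trace_proj_sqr_le : 0 < \tr Pi -> \tr Pi ^+ 2 <= \tr (V X) * \tr W.
Proof.
move=> r0; have tau0 := scat_trace_gt0 r0.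
have q a : 0 <= a ^+ 2 * \tr W - 2 * a * \tr Pi + \tr (V X).
  have := psdmx_trace_ge0 (psdmx_quad (a *: Pi - V X) psdmx_pinv_scat).
  rewrite trace_quad linearB linearZ /= range_proj_sym sV.
  have WPi : W *m Pi = W by rewrite -good pinv_range_proj.
  have WV : W *m V X = Pi by rewrite pinv_mulC.
  have -> : W *m ((a *: Pi - V X) *m (a *: Pi - V X)) =
      a ^+ 2 *: W - (2 * a) *: Pi + V X.
    have WN : W *m (a *: Pi - V X) = a *: W - Pi by rewrite mulmxBr -scalemxAr WPi WV.
    rewrite mulmxA WN mulmxBl -scalemxAl WN mulmxBr -scalemxAr range_proj_idem proj_scat.
    move: W Pi (V X) => w q v.
    by apply/matrixP => i j; rewrite !mxE; ring.
  by rewrite linearD linearB !linearZ /=.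
move: q tau0 r0; move: (\tr W) (\tr Pi) (\tr (V X)) => w r tau q tau0 r0.
have := q (tau / r).
have -> : (tau / r) ^+ 2 * w - 2 * (tau / r) * r + tau = tau / r ^+ 2 * (tau * w - r ^+ 2).
  by field; rewrite gt_eqF.
by rewrite pmulr_rge0 ?subr_ge0 // divr_gt0 // exprn_gt0.
Qed.

End full_rank.
End pinv_limit.

(** * Almost sure full rank, moments of the pseudoinverse and the limiting identity *)

Section pinv_moments.
Context {R : realType} (n p : nat) (Sigma : 'M[R]_p).
Hypotheses (psdS : psdmx Sigma) (rank_gt0 : (0 < \rank Sigma)%N)
  (rank_le : (\rank Sigma + 5 <= n)%N).
Context d (T : measurableType d) (P : probability T R)
  (X : 'I_n -> {mfun T >-> p.-tuple R}) (mu : 'cV[R]_p).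
Hypothesis HX : iid_normal P X mu Sigma.
Local Notation K := (pinv Sigma).
Local Notation Pi := (range_proj Sigma).
Local Notation V := (@scat R n p Sigma).
Local Notation Rs := (@rsv R n p Sigma).
Local Notation t := (@trsv R n p Sigma).
Local Notation u := (@invtr R n p Sigma).
Local Notation W w := (pinv (V (obs X w))).

Let sS : Sigma^T = Sigma. Proof. by case: psdS. Qed.
Let n_gt0 : (0 < n)%N. Proof. by apply: leq_trans rank_le; rewrite addnS. Qed.
Let r : R := (\rank Sigma)%:R.
Let trPi : \tr Pi = r. Proof. exact: range_proj_trace. Qed.
Let a : R := n%:R - \tr Pi - 4.
Let a_gt0 : 0 < a.
Proof.
rewrite /a trPi /r -addrA -opprD subr_gt0 -natrD ltr_nat.
by rewrite -addnS.
Qed.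
Let e_ (k : nat) : R := k.+1%:R^-1.
Let e_gt0 k : 0 < e_ k. Proof. by rewrite invr_gt0. Qed.
Let bound : R := (\tr K / a) ^+ 2.

Let moment k : (\int[P]_w (t (e_ k) (obs X w) ^+ 2)%:E <= bound%:E)%E.
Proof. exact: (second_moment_trsv n_gt0 psdS HX (e_gt0 k) erefl a_gt0). Qed.

Let mt k : measurable_fun setT (fun w => t (e_ k) (obs X w)).
Proof. exact: measurable_trsv_obs. Qed.

(** [pinv] is defined by choice, so measurability comes from [cvg_pinv], a pointwise limit of
    measurable functions. It is applied to [Sigma] and to [1%:M], the latter for the sample
    covariance. *)
Lemma measurable_pinv_scat_obs (S : 'M[R]_p) :
  S^T = S -> entries (fun f => measurable_fun setT f) (fun w => pinv (scat S (obs X w))).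
Proof.
move=> sS' i j.
have mring := @fun_subring_data_measurable R n p.
have mid := @entries_data_measurable R n p.
have mV := @data_measurableV R n p.
apply: (@measurable_fun_cvg _ _ _ setT
  (fun k w => (rsv S (e_ k) (obs X w) *m scat S (obs X w) *m rsv S (e_ k) (obs X w)) i j)).
- move=> k; have mR := entries_rsv S (e_gt0 k) mring mid mV.
  have h := entries_mul mring (entries_mul mring mR (entries_scat S mring mid)) mR i j.
  exact: (measurableT_comp h (measurable_joint X)).
- by move=> w _; exact: cvg_pinv.
Qed.

Lemma measurable_trpinv : measurable_fun setT (fun w => \tr (W w)).
Proof.
by apply: (entries_trace (@fun_subring_measurable R _ T)); exact: measurable_pinv_scat_obs.
Qed.

(** If the rank drops, then [t (e_ k) >= k + 1] for every [k] by [trsv_lower]. By Markov's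
    inequality and the uniform second moment, each such event has probability at most
    [bound / (k + 1)^2]. *)
Lemma ae_full_rank : \forall w \ae P, range_proj (V (obs X w)) = Pi.
Proof.
pose B k : set T := [set w | k.+1%:R <= t (e_ k) (obs X w)].
have mB k : measurable (B k).
  rewrite -[B k]setTI (_ : B k = (fun w => t (e_ k) (obs X w)) @^-1` `[k.+1%:R, +oo[%classic).
    by apply: mt => //; exact: measurable_itv.
  by apply/seteqP; split => w; rewrite /B /= in_itv /= andbT.
have PB k : (P (B k) <= (bound * e_ k ^+ 2)%:E)%E.
  have h : (\int[P]_w ((k.+1%:R ^+ 2)%:E * (\1_(B k) w)%:E) <= bound%:E)%E.
    apply: le_trans (moment k); apply: ge0_le_integral => //.
    - by apply/measurable_EFinP; apply: measurable_funM => //; exact: measurable_indic.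
    - by apply/measurable_EFinP; exact: measurable_funX.
    - move=> w _; rewrite -EFinM lee_fin indicE; have [wB|wB] := boolP (w \in B k).
        by rewrite mulr1; move: wB; rewrite inE /B /= => wB; rewrite ler_pXn2r // nnegrE // ltW // (lt_le_trans _ wB).
      by rewrite mulr0 sqr_ge0.
  move: h; rewrite ge0_integralZl //; last first.
    by apply/measurable_EFinP; exact: measurable_indic.
  rewrite integral_indic // setIT => h.
  have -> : P (B k) = ((e_ k ^+ 2)%:E * ((k.+1%:R ^+ 2)%:E * P (B k)))%E.
    by rewrite muleA -EFinM -exprMn mulVf // expr1n mul1e.
  rewrite [bound * _]mulrC (EFinM (e_ k ^+ 2) bound).
  by apply: lee_wpmul2l; rewrite ?lee_fin ?sqr_ge0.
have PN0 : P (\bigcap_k B k) = 0%E.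
  apply/eqP; rewrite eq_le measure_ge0 andbT.
  have lim : (bound * e_ k ^+ 2) @[k --> \oo] --> (0 : R).
    rewrite -[X in _ --> X](mulr0 bound); apply: cvgM; first exact: cvg_cst.
    rewrite -[X in _ --> X](mulr0 (0 : R)).
    by under eq_fun do rewrite expr2; apply: cvgM; exact: cvg_harmonic.
  apply/lee_addgt0Pr => eps eps0; rewrite add0e.
  have [k _ /(_ k (leqnn _)) hk] := (cvgr0Pnorm_lt _).1 lim eps eps0.
  apply: le_trans (le_measure P _ _ (_ : _ `<=` B k)) _; rewrite ?inE //.
  - exact: bigcapT_measurable.
  - by move=> w /(_ k I).
  - apply: le_trans (PB k) _; rewrite lee_fin.
    exact: le_trans (ler_norm _) (ltW hk).
exists (\bigcap_k B k); split=> //; first exact: bigcapT_measurable.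
move=> w /= bad k _; rewrite /B /= -[k.+1%:R]invrK.
exact: trsv_lower.
Qed.

(** Fatou's lemma: on the full rank event [t (e_ k)] converges to [tr W]. *)
Lemma second_moment_trpinv : (\int[P]_w (\tr (W w) ^+ 2)%:E <= bound%:E)%E.
Proof.
have mf k : measurable_fun setT (fun w => (t (e_ k) (obs X w) ^+ 2)%:E).
  by apply/measurable_EFinP; exact: measurable_funX.
have := @fatou _ _ _ P setT measurableT (fun k w => (t (e_ k) (obs X w) ^+ 2)%:E) mf.
move=> /(_ _)/wrap[k w _|h]; first by rewrite lee_fin sqr_ge0.
have einfE : (\int[P]_w (\tr (W w) ^+ 2)%:E =
    \int[P]_w limn_einf (fun k => (t (e_ k) (obs X w) ^+ 2)%:E))%E.
  apply: ge0_ae_eq_integral => //.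
  - by apply/measurable_EFinP; apply: measurable_funX; exact: measurable_trpinv.
  - under eq_fun do rewrite -[limn_einf _]oppeK -limn_esupN.
    apply: measurableT_comp => //; apply: measurable_fun_limn_esup => k.
    by apply: measurableT_comp.
  - by move=> w _; rewrite lee_fin sqr_ge0.
  - move=> w _; rewrite limn_einf_lim; apply: lime_ge; first exact: is_cvg_einfs.
    apply: nearW => k; apply: le_ereal_inf_tmp => _ [m _ <-].
    by rewrite lee_fin sqr_ge0.
  - apply: filterS ae_full_rank => w good _.
    have c : (t (e_ k) (obs X w) ^+ 2)%:E @[k --> \oo] --> (\tr (W w) ^+ 2)%:E.
      apply: cvg_EFin; first by near=> k.
      rewrite expr2; under eq_fun do rewrite /= expr2.
      by apply: cvgM; exact: cvg_trsv.
    by rewrite (cvg_limn_einf_sup c).1.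
rewrite einfE; apply: le_trans h _.
rewrite limn_einf_lim; apply: lime_le; first exact: is_cvg_einfs.
apply: nearW => k; apply: le_trans (moment k).
by apply: ereal_inf_lbound; exists k => //=.
Unshelve. all: by end_near. Qed.

Lemma integrable_trpinv_sqr : P.-integrable setT (EFin \o (fun w => \tr (W w) ^+ 2)).
Proof.
apply/integrableP; split.
  by apply/measurable_EFinP; apply: measurable_funX; exact: measurable_trpinv.
under eq_integral do rewrite /= ger0_norm ?sqr_ge0 //.
exact: le_lt_trans second_moment_trpinv (ltry _).
Qed.

Local Notation tau w := (\tr (V (obs X w))).
Let k : R := \tr K.
Let k_ge0 : 0 <= k. Proof. exact/psdmx_trace_ge0/psdmx_pinv. Qed.
Let r_ge1 : 1 <= r. Proof. by rewrite ler1n. Qed.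
Let nr_ge0 : 0 <= n%:R - 2 - r.
Proof. by have := a_gt0; rewrite /a trPi; lra. Qed.

Lemma measurable_trscat : measurable_fun setT (fun w => tau w).
Proof.
have mring := @fun_subring_data_measurable R n p.
have h := entries_trace mring (entries_scat Sigma mring (@entries_data_measurable R n p)).
exact: (measurableT_comp h (measurable_joint X)).
Qed.

(** Since [tau * tr W >= r^2 >= 1], the variable [tr W] also dominates the reciprocal traces, and
    its second moment controls every integrand below. *)
Lemma invtr_le w e : 0 < e -> range_proj (V (obs X w)) = Pi ->
  [/\ 0 < tau w, (tau w)^-1 <= \tr (W w) & u e (obs X w) <= (tau w)^-1].
Proof.
move=> e0 good; have r0 : 0 < \tr Pi by rewrite trPi (lt_le_trans ltr01).
have t0 := scat_trace_gt0 good r0.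
split=> //.
  have := trace_proj_sqr_le good r0; rewrite trPi => h.
  rewrite -[leLHS]mul1r ler_pdivrMr // mulrC; apply: le_trans h.
  by rewrite expr2 -[leLHS]mulr1 ler_pM.
by rewrite /invtr lef_pV2 ?posrE ?etr_gt0 // lerDr ltW.
Qed.

Lemma integrable_invtr_sqr : P.-integrable setT (EFin \o (fun w => (tau w)^-1 ^+ 2)).
Proof.
have mi : measurable_fun setT (fun w => (tau w)^-1).
  exact/measurable_funV/measurable_trscat.
apply/integrableP; split; first by apply/measurable_EFinP; exact: measurable_funX.
apply: le_lt_trans (integrable_lty measurableT integrable_trpinv_sqr).
apply: ae_ge0_le_integral => //.
- by apply: measurableT_comp => //; apply/measurable_EFinP; exact: measurable_funX.
- by move=> w _; rewrite lee_fin sqr_ge0.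
- by apply/measurable_EFinP; apply: measurable_funX; exact: measurable_trpinv.
apply: filterS ae_full_rank => w good _ /=.
have [t0 h _] := invtr_le ltr01 good.
by rewrite lee_fin ger0_norm ?sqr_ge0 // ler_pXn2r // nnegrE ?invr_ge0 ?ltW // (lt_le_trans _ h) // invr_gt0.
Qed.

(** Right side minus left side of [stein_invtr], hence of integral 0 for each [e > 0]; [D0] is its
    almost sure limit. *)
Let D (e : R) (w : T) : R :=
  u e (obs X w) * ((n%:R - 1) * t e (obs X w)
      - (t e (obs X w) - e * \tr (Pi *m Rs e (obs X w) *m Rs e (obs X w)))
      - (\tr Pi - e * t e (obs X w)) * t e (obs X w))
    - 2 * u e (obs X w) ^+ 2 * (\tr Pi - e * t e (obs X w))
  - u e (obs X w) * (\tr K - e * \tr (K *m Rs e (obs X w))).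

Let D0 (w : T) : R :=
  (n%:R - 2 - r) * (\tr (W w) * (tau w)^-1) - 2 * r * (tau w)^-1 ^+ 2 - k * (tau w)^-1.

Let integrable_D e : 0 < e ->
  P.-integrable setT (EFin \o D e) /\ (\int[P]_w (D e w)%:E = 0)%E.
Proof.
move=> e0; have [il ir eq] := stein_invtr n_gt0 psdS HX e0.
have h := integralB measurableT ir il.
split; first exact: (integrableB measurableT ir il).
apply: (eq_trans _ (eq_trans h _)); first by apply: eq_integral.
have := integrable_fin_num measurableT il; move: eq => /= -> fin.
exact: subee.
Qed.

(** Dominating function for the limit. The constants are not sharp: what matters is that they do not
    depend on [k']. The summand 1 absorbs the term [u * tr K], which is only linear in [tr W]. *)
Let D_bound w k' : range_proj (V (obs X w)) = Pi ->
  `|D (e_ k') w| <= (n%:R + 5 * r + p%:R ^+ 2 * k + k) * (1 + \tr (W w) ^+ 2).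
Proof.
move=> good; have e0 := e_gt0 k'; set e := e_ k' in e0 *.
have e1 : e <= 1 by rewrite invf_le1 // ler1n.
have [tau0 h1 h2] := invtr_le e0 good.
have x0 : 0 <= t e (obs X w) by exact: trsv_ge0.
have xw : t e (obs X w) <= \tr (W w) by exact: trsv_le.
have u0 : 0 <= u e (obs X w) by apply/ltW/invtr_gt0.
have uw : u e (obs X w) <= \tr (W w) by exact: le_trans h2 h1.
(* [tr (R V) = r - e t] is nonnegative. This bounds the terms in [e * t] and [e * tr (Pi R R)]
   uniformly in [e]. *)
have exr : e * t e (obs X w) <= r.
  rewrite -trPi -subr_ge0 -tr_rsv_scat // mxtrace_mulC.
  exact: tr_psd_rsv_ge0 (psdmx_scat _ _).
have t20 : 0 <= \tr (Pi *m Rs e (obs X w) *m Rs e (obs X w)) by exact: tr_rsv2_ge0.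
have t2x : \tr (Pi *m Rs e (obs X w) *m Rs e (obs X w)) <= t e (obs X w) ^+ 2.
  exact: tr_rsv2_le.
have s0 : 0 <= \tr (K *m Rs e (obs X w)).
  exact: tr_psd_rsv_ge0 (psdmx_pinv sS psdS).
have sx : \tr (K *m Rs e (obs X w)) <= p%:R ^+ 2 * (k * t e (obs X w)).
  have -> : K *m Rs e (obs X w) = K *m (Pi *m Rs e (obs X w)).
    by rewrite mulmxA pinv_range_proj.
  apply: tr_mul_psdmx_le; first exact: psdmx_pinv.
  exact: psdmx_proj_rsv.
rewrite /D trPi -/k.
move: (t e _) (u e _) (\tr (W w)) (\tr (Pi *m _ *m _)) (\tr (K *m _)) x0 xw u0 uw exr t20 t2x s0 sx.
move=> x v w' t2 s x0 xw v0 vw exr t20 t2x s0 sx.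
have w0 : 0 <= w' by exact: le_trans xw.
have vx0 : 0 <= v * x by exact: mulr_ge0.
have vxw : v * x <= w' ^+ 2 by rewrite expr2 ler_pM.
have vvw : v ^+ 2 <= w' ^+ 2 by rewrite ler_pXn2r.
have et2 : e * t2 <= r * x.
  apply: (@le_trans _ _ (e * x ^+ 2)); first by rewrite ler_wpM2l // ltW.
  by rewrite expr2 mulrA ler_wpM2r.
have B0 : 0 <= v * (e * t2) by rewrite !mulr_ge0 // ltW.
have B1 : v * (e * t2) <= r * w' ^+ 2.
  apply: (@le_trans _ _ (r * (v * x))); last by rewrite ler_wpM2l // ler0n.
  by rewrite [leRHS]mulrCA ler_wpM2l.
have C0 : 0 <= v * (e * x * x) by rewrite !mulr_ge0 // ltW.
have C1 : v * (e * x * x) <= r * w' ^+ 2.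
  apply: (@le_trans _ _ (r * (v * x))); last by rewrite ler_wpM2l // ler0n.
  by rewrite [leRHS]mulrCA ler_wpM2l // ler_wpM2r.
have E0 : 0 <= v ^+ 2 * (e * x) by rewrite !mulr_ge0 // ltW.
have E1 : v ^+ 2 * (e * x) <= r * w' ^+ 2.
  by rewrite mulrC ler_pM // ?mulr_ge0 ?sqr_ge0 // ltW.
have r0 : 0 <= r by rewrite ler0n.
have G0 : 0 <= r * v ^+ 2 by rewrite mulr_ge0 ?sqr_ge0.
have G1 : r * v ^+ 2 <= r * w' ^+ 2 by rewrite ler_wpM2l.
have F0 : 0 <= v * (e * s) by rewrite !mulr_ge0 // ltW.
have q0 : 0 <= p%:R ^+ 2 * k by rewrite mulr_ge0 // sqr_ge0.
have F1 : v * (e * s) <= p%:R ^+ 2 * k * w' ^+ 2.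
  apply: (@le_trans _ _ (p%:R ^+ 2 * k * (v * x))); last by rewrite ler_wpM2l.
  rewrite [leRHS]mulrCA ler_wpM2l // -mulrA; apply: le_trans sx.
  by rewrite -[leRHS]mul1r ler_wpM2r.
have w'1 : v <= 1 + w' ^+ 2 by nra.
have K0 : 0 <= v * k by exact: mulr_ge0.
have K1 : v * k <= k * (1 + w' ^+ 2) by rewrite mulrC ler_wpM2l.
have N0 : 0 <= (n%:R - 2 - r) * (v * x) by rewrite mulr_ge0.
have N1 : (n%:R - 2 - r) * (v * x) <= n%:R * w' ^+ 2.
  apply: ler_pM => //; lra.
have z0 : 0 <= w' ^+ 2 by exact: sqr_ge0.
have rz0 : 0 <= r * w' ^+ 2 by exact: mulr_ge0.
have nz0 : 0 <= n%:R * w' ^+ 2 by rewrite mulr_ge0.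
have qz0 : 0 <= p%:R ^+ 2 * k * w' ^+ 2 by rewrite mulr_ge0.
have kz0 : 0 <= k * w' ^+ 2 by rewrite mulr_ge0.
have n0 : 0 <= n%:R :> R by [].
rewrite (_ : v * _ - _ - _ = (n%:R - 2 - r) * (v * x) + v * (e * t2) + v * (e * x * x)
  - 2 * (r * v ^+ 2) + 2 * (v ^+ 2 * (e * x)) - v * k + v * (e * s)); last by ring.
rewrite [leRHS](_ : _ = n%:R * w' ^+ 2 + 5 * (r * w' ^+ 2) + p%:R ^+ 2 * k * w' ^+ 2
  + k * (1 + w' ^+ 2) + (n%:R + 5 * r + p%:R ^+ 2 * k)); last by ring.
by rewrite ler_norml; apply/andP; split; lra.
Qed.

(** An identity of Stein-Haff type. On the full rank event [t], [tr (Pi R R)] and [tr (K R)] stay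
    bounded as [e] tends to 0, so every term of [D] with a factor [e] vanishes in the limit;
    dominated convergence does the rest. *)
Lemma stein_haff :
  P.-integrable setT (EFin \o D0) /\ (\int[P]_w (D0 w)%:E = 0)%E.
Proof.
pose C : R := n%:R + 5 * r + p%:R ^+ 2 * k + k.
have mW := measurable_trpinv.
have mi : measurable_fun setT (fun w => (tau w)^-1).
  exact/measurable_funV/measurable_trscat.
have mD0 : measurable_fun setT D0.
  apply: measurable_funB; last exact: measurable_funM.
  apply: measurable_funB; last by apply: measurable_funM => //; exact: measurable_funX.
  by apply: measurable_funM => //; exact: measurable_funM.
have ig : P.-integrable setT (fun w => C%:E * ((1 : R)%:E + (\tr (W w) ^+ 2)%:E))%E.
  apply: (integrableZl measurableT); apply: integrableD => //.
    exact: finite_measure_integrable_cst.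
  exact: integrable_trpinv_sqr.
have [] := @dominated_convergence _ _ _ P setT measurableT
   (fun m w => (D (e_ m) w)%:E) (EFin \o D0) _ _ _ _ ig _.
- by move=> m; exact: (measurable_int P (integrable_D (e_gt0 m)).1).
- exact/measurable_EFinP.
- apply: filterS ae_full_rank => w good _.
  have W0 : 0 <= \tr (W w) by exact/psdmx_trace_ge0/psdmx_pinv_scat.
  have t0 m : 0 <= t (e_ m) (obs X w) by exact: trsv_ge0.
  have tW m : t (e_ m) (obs X w) <= \tr (W w) by exact: trsv_le.
  have small (f : nat -> R) M : (forall m, 0 <= f m <= M) -> e_ m * f m @[m --> \oo] --> (0 : R).
    move=> fM; apply: (@cvg_add_harmonic _ _ f) => [|m]; last by rewrite add0r.
    by exists M => m; have /andP[f0 f1] := fM m; rewrite ger0_norm.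
  have cx := cvg_trsv good.
  have cex : e_ m * t (e_ m) (obs X w) @[m --> \oo] --> (0 : R).
    by apply: (small _ (\tr (W w))) => m; rewrite t0 tW.
  have cet2 : e_ m * \tr (Pi *m Rs (e_ m) (obs X w) *m Rs (e_ m) (obs X w)) @[m --> \oo] --> (0 : R).
    apply: (small _ (\tr (W w) ^+ 2)) => m; rewrite tr_rsv2_ge0 //=.
    apply: le_trans (tr_rsv2_le _ (e_gt0 m) _) _.
    by rewrite ler_pXn2r ?nnegrE.
  have ces : e_ m * \tr (K *m Rs (e_ m) (obs X w)) @[m --> \oo] --> (0 : R).
    apply: (small _ (p%:R ^+ 2 * (k * \tr (W w)))) => m.
    rewrite (tr_psd_rsv_ge0 _ _ _ (psdmx_pinv sS psdS)) //=.
    rewrite -[K](pinv_range_proj Sigma) -mulmxA.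
    apply: le_trans (tr_mul_psdmx_le (psdmx_pinv sS psdS) (psdmx_proj_rsv _ (e_gt0 m) _)) _.
    by rewrite !ler_wpM2l ?sqr_ge0 //; exact: tW.
  have [tau0 _ _] := invtr_le ltr01 good.
  have cu : u (e_ m) (obs X w) @[m --> \oo] --> (tau w)^-1.
    apply: cvgV; first by rewrite gt_eqF.
    rewrite -[X in _ --> X]add0r; apply: cvgD; first exact: cvg_harmonic.
    exact: cvg_cst.
  apply: cvg_EFin; first by apply: nearW.
  have -> : D0 w = (tau w)^-1 * ((n%:R - 1) * \tr (W w) - (\tr (W w) - 0) - (\tr Pi - 0) * \tr (W w))
     - 2 * ((tau w)^-1 * (tau w)^-1) * (\tr Pi - 0) - (tau w)^-1 * (k - 0).
    by rewrite /D0 trPi; ring.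
  rewrite /comp /= /D; under eq_fun do rewrite expr2.
  apply: cvgB; last by apply: cvgM => //; apply: cvgB => //; exact: cvg_cst.
  apply: cvgB.
    apply: cvgM => //; apply: cvgB.
      by apply: cvgB; [apply: cvgM => //; exact: cvg_cst|exact: cvgB].
    by apply: cvgM => //; apply: cvgB => //; exact: cvg_cst.
  apply: cvgM; last by apply: cvgB => //; exact: cvg_cst.
  by apply: cvgM; [exact: cvg_cst|exact: cvgM].
- apply: filterS ae_full_rank => w good m _.
  by rewrite /= -EFinD -EFinM lee_fin; exact: D_bound.
move=> iD0 _ c; split=> //; move: c.
rewrite (_ : [sequence _]_n = cst 0%E); last first.
  by apply/funext => m /=; exact: (integrable_D (e_gt0 m)).2.
by move=> c; apply/esym; exact: (cvg_unique _ (cvg_cst _) c).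
Qed.

End pinv_moments.

(** * Losses and risks *)

Section sample_facts.
Context {R : realType}.

Lemma pinvZ m n (c : R) (A : 'M[R]_(m, n)) : c != 0 -> pinv (c *: A) = c^-1 *: pinv A.
Proof.
move=> c0; apply: pinv_unique; have [h1 h2 h3 h4] := penrose_pinv A.
have e1 : c *: A *m (c^-1 *: pinv A) = A *m pinv A.
  by rewrite -scalemxAl -scalemxAr scalerA mulfV // scale1r.
have e2 : c^-1 *: pinv A *m (c *: A) = pinv A *m A.
  by rewrite -scalemxAl -scalemxAr scalerA mulVf // scale1r.
by split; rewrite ?e1 ?e2 // -scalemxAr ?h1 ?h2.
Qed.

Lemma range_proj1 p : range_proj (1%:M : 'M[R]_p) = 1%:M.
Proof. by have := range_proj_mul (1%:M : 'M[R]_p); rewrite mulmx1. Qed.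

(** [A] and [A A^T] have the same range, so [mu + A z] never leaves the translate by [mu] of the
    range of [Sigma]. *)
Lemma range_proj_factor p k (A : 'M[R]_(p, k)) : range_proj (A *m A^T) *m A = A.
Proof.
set Pi := range_proj _; apply/eqP; rewrite -subr_eq0; apply/eqP/mulmx_trmx_eq0.
have h : Pi *m A *m A^T = A *m A^T by rewrite -mulmxA range_proj_mul.
rewrite linearB /= trmx_mul mulmxBr mulmxA.
have -> : (Pi *m A - A) *m A^T = 0 by rewrite mulmxBl h subrr.
by rewrite mul0mx subrr.
Qed.

(** With [1%:M] in place of [Sigma] the projection is trivial, so [scat 1%:M] is the scatter
    computed from the data alone. *)
Lemma sample_cov_scat d (T : measurableType d) (n p : nat)
    (X : 'I_n -> {mfun T >-> p.-tuple R}) w :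
  sample_cov (sample X w) = n%:R^-1 *: scat 1%:M (obs X w).
Proof.
rewrite /sample_cov; congr (_ *: _); rewrite scatE cdatE range_proj1 mul1mx.
have E i : sample X w i - sample_mean (sample X w) = col i (obs X w *m centering n).
  apply/matrixP => j k; rewrite (ord1 k) centeringE mulmxBr mulmx1 -scalemxAr !mxE.
  rewrite tnth_mktuple /sample_mean summxE; congr (_ - _ * _).
  by apply: eq_bigr => l _; rewrite !mxE tnth_mktuple mulr1.
under eq_bigr do rewrite E.
apply/matrixP => j k; rewrite summxE mxE; apply: eq_bigr => i _.
by rewrite mxE big_ord1 ![_^T _ _]mxE ![col _ _ _ _]mxE.
Qed.

Lemma frob_norm_sqr m n (A : 'M[R]_(m, n)) : frob_norm A ^+ 2 = \tr (A *m A^T).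
Proof.
rewrite /frob_norm sqr_sqrtr; last by do 2 (apply: sumr_ge0 => ? _); rewrite sqr_ge0.
apply: eq_bigr => i _; rewrite mxE; apply: eq_bigr => j _.
by rewrite mxE expr2.
Qed.

End sample_facts.

Section sample_scatter.
Context {R : realType} (n p : nat) (Sigma : 'M[R]_p).
Hypotheses (psdS : psdmx Sigma) (rank_gt0 : (0 < \rank Sigma)%N)
  (rank_le : (\rank Sigma + 5 <= n)%N).
Context d (T : measurableType d) (P : probability T R)
  (X : 'I_n -> {mfun T >-> p.-tuple R}) (mu : 'cV[R]_p).
Hypothesis HX : iid_normal P X mu Sigma.
Local Notation K := (pinv Sigma).
Local Notation Pi := (range_proj Sigma).
Local Notation V := (@scat R n p Sigma).

Let sS : Sigma^T = Sigma. Proof. by case: psdS. Qed.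
Let n_gt0 : (0 < n)%N. Proof. by apply: leq_trans rank_le; rewrite addnS. Qed.

(** The condition is the zero set of a squared norm, a measurable set of observations, so its
    probability can be read off from the representation [mu + A Z]. *)
Lemma ae_range (i : 'I_n) : \forall w \ae P,
  Pi *m (vec (X i w) - mu) = vec (X i w) - mu.
Proof.
pose N (y : p.-tuple R) : 'cV[R]_p := Pi *m (vec y - mu) - (vec y - mu).
pose f y := \tr (N y *m (N y)^T).
have fP y : f y = 0 <-> Pi *m (vec y - mu) = vec y - mu.
  split=> [f0|h]; last by rewrite /f /N h subrr mul0mx linear0.
  by apply/eqP; rewrite -subr_eq0; apply/eqP/mxtrace_gram_eq0; rewrite -/(f y) f0.
have mring := @fun_subring_measurable R _ (p.-tuple R).
have mvec : entries (fun f => measurable_fun setT f) (fun y : p.-tuple R => vec y - mu).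
  apply: (entries_add mring); last exact: (entries_cst mring).
  by move=> j k; rewrite (ord1 k); exact: measurable_vec.
have mN : entries (fun f => measurable_fun setT f) N.
  apply: (entries_add mring); last exact: (entries_opp mring).
  by apply: (entries_mul mring) => //; exact: (entries_cst mring).
have mf : measurable_fun setT f.
  by apply: (entries_trace mring); apply: (entries_mul mring) => //; exact: entries_tr.
pose B : set (p.-tuple R) := f @^-1` [set 0].
have mB : measurable B by rewrite -[B]setTI; apply: mf => //; exact: measurable_set1.
have PB : P (X i @^-1` B) = 1%E.
  have [k [A [d' [T' [Q [Z [AA snZ lawX]]]]]]] := HX.2 i.
  rewrite -[LHS]/(distribution P (X i) B) lawX //.
  rewrite (_ : [set w | _] = setT) ?probability_setT //.
  apply/seteqP; split=> // w _ /=; apply/fP.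
  set y := [tuple _ | _ < _]; have -> : vec y = mu + A *m \col_j Z j w.
    by apply/matrixP => j l; rewrite mxE tnth_mktuple (ord1 l).
  by rewrite addrAC subrr add0r mulmxA -AA range_proj_factor.
exists (~` (X i @^-1` B)); split.
- by apply: measurableC; rewrite -[X in measurable X]setTI; exact: measurable_funPT.
- rewrite probability_setC ?PB ?subee //.
  by rewrite -[X in measurable X]setTI; exact: measurable_funPT.
- by move=> w /= h /fP; exact: h.
Qed.

(** Centring allows [mu] to be subtracted, and the differences lie in the range of [Sigma], where
    [Pi] acts as the identity. *)
Lemma ae_scat1 : \forall w \ae P, scat 1%:M (obs X w) = V (obs X w).
Proof.
have all_range : \forall w \ae P, forall i, Pi *m (vec (X i w) - mu) = vec (X i w) - mu.
  by apply: filter_forall => i; exact: ae_range.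
apply: filterS all_range => w h.
rewrite !scatE; suff -> : cdat 1%:M (obs X w) = cdat Sigma (obs X w) by [].
rewrite !cdatE range_proj1 mul1mx.
pose M : 'M[R]_(p, n) := obs X w - mu *m const_mx 1.
have MH : M *m centering n = obs X w *m centering n.
  by rewrite mulmxBl -(mulmxA mu) const_centering // mulmx0 subr0.
rewrite -mulmxA -MH mulmxA; congr (_ *m _).
apply/matrixP => j i.
have colM : col i M = vec (X i w) - mu.
  by apply/matrixP => l k; rewrite (ord1 k) !mxE big_ord1 mxE mulr1 tnth_mktuple.
have := congr1 (fun v : 'cV[R]_p => v j 0) (h i).
have ce (A : 'M[R]_(p, n)) : col i A j 0 = A j i by rewrite mxE.
by rewrite -colM [X in Pi *m X]colE mulmxA -colE !ce.
Qed.

(** [S S^+] is almost surely the deterministic projection [Pi], so [EMt] perturbs [EM1] by a random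
    multiple of a fixed matrix. *)
Lemma ae_sample_cov : \forall w \ae P,
  [/\ range_proj (V (obs X w)) = Pi,
      pinv (sample_cov (sample X w)) = n%:R *: pinv (V (obs X w)),
      sample_cov (sample X w) *m pinv (sample_cov (sample X w)) = Pi &
      \tr (sample_cov (sample X w)) = n%:R^-1 * \tr (V (obs X w))].
Proof.
have full := ae_full_rank psdS rank_le HX.
apply: filterS2 full ae_scat1 => w good E.
have n0 : n%:R != 0 :> R by rewrite pnatr_eq0 -lt0n.
have Ep : pinv (sample_cov (sample X w)) = n%:R *: pinv (V (obs X w)).
  by rewrite sample_cov_scat E pinvZ ?invr_eq0 // invrK.
split=> //.
- rewrite Ep sample_cov_scat E -scalemxAl -scalemxAr scalerA mulVf // scale1r.
  by rewrite -range_projE.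
- by rewrite sample_cov_scat E linearZ.
Qed.

End sample_scatter.

(** * Integrability and pointwise comparison of the losses *)

Section losses.
Context {R : realType} (n p : nat) (Sigma : 'M[R]_p).
Hypotheses (psdS : psdmx Sigma) (rank_gt0 : (0 < \rank Sigma)%N)
  (rank_le : (\rank Sigma + 5 <= n)%N).
Context d (T : measurableType d) (P : probability T R)
  (X : 'I_n -> {mfun T >-> p.-tuple R}) (mu : 'cV[R]_p).
Hypothesis HX : iid_normal P X mu Sigma.
Local Notation K := (pinv Sigma).
Local Notation Pi := (range_proj Sigma).
Local Notation V := (@scat R n p Sigma).
Local Notation W w := (pinv (V (obs X w))).
Local Notation tau w := (\tr (V (obs X w))).
Local Notation S w := (sample_cov (sample X w)).
Local Notation r := (\rank Sigma).

Let sS : Sigma^T = Sigma. Proof. by case: psdS. Qed.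
Let n_gt0 : (0 < n)%N. Proof. by apply: leq_trans rank_le; rewrite addnS. Qed.
Let n0 : n%:R != 0 :> R. Proof. by rewrite pnatr_eq0 -lt0n. Qed.
Let trPi : \tr Pi = r%:R. Proof. exact: range_proj_trace. Qed.
Let a : R := n%:R - r%:R - 4.
Let a_gt0 : 0 < a.
Proof. by rewrite /a -addrA -opprD subr_gt0 -natrD ltr_nat -addnS. Qed.
Let k : R := \tr K.
Let k_ge0 : 0 <= k. Proof. exact/psdmx_trace_ge0/psdmx_pinv. Qed.

Definition loss (delta : estimator R n p) (w : T) : R :=
  frob_norm (delta (sample X w) - K) ^+ 2.

Definition inv_trace_sqr (w : T) : R := (\tr (S w) ^+ 2)^-1.

Definition bound_coef (t : R) : R :=
  (n%:R - r%:R - 4) * r%:R / n%:R ^+ 2 * ((n%:R - r%:R - 4) * t ^+ 2 - 4 * (r%:R - 1) * t).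

Let mring := @fun_subring_measurable R _ T.

Lemma measurable_sample_cov : entries (fun f => measurable_fun setT f) (fun w => S w).
Proof.
apply: (entries_ext (A := fun w => n%:R^-1 *: scat 1%:M (obs X w))).
  by move=> w; rewrite sample_cov_scat.
apply: (entries_scale mring) => //.
have mdring := @fun_subring_data_measurable R n p.
have h := entries_scat 1%:M mdring (@entries_data_measurable R n p).
by move=> i j; exact: (measurableT_comp (h i j) (measurable_joint X)).
Qed.

Lemma measurable_pinv_sample_cov :
  entries (fun f => measurable_fun setT f) (fun w => pinv (S w)).
Proof.
apply: (entries_ext (A := fun w => n%:R *: pinv (scat 1%:M (obs X w)))).
  by move=> w; rewrite sample_cov_scat pinvZ ?invr_eq0 // invrK.
by apply: (entries_scale mring) => //; apply: measurable_pinv_scat_obs; exact: trmx1.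
Qed.

Lemma measurable_loss delta :
  entries (fun f => measurable_fun setT f) (fun w => delta (sample X w)) ->
  measurable_fun setT (loss delta).
Proof.
move=> md; have mD : entries (fun f => measurable_fun setT f) (fun w => delta (sample X w) - K).
  by apply: (entries_add mring) => //; exact: (entries_cst mring).
rewrite (_ : loss delta = (fun w => \tr ((delta (sample X w) - K) *m (delta (sample X w) - K)^T))).
  by apply: (entries_trace mring); apply: (entries_mul mring) => //; exact: entries_tr.
by apply/funext => w; rewrite /loss frob_norm_sqr.
Qed.

Lemma measurable_loss_EM1 : measurable_fun setT (loss (EM1 r)).
Proof.
apply: measurable_loss; apply: (entries_scale mring) => //.
exact: measurable_pinv_sample_cov.
Qed.

Lemma measurable_loss_EMt t : measurable_fun setT (loss (EMt r t)).
Proof.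
apply: measurable_loss; apply: (entries_scale mring) => //.
apply: (entries_add mring); first exact: measurable_pinv_sample_cov.
apply: (entries_scale mring).
  apply: measurable_funM => //; apply: measurable_funV.
  by apply: (entries_trace mring); exact: measurable_sample_cov.
by apply: (entries_mul mring); [exact: measurable_sample_cov|exact: measurable_pinv_sample_cov].
Qed.

Lemma measurable_inv_trace_sqr : measurable_fun setT inv_trace_sqr.
Proof.
apply: measurable_funV; apply: measurable_funX.
by apply: (entries_trace mring); exact: measurable_sample_cov.
Qed.

Lemma integrable_loss_EM1 : P.-integrable setT (EFin \o loss (EM1 r)).
Proof.
(* There are [p^2] entries, each with square at most [(a tr W + k)^2 <= 2 (k^2 + a^2 (tr W)^2)]. *)
pose C : R := p%:R ^+ 2 * 2.
pose g w := C * (k ^+ 2 + a ^+ 2 * \tr (W w) ^+ 2).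
have ib0 : P.-integrable setT (fun w => C%:E * ((k ^+ 2)%:E + (a ^+ 2)%:E * (\tr (W w) ^+ 2)%:E))%E.
  apply: (integrableZl measurableT); apply: integrableD => //.
    exact: finite_measure_integrable_cst.
  exact: (integrableZl measurableT (a ^+ 2) (integrable_trpinv_sqr psdS rank_le HX)).
have ib : P.-integrable setT (EFin \o g) by exact: ib0.
apply/integrableP; split; first exact/measurable_EFinP/measurable_loss_EM1.
apply: le_lt_trans (integrable_lty measurableT ib).
apply: ae_ge0_le_integral => //.
- by apply: measurableT_comp => //; exact/measurable_EFinP/measurable_loss_EM1.
- move=> w _; rewrite lee_fin; apply: mulr_ge0; first by rewrite mulr_ge0 ?sqr_ge0.
  by apply: addr_ge0; [exact: sqr_ge0|apply: mulr_ge0; exact: sqr_ge0].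
- exact: (measurable_int P ib).
apply: filterS (ae_sample_cov psdS rank_le HX) => w [good EW _ _] _ /=.
rewrite ger0_norm ?sqr_ge0 // lee_fin /g /loss frob_norm_sqr /EM1 EW.
rewrite scalerA -/a mulfVK //.
have pW : psdmx (W w) by exact: psdmx_pinv_scat.
have w0 : 0 <= \tr (W w) by exact: psdmx_trace_ge0.
have ent i j : (a *: W w - K) i j ^+ 2 <= 2 * (k ^+ 2 + a ^+ 2 * \tr (W w) ^+ 2).
  have h1 := psdmx_entry_le_trace i j pW.
  have h2 := psdmx_entry_le_trace i j (psdmx_pinv sS psdS).
  rewrite -[leLHS]real_normK ?num_real //.
  have h : `|(a *: W w - K) i j| <= a * \tr (W w) + k.
    rewrite mxE [X in X + _]mxE [X in _ + X]mxE; apply: le_trans (ler_normB _ _) _.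
    by apply: lerD => //; rewrite normrM (gtr0_norm a_gt0) ler_wpM2l // ltW.
  have h3 : 0 <= a * \tr (W w) + k by rewrite addr_ge0 // mulr_ge0 // ltW.
  apply: (@le_trans _ _ ((a * \tr (W w) + k) ^+ 2)); first by rewrite ler_pXn2r ?nnegrE.
  by have := sqr_ge0 (a * \tr (W w) - k); nra.
apply: (@le_trans _ _ (\sum_(i < p) \sum_(j < p) 2 * (k ^+ 2 + a ^+ 2 * \tr (W w) ^+ 2))).
  apply: ler_sum => i _; rewrite mxE; apply: ler_sum => j _.
  by rewrite [X in _ * X]mxE -expr2.
by rewrite !sumr_const !card_ord -mulrnA -[leLHS]mulr_natl natrM /C expr2 !mulrA.
Qed.

Lemma ae_inv_trace_sqr : \forall w \ae P,
  0 < inv_trace_sqr w /\ inv_trace_sqr w = n%:R ^+ 2 * (tau w)^-1 ^+ 2.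
Proof.
apply: filterS (ae_sample_cov psdS rank_le HX) => w [good _ _ ES].
have [t0 _ _] := invtr_le rank_gt0 ltr01 good.
have E : inv_trace_sqr w = n%:R ^+ 2 * (tau w)^-1 ^+ 2.
  by rewrite /inv_trace_sqr ES; field; rewrite n0 gt_eqF.
by split=> //; rewrite E mulr_gt0 // exprn_gt0 ?invr_gt0 // ltr0n.
Qed.

Lemma integrable_inv_trace_sqr : P.-integrable setT (EFin \o inv_trace_sqr).
Proof.
have ib := integrableZl measurableT (n%:R ^+ 2) (integrable_invtr_sqr psdS rank_gt0 rank_le HX).
apply/integrableP; split; first exact/measurable_EFinP/measurable_inv_trace_sqr.
apply: le_lt_trans (integrable_lty measurableT ib).
apply: ae_ge0_le_integral => //.
- by apply: measurableT_comp => //; exact/measurable_EFinP/measurable_inv_trace_sqr.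
- by move=> w _; rewrite -EFinM lee_fin mulr_ge0 ?sqr_ge0.
- exact: (measurable_int P ib).
apply: filterS ae_inv_trace_sqr => w [h E] _ /=.
by rewrite (gtr0_norm h) E EFinM.
Qed.

(** Strict positivity turns strict comparison of the coefficients into strict comparison of the
    bounds. *)
Lemma inv_trace_sqr_mean_gt0 : (0 < \int[P]_w (inv_trace_sqr w)%:E)%E.
Proof.
have ge w : 0 <= inv_trace_sqr w by rewrite invr_ge0 sqr_ge0.
rewrite lt_neqAle integral_ge0 ?andbT; last by move=> w _; rewrite lee_fin.
apply/eqP => /esym I0.
have : ae_eq P setT (EFin \o inv_trace_sqr) (cst 0%E).
  apply/ae_eq_integral_abs => //; first exact/measurable_EFinP/measurable_inv_trace_sqr.
  by rewrite -[RHS]I0; apply: eq_integral => w _; rewrite /= ger0_norm.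
move=> F; have : \forall w \ae P, False.
  by apply: filterS2 ae_inv_trace_sqr F => w [h _] /(_ I) /= [E]; rewrite E ltxx in h.
case=> N [mN N0 sub]; have NT : N = setT by apply/seteqP; split=> // w _; apply: sub.
by move: N0; rewrite NT probability_setT => /eqP; rewrite onee_eq0.
Qed.

(** The term with factor [2 a t] has mean 0 by [stein_haff]; it is added to trade the unknown
    [tr K / tau] of the cross term for observable traces. The right side then exceeds the left by
    exactly [4 a t (tau * tr W - r^2) / tau^2]. *)
Lemma ae_loss_EMt_le (t : R) : 0 <= t \/ r = 1%N -> \forall w \ae P,
  loss (EMt r t) w <= loss (EM1 r) w
    + 2 * a * t * ((n%:R - 2 - r%:R) * (\tr (W w) * (tau w)^-1)
        - 2 * r%:R * (tau w)^-1 ^+ 2 - k * (tau w)^-1)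
    + bound_coef t * inv_trace_sqr w.
Proof.
move=> ht; apply: filterS2 ae_inv_trace_sqr (ae_sample_cov psdS rank_le HX) => w.
move=> [_ EU] [good EW EP ES].
have [t0 _ _] := invtr_le rank_gt0 ltr01 good.
have r0 : 0 < \tr Pi by rewrite trPi ltr0n.
have tw := trace_proj_sqr_le good r0.
rewrite /loss !frob_norm_sqr /EMt /EM1 EP EW ES EU -/a.
have -> : a / n%:R *: (n%:R *: W w) = a *: W w by rewrite scalerA mulfVK.
have -> : a / n%:R *: (n%:R *: W w + t / (n%:R^-1 * tau w) *: Pi) - K =
    (a *: W w - K) + (a * t / tau w) *: Pi.
  rewrite scalerDr !scalerA mulfVK // addrAC; congr (_ + _ *: _).
  by field; rewrite n0 gt_eqF.
set N := a *: W w - K; set b := a * t / tau w.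
have sN : N^T = N by rewrite /N linearB linearZ /= !pinv_sym // scat_sym.
have NPi : \tr (N *m Pi) = a * \tr (W w) - k.
  rewrite /N mulmxBl -scalemxAl pinv_range_proj -{1}good pinv_range_proj.
  by rewrite linearB linearZ.
have -> : \tr ((N + b *: Pi) *m (N + b *: Pi)^T) =
    \tr (N *m N^T) + 2 * b * (a * \tr (W w) - k) + b ^+ 2 * r%:R.
  clearbody N b.
  rewrite linearD linearZ /= range_proj_sym sN mulmxDr !mulmxDl -!scalemxAr -!scalemxAl.
  rewrite range_proj_idem !linearD !linearZ /= [\tr (Pi *m N)]mxtrace_mulC NPi trPi.
  by ring.
have ttw : 0 <= t * (tau w * \tr (W w) - r%:R ^+ 2).
  case: ht => [t_ge0|r1]; first by rewrite mulr_ge0 // subr_ge0 -trPi.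
  (* In rank one both [V] and its pseudoinverse are multiples of [Pi], and [V W = Pi] forces the two
     coefficients to be reciprocal. *)
  have VE : V (obs X w) = tau w *: Pi.
    by rewrite -{1}(scat_proj Sigma) -{1}(proj_scat Sigma) range_proj_rank1 // proj_scat.
  have WE : W w = \tr (W w) *: Pi.
    have WPi : W w *m Pi = W w by rewrite -good pinv_range_proj.
    have PiW : Pi *m W w = W w by rewrite -good range_proj_pinv // scat_sym.
    by rewrite -{1}WPi -{1}PiW range_proj_rank1 // PiW.
  have VW : Pi = (tau w * \tr (W w)) *: Pi.
    have h : (tau w *: Pi) *m (\tr (W w) *: Pi) = (tau w * \tr (W w)) *: Pi.
      by rewrite -scalemxAl -scalemxAr range_proj_idem scalerA.
    by rewrite -h -VE -WE -range_projE good.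
  have tW1 : tau w * \tr (W w) = 1.
    by have := congr1 mxtrace VW; rewrite linearZ /= trPi r1 mulr1 => <-.
  by rewrite tW1 r1 expr1n subrr mulr0.
rewrite -!addrA lerD2l /bound_coef -/a /b -subr_ge0.
move: ttw t0; move: (\tr (W w)) (tau w) => x y ttw y0.
have aE : n%:R = a + r%:R + 4 :> R by rewrite /a; ring.
rewrite [X in 0 <= X](_ : _ = 4 * a * (y^-1) ^+ 2 * (t * (y * x - r%:R ^+ 2))).
  by rewrite mulr_ge0 // mulr_ge0 ?sqr_ge0 // mulr_ge0 // ltW.
have n1 := n0; rewrite aE in n1 *.
by field; rewrite n1 gt_eqF.
Qed.

End losses.

Section risk_bounds.
Context {R : realType} (n p : nat) (Sigma : 'M[R]_p).
Hypotheses (psdS : psdmx Sigma) (rank_gt0 : (0 < \rank Sigma)%N)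
  (rank_le : (\rank Sigma + 5 <= n)%N).
Context d (T : measurableType d) (P : probability T R)
  (X : 'I_n -> {mfun T >-> p.-tuple R}) (mu : 'cV[R]_p).
Hypothesis HX : iid_normal P X mu Sigma.
Local Notation r := (\rank Sigma).
Local Notation lossE delta := (@loss R n p Sigma d T X delta).
Local Notation U := (inv_trace_sqr X).

Lemma integral_loss_EMt_le (t : R) : 0 <= t \/ r = 1%N ->
  (\int[P]_w (lossE (EMt r t) w)%:E <=
   \int[P]_w (lossE (EM1 r) w)%:E + (bound_coef n Sigma t)%:E * \int[P]_w (U w)%:E)%E.
Proof.
move=> ht; have [iD D0] := stein_haff psdS rank_gt0 rank_le HX.
have i1 := integrable_loss_EM1 psdS rank_le HX.
have iU := integrable_inv_trace_sqr psdS rank_gt0 rank_le HX.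
set D := (X in EFin \o X) in iD; rewrite -/D in D0.
set a : R := n%:R - r%:R - 4.
pose G w := lossE (EM1 r) w + 2 * a * t * D w + bound_coef n Sigma t * U w.
have iG1 : P.-integrable setT (EFin \o (fun w => lossE (EM1 r) w + 2 * a * t * D w)).
  exact: (integrableD measurableT i1 (integrableZl measurableT (2 * a * t) iD)).
have iG2 := integrableZl measurableT (bound_coef n Sigma t) iU.
have iG : P.-integrable setT (EFin \o G) by exact: (integrableD measurableT iG1 iG2).
have le_G : \forall w \ae P, lossE (EMt r t) w <= G w.
  exact: (ae_loss_EMt_le psdS rank_gt0 rank_le HX ht).
have <- : (\int[P]_w (G w)%:E =
    \int[P]_w (lossE (EM1 r) w)%:E + (bound_coef n Sigma t)%:E * \int[P]_w (U w)%:E)%E.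
  rewrite -(integralZl measurableT iU).
  rewrite -[X in (X + _)%E]adde0.
  have <- : (\int[P]_w ((2 * a * t)%:E * (D w)%:E) = 0)%E.
    by rewrite (integralZl measurableT iD) D0 mule0.
  rewrite -(integralD measurableT i1 (integrableZl measurableT (2 * a * t) iD)).
  by rewrite -(integralD measurableT iG1 iG2).
have mG := measurable_int P iG.
(* [G] lies almost surely above a loss, hence is almost surely nonnegative; passing to its absolute
   value makes monotonicity for nonnegative integrands applicable. *)
have -> : (\int[P]_w (G w)%:E = \int[P]_w `|(G w)%:E|)%E.
  apply: ae_eq_integral => //; first exact: measurableT_comp.
  apply: filterS le_G => w h _; rewrite gee0_abs // lee_fin.
  by apply: le_trans h; rewrite sqr_ge0.
apply: ae_ge0_le_integral => //.
- by move=> w _; rewrite lee_fin sqr_ge0.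
- by apply/measurable_EFinP; exact: measurable_loss_EMt.
- exact: measurableT_comp.
by apply: filterS le_G => w h _; rewrite lee_fin (le_trans h) // ler_norm.
Qed.

End risk_bounds.

(** Supplies the parameter at which dominance is strict. *)
Lemma parameter_pid_mx (R : realType) p r : (r <= p)%N ->
  parameter r (0 : 'cV[R]_p) (pid_mx r).
Proof.
move=> rp; split; last by rewrite rank_pid_mx.
have -> : pid_mx r = (pid_mx r : 'M[R]_p) *m (pid_mx r : 'M[R]_p)^T.
  by rewrite tr_pid_mx mul_pid_mx minnn (minn_idPr rp).
exact: psdmx_gram.
Qed.

(** * The risk bound, its minimizer and dominance *)

Theorem proposition4 (R : realType) (n p r : nat)
    (r_ge1 : (1 <= r)%N) (r_le : (r + 5 <= n)%N) (r_lt : (r < minn n p)%N)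
    (d : measure_display) (T : measurableType d)
    (P : 'cV[R]_p -> 'M[R]_p -> probability T R)
    (X : 'I_n -> {mfun T >-> p.-tuple R})
    (model : normal_model r P X) :
  [/\ forall t : R, 0 <= t \/ r = 1%N ->
        forall mu Sigma, parameter r mu Sigma ->
          (risk P X (EMt r t) mu Sigma <= risk_bound P X r t mu Sigma)%E,
      forall mu Sigma, parameter r mu Sigma ->
        forall t : R, t != t_opt R n r ->
          (risk_bound P X r (t_opt R n r) mu Sigma
             < risk_bound P X r t mu Sigma)%E,
      forall mu Sigma, parameter r mu Sigma ->
        (risk P X (EM2 r) mu Sigma <= risk P X (EM1 r) mu Sigma)%E
    & (1 < r)%N -> dominates P X r (EM2 r) (EM1 r)].
Proof.
pose a : R := n%:R - r%:R - 4.
have a_gt0 : 0 < a by rewrite /a -addrA -opprD subr_gt0 -natrD ltr_nat -addnS.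
have r1 : 1 <= r%:R :> R by rewrite ler1n.
have n_gt0 : 0 < n%:R :> R by rewrite ltr0n (leq_trans _ r_le) // addnS.
pose coef (t : R) := a * r%:R / n%:R ^+ 2 * (a * t ^+ 2 - 4 * (r%:R - 1) * t).
have coef_pos : 0 < a * r%:R / n%:R ^+ 2.
  by rewrite divr_gt0 ?exprn_gt0 // mulr_gt0 // (lt_le_trans ltr01).
have topt_ge0 : 0 <= t_opt R n r.
  by rewrite /t_opt -/a; apply: mulr_ge0 => //; apply: divr_ge0; [rewrite subr_ge0|exact: ltW].
have atopt : a * t_opt R n r = 2 * (r%:R - 1).
  by rewrite /t_opt -/a; field; rewrite gt_eqF.
(* Completing the square at [t_opt]: the excess is a positive multiple of [(t - t_opt)^2], so the
   minimizer is unique. *)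
have coefB t : coef t - coef (t_opt R n r) =
    a * r%:R / n%:R ^+ 2 * (a * (t - t_opt R n r) ^+ 2).
  rewrite /coef -mulrBr; congr (_ * _).
  have -> : 4 * (r%:R - 1) = 2 * (a * t_opt R n r) by rewrite atopt; ring.
  by ring.
have coef_opt : coef (t_opt R n r) = - (a * r%:R / n%:R ^+ 2 * (2 * (r%:R - 1) * t_opt R n r)).
  rewrite /coef -[RHS]mulrN; congr (_ * _).
  have -> : a * t_opt R n r ^+ 2 = a * t_opt R n r * t_opt R n r by ring.
  by rewrite atopt; ring.
(* Finiteness of the risk of [EM1] is what permits cancelling it in comparisons between extended
   reals. *)
have facts mu Sigma : parameter r mu Sigma ->
    [/\ risk P X (EM1 r) mu Sigma \is a fin_num,
        exists2 u : R, 0 < u & forall t, risk_bound P X r t mu Sigma =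
          (risk P X (EM1 r) mu Sigma + (coef t * u)%:E)%E &
        forall t, 0 <= t \/ r = 1%N ->
          (risk P X (EMt r t) mu Sigma <= risk_bound P X r t mu Sigma)%E].
  move=> par; have HX := model _ _ par; case: par => psdS rk.
  have rank_gt0 : (0 < \rank Sigma)%N by rewrite rk.
  have rank_le : (\rank Sigma + 5 <= n)%N by rewrite rk.
  have i1 := integrable_loss_EM1 psdS rank_le HX.
  have iU := integrable_inv_trace_sqr psdS rank_gt0 rank_le HX.
  have Upos := inv_trace_sqr_mean_gt0 psdS rank_gt0 rank_le HX.
  have le_bound := integral_loss_EMt_le psdS rank_gt0 rank_le HX.
  rewrite rk in i1 le_bound.
  have fU := integrable_fin_num measurableT iU.
  split.
  - by rewrite /risk unlock; exact: (integrable_fin_num measurableT i1).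
  - exists (fine (\int[P mu Sigma]_w (inv_trace_sqr X w)%:E)%E).
      by rewrite fine_gt0 // Upos (integrable_lty measurableT iU).
    by move=> t; rewrite /risk_bound (EFinM (coef t)) fineK // unlock.
  - move=> t ht; rewrite /risk_bound /risk unlock.
    by have := le_bound t ht; rewrite /bound_coef rk.
have third mu Sigma : parameter r mu Sigma ->
    (risk P X (EM2 r) mu Sigma <= risk P X (EM1 r) mu Sigma)%E.
  move=> par; have [fin [u u0 bE] le] := facts _ _ par.
  apply: le_trans (le _ (or_introl topt_ge0)) _.
  rewrite bE; apply: geeDl; rewrite lee_fin coef_opt mulNr oppr_le0.
  apply: mulr_ge0; last exact: ltW.
  apply: mulr_ge0; first exact: ltW.
  by do 2 (apply: mulr_ge0 => //); rewrite subr_ge0.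
split=> //.
- by move=> t ht mu Sigma par; have [_ _] := facts _ _ par; exact.
- move=> mu Sigma par t tne; have [fin [u u0 bE] _] := facts _ _ par.
  rewrite !bE lteD2lE // lte_fin ltr_pM2r // -subr_gt0 coefB.
  apply: mulr_gt0 => //; apply: mulr_gt0 => //.
  by rewrite exprn_even_gt0 //= subr_eq0.
- move=> r_gt1; split=> //.
  have rp : (r <= p)%N by apply: ltnW; exact: leq_trans r_lt (geq_minr _ _).
  have par := parameter_pid_mx R rp.
  exists 0, (pid_mx r); split=> //; have [fin [u u0 bE] le] := facts _ _ par.
  apply: le_lt_trans (le _ (or_introl topt_ge0)) _.
  (* For [1 < r] both [r - 1] and [t_opt] are positive; at [r = 1] this coefficient would be 0. *)
  have h : coef (t_opt R n r) * u < 0.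
    have r1_gt0 : 0 < r%:R - 1 :> R by rewrite subr_gt0 ltr1n.
    have topt_gt0 : 0 < t_opt R n r.
      by rewrite /t_opt -/a; apply: mulr_gt0 => //; exact: divr_gt0.
    by rewrite coef_opt mulNr oppr_lt0; do 3 (apply: mulr_gt0 => //); exact: mulr_gt0.
  by rewrite bE -(fineK fin) -EFinD lte_fin gtrDl.
Qed.
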